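(* Let $q_n$ denote the $n$-th positive integer that is a product of exactly two distinct primes. Suppose that Hypotheses $BV(\theta)$ and $BV_2(\theta)$ (defined in the context) are both true for some $\theta$ with \[ \frac{75-\sqrt{473}}{56}=0.950918\ldots<\theta\le 1 . \] Then $\liminf_{n\to\infty}(q_{n+1}-q_n)\le 6$.
   Context: Let $\varpi(n)=\log n$ if $n$ is prime and $\varpi(n)=0$ otherwise, and let $\varpi*\varpi(n)=\sum_{d\mid n}\varpi(d)\varpi(n/d)$. For $(a,q)=1$, define $E(x;q,a)$ by $\sum_{x<n\le 2x,\ n\equiv a \,(\mathrm{mod}\, q)}\varpi(n)=\frac{x}{\phi(q)}+E(x;q,a)$. Set $E(x,q)=\max_{(a,q)=1}|E(x;q,a)|$ and $E^*(N,q)=\max_{x\le N}E(x,q)$. Let $C_0=2\log 2-2\gamma-1-2\sum_p\frac{\log p}{p(p-1)}$, where $\gamma$ is Euler's constant. For $(a,r)=1$, define $E_2(x;r,a)$ by \[ \sum_{x<n\le 2x,\ n\equiv a\,(\mathrm{mod}\, r)}\varpi*\varpi(n)=\frac{x}{\phi(r)}\Big(\log x+C_0-2\sum_{p\mid r}\frac{\log p}{p}\Big)+E_2(x;r,a). \] Set $E_2(x,r)=\max_{(a,r)=1}|E_2(x;r,a)|$ and $E_2^*(N,r)=\max_{x\le N}E_2(x,r)$. For $1/2<\theta\le 1$: - Hypothesis $BV(\theta)$ asserts that for every $A>0$ and $\epsilon>0$, $\sum_{q\le N^{\theta-\epsilon}}E^*(N,q)\ll_{A,\epsilon}N(\log N)^{-A}$.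 - Hypothesis $BV_2(\theta)$ asserts the same bound with $E_2^*(N,q)$ in place of $E^*(N,q)$. *)

(* Defs.v *)
From mathcomp Require Import all_boot all_order all_algebra.
From mathcomp Require Import all_classical all_reals all_analysis.
Set Implicit Arguments. Unset Strict Implicit. Unset Printing Implicit Defensive.
Import Order.TTheory GRing.Theory Num.Theory.
Local Open Scope ring_scope.
Local Open Scope classical_set_scope.

Section Defs.
Variable R : realType.

Definition varpi (n : nat) : R := if prime n then ln (n%:R) else 0.

Definition varpi2 (n : nat) : R :=
  \sum_(d < n.+1 | (d %| n)%N) varpi d * varpi (n %/ d).

Definition sum_ap (f : nat -> R) (x : R) (q a : nat) : R :=
  \sum_(n < (Num.truncn (2 * x)).+1 |
          (x < n%:R) && (n%:R <= 2 * x) && (n == a %[mod q])%N) f n.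

Definition Eqa (x : R) (q a : nat) : R :=
  sum_ap varpi x q a - x / (totient q)%:R.

Definition Eq (x : R) (q : nat) : R :=
  \big[Num.max/0]_(a < q | coprime a q) `|Eqa x q a|.

Definition Estar (N : R) (q : nat) : R :=
  sup [set Eq x q | x in [set x : R | 0 < x <= N]].

Definition euler_gamma : R :=
  limn (fun n : nat => \sum_(1 <= k < n.+1) (k%:R)^-1 - ln (n%:R)).

Definition C0 : R :=
  2 * ln 2 - 2 * euler_gamma - 1
  - 2 * limn (fun m : nat =>
              \sum_(p < m | prime p) ln (p%:R) / (p%:R * (p%:R - 1))).

Definition E2qa (x : R) (r a : nat) : R :=
  sum_ap varpi2 x r a
  - x / (totient r)%:R *
      (ln x + C0 - 2 * \sum_(p < r.+1 | prime p && (p %| r)%N) ln (p%:R) / p%:R).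

Definition E2q (x : R) (r : nat) : R :=
  \big[Num.max/0]_(a < r | coprime a r) `|E2qa x r a|.

Definition E2star (N : R) (r : nat) : R :=
  sup [set E2q x r | x in [set x : R | 0 < x <= N]].

Definition sum_moduli (F : R -> nat -> R) (N theta eps : R) : R :=
  \sum_(q < (Num.truncn (N `^ (theta - eps))).+1 |
          (0 < q)%N && (q%:R <= N `^ (theta - eps))) F N q.

Definition BV_hyp (F : R -> nat -> R) (theta : R) : Prop :=
  forall A eps : R, 0 < A -> 0 < eps ->
    exists C N0 : R, forall N : R, N0 <= N ->
      sum_moduli F N theta eps <= C * (N / (ln N `^ A)).

Definition BV (theta : R) : Prop := BV_hyp Estar theta.
Definition BV2 (theta : R) : Prop := BV_hyp E2star theta.

End Defs.

Definition isE2 (m : nat) : bool :=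
  [exists p : 'I_m.+1, [exists p' : 'I_m.+1,
     [&& prime p, prime p', (p < p')%N & (m == p * p')%N]]].

(* q_n : the n-th (starting from n = 0) such number, i.e. the unique
   E2 number m with exactly n E2 numbers below it *)
Definition qE2 (n : nat) : nat :=
  xget 0%N [set m : nat | isE2 m && (count isE2 (iota 0 m) == n)].

(* Main.v *)
(* Six linear forms: with W divisible by 4, 9, 25, 49 and v chosen suitably modulo W, every
   n = v mod W satisfies n + h_i = a_i L_i for (h_i) = (0,1,2,4,5,6), (a_i) = (3,2,5,7,2,3),
   where L_i is coprime to W. If two of the L_i are prime, two products of two distinct primes
   lie within distance 6. So it suffices to run a Maynard-type sieve with k = 6 on L_1,...,L_6.

   Let w(n) be a Selberg weight of level Z = N^(theta/2 - eps) attached to a function F on the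
   simplex {sum t <= 1}, and suppose that no n in (N, 2N] makes two of the L_i prime. Then
   the sum over i of sum (log L_i) [L_i prime] w(n)^2 is at most log N * sum w(n)^2. Up to a common
   factor the right side is at most log N * I with I the integral of F^2, and by BV the left
   side is at least 6 J log Z, with J the integral of (int F dt_m)^2. For
   F = y + 4 y^2 + q, y = 1 - sum t, q = sum t^2, one gets I = 29/60480 and J = 1/5940, so that
   6 J theta / 2 > I as soon as theta > 319/336; and 319/336 < (75 - sqrt 473)/56.

   The quadratic forms are treated locally: primes in (D, Z] are assigned colours (the index i
   with p | L_i, or none), the weight is a combination of products over p of functions psi_p,
   and after completing each local factor by auxiliary points the Gram matrix becomes diagonal,
   which gives an upper bound for sum w^2 and, dropping the auxiliary points, a lower bound
   for the sum over primes. *)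
Require Import Defs.
From mathcomp Require Import all_boot all_order all_algebra.
From mathcomp Require Import all_classical all_reals all_analysis.
From mathcomp Require Import zify ring lra.
Import Order.TTheory GRing.Theory Num.Theory.
Set Implicit Arguments. Unset Strict Implicit. Unset Printing Implicit Defensive.
Local Open Scope ring_scope.

(** * Gram matrices and colourings *)

(** The obstacle is that tuples of integers whose entries share a prime or contain a square do not
    come from colourings. Primes up to a constant [D] are therefore put into [W]; each defect then
    costs a sum of [p ^- 2] over [p > D], that is [O(1 / D)] times the main term. [D] depends only
    on the surplus in theta and is fixed before the scale [X], so [W] is a constant and every loss
    depending on [W] is harmless. What remains are sums over all tuples of integers coprime to [W],
    where the coordinates are independent and partial summation suffices. That [a_i] divides
    [W / a_i] keeps [L_i] coprime to [a_i] and gives [phi(W) = a_i phi(W / a_i)], so that the six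
    sums over primes have the same main term [X / phi(W)]. Two primes among the six forms require
    [6 J / I > 2 / theta]; the chosen [F] gives [6 J / I = 672 / 319]. As [F] is a polynomial in [y]
    and [q], both integrals are Dirichlet integrals and rational. *)

Section Gram.
Variables (R : realFieldType) (T I S : finType).
Implicit Types (y : {ffun T -> I} -> R) (rho : T -> S -> R) (f : T -> I -> S -> R).

Lemma sum_prod_ffun (g : T -> S -> R) :
  \sum_(X : {ffun T -> S}) \prod_p g p (X p) = \prod_p \sum_s g p s.
Proof. by rewrite bigA_distr_bigA. Qed.

(** Weights and functions are products over the primes, so the Gram matrix of the form in [y] is a
    product of local ones. Two models with the same local Gram matrices have the same form, whatever
    their point sets [S]; this is what allows auxiliary points. *)
Lemma gram_expansion y rho f :
  \sum_(X : {ffun T -> S}) (\prod_p rho p (X p)) *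
      (\sum_r y r * \prod_p f p (r p) (X p)) ^+ 2 =
  \sum_r \sum_r' y r * y r' *
      \prod_p \sum_s rho p s * (f p (r p) s * f p (r' p) s).
Proof.
under eq_bigr => X _.
  rewrite expr2 big_distrlr /= big_distrr /=.
  under eq_bigr => r _ do rewrite big_distrr /=.
over.
rewrite exchange_big /=; apply: eq_bigr => r _.
rewrite exchange_big /=; apply: eq_bigr => r' _.
rewrite -sum_prod_ffun big_distrr /=; apply: eq_bigr => X _.
rewrite !big_split /=; ring.
Qed.

End Gram.

Section Colouring.
Variables (T K : finType) (pi : T -> nat).
Hypotheses (prime_pi : forall p, prime (pi p)) (pi_inj : injective pi).
Implicit Types r : {ffun T -> option K}.

(* A colouring [r] of the primes [pi p] encodes the tuple of coprime squarefree integers whose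
   i-th entry [colour_part r i] is the product of the primes of colour [Some i]. *)
Definition colour_part r (i : K) : nat := (\prod_(p | r p == Some i) pi p)%N.
Definition colour_norm r : nat := (\prod_(p | r p != None) pi p)%N.

Lemma prime_dvd_prod (P : pred T) p : (pi p %| \prod_(q | P q) pi q)%N = P p.
Proof.
apply/idP/idP => [|Pp]; last by rewrite (bigD1 p) //= dvdn_mulr.
elim/big_rec: _ => [|q n Pq IH]; first by rewrite dvdn1 => /eqP p1; have := prime_pi p; rewrite p1.
rewrite Euclid_dvdM // => /orP[|//].
by rewrite dvdn_prime2 // => /eqP /pi_inj ->.
Qed.

Lemma prime_dvd_colour_part r i p : (pi p %| colour_part r i)%N = (r p == Some i).
Proof. exact: prime_dvd_prod. Qed.

Lemma prodpi_gt0 (P : pred T) : (0 < \prod_(q | P q) pi q)%N.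
Proof. by rewrite prodn_cond_gt0 // => q _; rewrite prime_gt0. Qed.

Lemma colour_part_gt0 r i : (0 < colour_part r i)%N. Proof. exact: prodpi_gt0. Qed.
Lemma colour_norm_gt0 r : (0 < colour_norm r)%N. Proof. exact: prodpi_gt0. Qed.

Lemma colour_part_inj r r' : colour_part r =1 colour_part r' -> r = r'.
Proof.
move=> E; apply/ffunP => p.
have H i : (r p == Some i) = (r' p == Some i).
  by rewrite -!prime_dvd_colour_part E.
case: (r p) (r' p) H => [i|] [j|] // H.
- by have := H i; rewrite eqxx => /esym/eqP ->.
- by have := H i; rewrite eqxx.
- by have := H j; rewrite eqxx.
Qed.

Lemma colour_normE r : colour_norm r = (\prod_i colour_part r i)%N.
Proof.
rewrite /colour_norm (eq_bigr (fun p => \prod_(i | r p == Some i) pi p)%N).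
  rewrite (exchange_big_dep xpredT) //=.
  apply: eq_bigr => i _; rewrite /colour_part; apply: eq_bigl => p.
  by case: (r p).
by move=> p; case: (r p) => // i _; rewrite (big_pred1 i) // => j; rewrite /= eq_sym.
Qed.

Lemma colour_part_le r i : (colour_part r i <= colour_norm r)%N.
Proof.
rewrite colour_normE (bigD1 i) //= leq_pmulr //.
by rewrite prodn_cond_gt0 // => j _; exact: colour_part_gt0.
Qed.

Lemma coprime_prodpi W (P : pred T) : (forall p, coprime (pi p) W) ->
  coprime (\prod_(q | P q) pi q) W.
Proof.
move=> cW; elim/big_rec: _ => [|q n _ IH]; first by rewrite coprime1n.
by rewrite coprimeMl cW.
Qed.

Lemma prodpi_inj (P Q : pred T) :
  (\prod_(q | P q) pi q = \prod_(q | Q q) pi q)%N -> P =1 Q.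
Proof. by move=> E p; rewrite -[LHS]prime_dvd_prod E prime_dvd_prod. Qed.

End Colouring.

Lemma sum_inj_le (R : numDomainType) (I J : finType) (P : pred I) (h : I -> J) (G : J -> R) :
  {in P &, injective h} -> (forall j, 0 <= G j) ->
  \sum_(i | P i) G (h i) <= \sum_j G j.
Proof.
move=> hI G0; have -> : \sum_(i | P i) G (h i) = \sum_(i in finset P) G (h i).
  by apply: eq_bigl => i; rewrite finset.inE.
rewrite -(@big_imset _ _ _ _ _ h (mem (finset P)) G) /=.
  by rewrite [leRHS](bigID (mem (imset h (mem (finset P))))) /= lerDl sumr_ge0.
by move=> i j; rewrite !finset.inE; exact: hI.
Qed.

Lemma logn_coprime_prime p m : prime p -> ~~ (p %| m)%N -> logn p m = 0%N.
Proof. by move=> pp /negbTE pm; rewrite lognE pm !andbF. Qed.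

(** * Harmonic weights on tuples of integers coprime to [W] *)

Section Weights.
Variables (R : realFieldType) (Z W : nat) (K : finType).
Local Notation V := 'I_Z.+1.

(** The index 0 gets weight 0, its inverse being 0 by convention, so sums over ['I_Z.+1] are really
    sums over 1, ..., [Z]. *)
Definition cw (u : nat) : R := if coprime u W then u%:R^-1 else 0.
Definition mass : R := \sum_(u : V) cw u.

Lemma cw_ge0 u : 0 <= cw u.
Proof. by rewrite /cw; case: ifP => // _; rewrite invr_ge0 ler0n. Qed.

Lemma mass_ge0 : 0 <= mass. Proof. by rewrite sumr_ge0 // => u _; exact: cw_ge0. Qed.

Lemma cw_mul d u : cw (d * u) <= cw u / d%:R.
Proof.
rewrite /cw coprimeMl; case: (coprime d W) => /=.
  by case: ifP => //= _; rewrite ?mul0r // natrM invfM mulrC.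
by rewrite mulr_ge0 ?invr_ge0 ?ler0n // -/(cw u) cw_ge0.
Qed.

Lemma sum_cw_dvd d : (0 < d)%N ->
  \sum_(u : V | (d %| u)%N) cw u <= mass / d%:R.
Proof.
move=> d0; pose h (u : V) : V := inord (u %/ d).
have hle (u : V) : (u %/ d < Z.+1)%N.
  by rewrite (leq_ltn_trans (leq_div u d)) // ltn_ord.
apply: (@le_trans _ _ (\sum_(u : V | (d %| u)%N) cw (h u) / d%:R)).
  by apply: ler_sum => u du; rewrite inordK // -{1}(divnK du) mulnC cw_mul.
rewrite -mulr_suml ler_wpM2r ?invr_ge0 ?ler0n //.
apply: sum_inj_le; last by move=> *; exact: cw_ge0.
move=> u v; rewrite !unfold_in => du dv /(congr1 val); rewrite /= !inordK // => E.
by apply: val_inj; rewrite /= -(divnK du) -(divnK dv) E.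
Qed.

Variable A : {set K}.

(** Coordinates outside [A] are pinned to 1 instead of being dropped, so that the full sum and the
    sum with one coordinate removed run over the same type of tuples. *)
Definition wt (i : K) (v : nat) : R := if i \in A then cw v else (v == 1%N)%:R.
Definition twt (u : {ffun K -> V}) : R := \prod_i wt i (u i).

Lemma wt_ge0 i v : 0 <= wt i v.
Proof. by rewrite /wt; case: ifP => _; [exact: cw_ge0 | rewrite ler0n]. Qed.

Lemma twt_ge0 u : 0 <= twt u.
Proof. by apply: prodr_ge0 => i _; exact: wt_ge0. Qed.

Hypothesis Z_gt0 : (0 < Z)%N.

Lemma sum_one : \sum_(v : V) ((v : nat) == 1%N)%:R = 1 :> R.
Proof.
rewrite (bigD1 (inord 1)) //= inordK ?ltnS // eqxx big1 ?addr0 // => v /eqP v1.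
case: eqP => // E; case: v1; apply: val_inj; by rewrite /= inordK ?ltnS.
Qed.

Lemma sum_twt : \sum_u twt u = mass ^+ #|A|.
Proof.
rewrite (sum_prod_ffun (fun i (v : V) => wt i v)) -prodr_const [RHS]big_mkcond /=.
apply: eq_bigr => i _; rewrite /wt; case: ifP => _ //; exact: sum_one.
Qed.

Lemma sum_twt_dvd (B : {set K}) d : (1 < d)%N ->
  \sum_(u : {ffun K -> V} | [forall i in B, (d %| u i)%N]) twt u <= mass ^+ #|A| / d%:R ^+ #|B|.
Proof.
move=> d1; have d0 : (0 < d)%N by apply: ltnW.
pose g i (v : V) : R := if i \in B then (if (d %| v)%N then wt i v else 0) else wt i v.
have -> : \sum_(u : {ffun K -> V} | [forall i in B, (d %| u i)%N]) twt u =
          \sum_(u : {ffun K -> V}) \prod_i g i (u i).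
  rewrite big_mkcond; apply: eq_bigr => u _.
  case: ifP => [/forallP H | /negbT].
    by apply: eq_bigr => i _; rewrite /g; case: ifP => // iB; have := H i; rewrite iB /= => ->.
  rewrite negb_forall => /existsP[i]; rewrite negb_imply => /andP[iB di].
  by rewrite (bigD1 i) //= /g iB (negbTE di) mul0r.
rewrite sum_prod_ffun -exprVn -!prodr_const 2![X in _ <= X * _]big_mkcond /=.
rewrite [X in _ <= _ * X]big_mkcond -big_split /=.
apply: ler_prod => i _; apply/andP; split.
  by apply: sumr_ge0 => v _; rewrite /g; case: ifP => _ //; [case: ifP => // _|]; exact: wt_ge0.
rewrite /g /wt; case: (i \in B); case: (i \in A); rewrite ?mulr1 ?mul1r.
- by rewrite -big_mkcond /= sum_cw_dvd.
(* Here the coordinate is pinned to 1, which [d > 1] does not divide. *)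
- rewrite big1 ?invr_ge0 ?ler0n // => v _; case: ifP => // dv.
  case: eqP => // v1; move: dv; rewrite v1 dvdn1 => /eqP E; by rewrite E in d1.
- by [].
- by rewrite sum_one.
Qed.

End Weights.

Section ColouringWeights.
Variables (R : realFieldType) (Z W : nat) (T K : finType) (pi : T -> nat).
Hypotheses (prime_pi : forall p, prime (pi p)) (pi_inj : injective pi).
Hypothesis (pi_W : forall p, coprime (pi p) W).
Implicit Types (r : {ffun T -> option K}) (A : {set K}).
Local Notation V := 'I_Z.+1.

Definition colour_tuple r : {ffun K -> V} := [ffun i => inord (colour_part pi r i)].

Lemma colour_tupleE r i : (colour_norm pi r <= Z)%N ->
  colour_tuple r i = colour_part pi r i :> nat.
Proof.
by move=> H; rewrite ffunE inordK // ltnS (leq_trans _ H) // colour_part_le.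
Qed.

Lemma colour_tuple_inj : {in [pred r | (colour_norm pi r <= Z)%N] &, injective colour_tuple}.
Proof.
move=> r r' Hr Hr' E; apply: (colour_part_inj prime_pi pi_inj) => i.
by rewrite -!colour_tupleE // E.
Qed.

Lemma twt_colour_tuple A r : (colour_norm pi r <= Z)%N ->
  (forall p i, r p = Some i -> i \in A) ->
  twt R W A (colour_tuple r) = (colour_norm pi r)%:R^-1.
Proof.
move=> Hr HA; rewrite colour_normE natr_prod -prodfV; apply: eq_bigr => i _.
rewrite colour_tupleE // /wt; case: ifP => iA.
  by rewrite /cw coprime_prodpi.
suff -> : colour_part pi r i = 1%N by rewrite eqxx invr1.
rewrite /colour_part big1 // => p /eqP rp; by rewrite (HA p i rp) in iA.
Qed.

(** Colourings inject into tuples, with image among the squarefree and pairwise coprime ones. For a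
    nonnegative [G] the other tuples only increase the sum, and dropping the coprimality conditions
    decouples the coordinates. *)
Lemma sum_colour_le A (P : pred {ffun T -> option K}) (G : {ffun K -> V} -> R) :
  (forall u, 0 <= G u) ->
  (forall r, P r -> (colour_norm pi r <= Z)%N) ->
  (forall r p i, P r -> r p = Some i -> i \in A) ->
  \sum_(r | P r) (colour_norm pi r)%:R^-1 * G (colour_tuple r) <=
  \sum_u twt R W A u * G u.
Proof.
move=> G0 HP HA.
rewrite (eq_bigr (fun r => (fun u => twt R W A u * G u) (colour_tuple r))).
  apply: (@sum_inj_le _ _ _ P colour_tuple (fun u => twt R W A u * G u)).
    by move=> r r' Pr Pr'; apply: colour_tuple_inj; rewrite inE; apply: HP.
  by move=> u; rewrite mulr_ge0 // twt_ge0.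
move=> r Pr; rewrite twt_colour_tuple //; first exact: HP.
by move=> p i; exact: HA.
Qed.

Hypothesis pi_surj : forall q, prime q -> (q <= Z)%N -> coprime q W -> exists p, pi p = q.

Lemma logn_prodpi (P : pred T) p : logn (pi p) (\prod_(q | P q) pi q) = P p.
Proof.
have [Pp|nPp] := boolP (P p).
  rewrite (bigD1 p) //= lognM ?(prodpi_gt0 prime_pi) ?prime_gt0 //.
  rewrite (logn_prime (pi p) (prime_pi p)) eqxx.
  rewrite (logn_coprime_prime (prime_pi p)) //.
  by rewrite (prime_dvd_prod prime_pi pi_inj) /= eqxx andbF.
by rewrite logn_coprime_prime // (prime_dvd_prod prime_pi pi_inj).
Qed.

Lemma prodpi_squarefree u : (0 < u)%N -> (u <= Z)%N -> coprime u W ->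
  (forall p, ~~ (pi p ^ 2 %| u)%N) -> (\prod_(p | pi p %| u) pi p)%N = u.
Proof.
move=> u0 uZ cu sf; apply: eqn_from_log => //; first exact: prodpi_gt0.
move=> q /=; have [pq|npq] := boolP (prime q); last by rewrite lognE [RHS]lognE (negbTE npq).
have [qu|nqu] := boolP (q %| u)%N; last first.
  rewrite !logn_coprime_prime //; apply/negP => /= /(elimT idP).
  have : ~~ (q %| u)%N by [].
  move=> /negP nq; elim/big_rec: _ => [|p n pu IH].
    by rewrite dvdn1 => /eqP q1; rewrite q1 in pq.
  rewrite Euclid_dvdM // => /orP[|//]; rewrite dvdn_prime2 // => /eqP qp.
  by apply: nq; rewrite qp.
have [p pE] : exists p, pi p = q.
  apply: pi_surj => //; first by rewrite (leq_trans _ uZ) // dvdn_leq.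
  by apply: coprime_dvdl qu cu.
subst q; rewrite logn_prodpi qu.
have : (0 < logn (pi p) u)%N by rewrite logn_gt0 mem_primes pq u0 qu.
have : (logn (pi p) u < 2)%N.
  by rewrite ltnNge; apply/negP => H; have := sf p; rewrite pfactor_dvdn // H.
by case: (logn (pi p) u) => [|[|?]].
Qed.

(** Converse of the injection used in [sum_colour_le]: a tuple fails to come from a colouring only
    through a square factor or a prime common to two entries. *)
Lemma colour_surj A (u : {ffun K -> V}) : (\prod_i u i <= Z)%N ->
  (forall i, i \in A -> (0 < u i)%N && coprime (u i) W) ->
  (forall i, i \notin A -> u i = 1%N :> nat) ->
  (forall p i, ~~ (pi p ^ 2 %| u i)%N) ->
  (forall p i j, (pi p %| u i)%N -> (pi p %| u j)%N -> i = j) ->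
  exists r, [/\ (colour_norm pi r <= Z)%N, colour_tuple r = u &
                forall p i, r p = Some i -> i \in A].
Proof.
move=> uZ uA unA sf cop.
pose r : {ffun T -> option K} := [ffun p => [pick i | (pi p %| u i)%N]].
have rE p i : (r p == Some i) = (pi p %| u i)%N.
  rewrite ffunE; case: pickP => [j pj|H]; last by rewrite H.
  apply/eqP/idP => [[<-] //|pu]; by rewrite (cop p j i pj pu).
have ci i : (0 < u i)%N && coprime (u i) W.
  by have [/uA//|/unA ->] := boolP (i \in A); rewrite coprime1n.
have ui i : (u i <= Z)%N by rewrite -ltnS ltn_ord.
have cE i : colour_part pi r i = u i.
  rewrite /colour_part (eq_bigl _ _ (fun p => rE p i)).
  by have /andP[u0 uW] := ci i; apply: prodpi_squarefree.
have rZ : (colour_norm pi r <= Z)%N.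
  by rewrite colour_normE (eq_bigr (fun i => u i : nat)).
exists r; split => //.
  by apply/ffunP => i; apply: val_inj; rewrite /= colour_tupleE.
move=> p i /eqP; rewrite rE => pu; apply: contraT => /unA u1.
by have := prime_pi p; move: pu; rewrite u1 dvdn1 => /eqP ->.
Qed.

End ColouringWeights.

Lemma sum_option (R : nmodType) (K : finType) (F : option K -> R) :
  \sum_x F x = F None + \sum_i F (Some i).
Proof.
rewrite (bigD1 None) //=; congr (_ + _).
rewrite (eq_bigl (fun x => x \in imset Some (mem K))).
  by rewrite big_imset //= => i j _ _ [].
by case=> [i|] /=; [rewrite imset_f | apply/esym/negbTE/imsetP=> -[]].
Qed.

(** * Local models *)

Section Model.
Variables (R : realFieldType) (T K : finType) (pi : T -> nat).
Hypotheses (prime_pi : forall p, prime (pi p)) (pi_inj : injective pi).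
Hypothesis pi_gt : forall p, (#|K| < pi p)%N.
Local Notation col := (option K).
Local Notation colouring := {ffun T -> option K}.
Local Notation ip p := ((pi p)%:R^-1 : R).
Local Notation iq p := (((pi p)%:R - 1)^-1 : R).
Local Notation k := (#|K|%:R : R).

Lemma sum_delta (a : K) (F : K -> R) : \sum_i (i == a)%:R * F i = F a.
Proof.
rewrite (bigD1 a) //= eqxx mul1r big1 ?addr0 // => i /negbTE ->.
by rewrite mul0r.
Qed.

Lemma pi_gt1 p : 1 < (pi p)%:R :> R.
Proof. by rewrite ltr1n prime_gt1. Qed.

Lemma pi_geK p : k + 1 <= (pi p)%:R.
Proof. by rewrite natr1 ler_nat pi_gt. Qed.

Definition incl (d x : col) : bool := (d == None) || (d == x).
Definition sub_ind (d X : colouring) : R := \prod_p (incl (d p) (X p))%:R.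

(* [X p = Some i] stands for the event that [pi p] divides the i-th linear form. *)
Definition psi p (r x : col) : R := if r is Some i then (x == Some i)%:R - ip p else 1.
Definition sieve_weight (y : colouring -> R) (X : colouring) : R :=
  \sum_r y r * \prod_p psi p (r p) (X p).

(** Change of basis from the centred functions [psi] to the indicators [incl d]. The resulting
    [lambda] are the usual Selberg divisor weights, which govern the error terms, while the [y] are
    the diagonalising variables. *)
Definition psi_coef p (r d : col) : R :=
  if r is Some i then (if d is None then - ip p else (d == Some i)%:R) else (d == None)%:R.
Definition lambda (y : colouring -> R) (d : colouring) : R :=
  \sum_r y r * \prod_p psi_coef p (r p) (d p).

Lemma psi_coefE p r x : psi p r x = \sum_d psi_coef p r d * (incl d x)%:R.
Proof.
rewrite sum_option; case: r => [i|] /=; last first.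
  by rewrite mulr1 big1 ?addr0 // => j _; rewrite mul0r.
rewrite mulr1 addrC (eq_bigr (fun j => (j == i)%:R * (Some j == x)%:R)).
  by rewrite sum_delta eq_sym.
by move=> j _; rewrite (inj_eq Some_inj).
Qed.

Lemma sieve_weightE y X : sieve_weight y X = \sum_d lambda y d * sub_ind d X.
Proof.
rewrite /sieve_weight /lambda.
under [RHS]eq_bigr => d _ do rewrite mulr_suml.
rewrite exchange_big /=; apply: eq_bigr => r _.
rewrite (eq_bigr (fun p => \sum_d psi_coef p (r p) d * (incl d (X p))%:R)); last first.
  by move=> p _; rewrite psi_coefE.
rewrite bigA_distr_bigA big_distrr /=; apply: eq_bigr => d _.
by rewrite big_split /= mulrA.
Qed.

Lemma model_expand (w : T -> col -> R) y :
  \sum_(X : colouring) (\prod_p w p (X p)) * sieve_weight y X ^+ 2 =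
  \sum_d \sum_e lambda y d * lambda y e *
     \prod_p \sum_x w p x * ((incl (d p) x)%:R * (incl (e p) x)%:R).
Proof.
rewrite -(gram_expansion _ w (fun p d x => (incl d x)%:R)).
by apply: eq_bigr => X _; rewrite sieve_weightE.
Qed.

(** The total mass 1 eliminates [w None], so the second moments depend only on the values
    [w (Some i)]. *)
Lemma psi_moment p (w : col -> R) r r' : w None + \sum_i w (Some i) = 1 ->
  \sum_x w x * (psi p r x * psi p r' x) =
  match r, r' with
  | None, None => 1
  | Some a, None => w (Some a) - ip p
  | None, Some a => w (Some a) - ip p
  | Some a, Some b => (a == b)%:R * w (Some a) - (w (Some a) + w (Some b)) * ip p + ip p ^+ 2
  end.
Proof.
move=> Hw; have H1 a : \sum_i w (Some i) * ((Some i == Some a)%:R - ip p) =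
    w (Some a) - (\sum_i w (Some i)) * ip p.
  rewrite (eq_bigr (fun i => (i == a)%:R * w (Some i) - w (Some i) * ip p)).
    by rewrite sumrB sum_delta -mulr_suml.
  by move=> i _; rewrite (inj_eq Some_inj); ring.
have H2 a b : \sum_i w (Some i) * (((Some i == Some a)%:R - ip p) * ((Some i == Some b)%:R - ip p)) =
    (a == b)%:R * w (Some a) - (w (Some a) + w (Some b)) * ip p + (\sum_i w (Some i)) * ip p ^+ 2.
  rewrite (eq_bigr (fun i => (i == a)%:R * ((i == b)%:R * w (Some i)) -
      (i == a)%:R * (w (Some i) * ip p) - (i == b)%:R * (w (Some i) * ip p) + w (Some i) * ip p ^+ 2)).
    by rewrite big_split /= !sumrB !sum_delta -mulr_suml; ring.
  by move=> i _; rewrite !(inj_eq Some_inj); ring.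
rewrite sum_option; case: r r' => [a|] [b|] /=.
- rewrite H2; have -> : \sum_i w (Some i) = 1 - w None by rewrite -Hw; ring.
  by rewrite !sub0r; ring.
- under eq_bigr => i _ do rewrite mulr1.
  rewrite H1; have -> : \sum_i w (Some i) = 1 - w None by rewrite -Hw; ring.
  by rewrite !sub0r; ring.
- under eq_bigr => i _ do rewrite mul1r.
  rewrite H1; have -> : \sum_i w (Some i) = 1 - w None by rewrite -Hw; ring.
  by rewrite !sub0r; ring.
- rewrite !mulr1 -[RHS]Hw; congr (_ + _); by apply: eq_bigr => i _; rewrite !mulr1.
Qed.

(* Law of the event [X p] for a random integer; [density2] below is the law when the m-th linear
   form is known to be prime. *)
Definition density1 p (x : col) : R := if x is Some _ then ip p else 1 - k * ip p.

Lemma sum_diag (y : colouring -> R) (D : T -> col -> R) :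
  \sum_r \sum_r' y r * y r' * \prod_p (if r p == r' p then D p (r p) else 0) =
  \sum_r y r ^+ 2 * \prod_p D p (r p).
Proof.
apply: eq_bigr => r _; rewrite (bigD1 r) //= [X in _ + X]big1 ?addr0.
  by rewrite expr2; congr (_ * _); apply: eq_bigr => p _; rewrite eqxx.
move=> r' nr; have /existsP[p /negbTE np] : [exists p, r p != r' p].
  apply: contra_neqT nr => /existsPn H; apply/ffunP => p; apply/eqP.
  by rewrite eq_sym -[_ == _]negbK H.
by rewrite (bigD1 p) //= np mul0r mulr0.
Qed.

Lemma prod_ip (r : colouring) :
  \prod_p (if r p is Some _ then ip p else 1) = (colour_norm pi r)%:R^-1.
Proof.
rewrite /colour_norm natr_prod -prodfV [RHS]big_mkcond /=.
by apply: eq_bigr => p _; case: (r p).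
Qed.

(* One extra point, on which psi is [1 / p], turns the Gram matrix of the psi's into a
   diagonal matrix; the omitted squares have the right sign. *)
Lemma model1_upper (y : colouring -> R) :
  \sum_(X : colouring) (\prod_p density1 p (X p)) * sieve_weight y X ^+ 2 <=
  \sum_r y r ^+ 2 / (colour_norm pi r)%:R.
Proof.
pose rho p (x : option col) : R := if x is Some x then density1 p x else 1.
pose f p (r : col) (x : option col) : R :=
  if x is Some x then psi p r x else if r is Some _ then ip p else 0.
have d0 p x : 0 <= density1 p x.
  have := pi_geK p; have := pi_gt1 p => h1 h2.
  have p0 : 0 < (pi p)%:R :> R by lra.
  case: x => [i|] /=; first by rewrite invr_ge0 ltW.
  by rewrite subr_ge0 -[leRHS](divff (lt0r_neq0 p0)) ler_pM2r ?invr_gt0 //; lra.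
have := gram_expansion y rho f; set S := LHS => HS.
apply: (@le_trans _ _ S).
  pose h (X : colouring) : {ffun T -> option col} := [ffun p => Some (X p)].
  rewrite (eq_bigr (fun X => (fun X' : {ffun T -> option col} => (\prod_p rho p (X' p)) *
      (\sum_r y r * \prod_p f p (r p) (X' p)) ^+ 2) (h X))).
    apply: (sum_inj_le (P := xpredT)).
      by move=> X X' _ _ E; apply/ffunP => p; have := congr1 (fun g : {ffun T -> option col} => g p) E;
         rewrite !ffunE => -[].
    move=> X'; rewrite mulr_ge0 ?sqr_ge0 //; apply: prodr_ge0 => p _.
    by rewrite /rho; case: (X' p).
  move=> X _; congr (_ * _ ^+ 2); first by apply: eq_bigr => p _; rewrite ffunE.
  by apply: eq_bigr => r _; congr (_ * _); apply: eq_bigr => p _; rewrite ffunE.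
rewrite HS le_eqVlt; apply/orP; left; apply/eqP.
under [RHS]eq_bigr => r _ do rewrite -prod_ip.
rewrite -(sum_diag y (fun p c => if c is Some _ then ip p else 1)).
apply: eq_bigr => r _; apply: eq_bigr => r' _; congr (_ * _); apply: eq_bigr => p _.
rewrite sum_option.
rewrite /rho /f psi_moment /density1; last by rewrite sumr_const -[_ *+ #|_|]mulr_natl /=; ring.
case: (r p) (r' p) => [a|] [b|] //=; rewrite ?(inj_eq Some_inj) //.
- by case: eqP => _ /=; ring.
- by ring.
- by ring.
- by ring.
Qed.

Variable m : K.
Local Notation u i := ((i != m)%:R : R).
Definition density2 p (x : col) : R :=
  if x is Some i then u i * iq p else 1 - (k - 1) * iq p.

(* Under [density2] the local Gram matrix of the [psi] is the sum of the squares [diag2 * coef2 ^+ 2]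
   and of one square for each pair of colours different from [m]. *)
Definition diag2 p (x : col) : R :=
  if x is Some i then u i * (iq p - (k - 1) * iq p ^+ 2) else 1.
Definition coef2 p (s r : col) : R :=
  match s, r with
  | None, None => 1
  | None, Some i => u i * iq p - ip p
  | Some _, None => 0
  | Some i, Some j => (j == i)%:R
  end.

Lemma sum_u : \sum_i u i = k - 1.
Proof.
have : \sum_(i : K) (u i + (i == m)%:R * 1) = k.
  under eq_bigr => i _ do rewrite mulr1 -natrD addn_negb.
  by rewrite sumr_const.
by rewrite big_split /= sum_delta => <-; ring.
Qed.

Lemma diag2_ge0 p x : 0 <= diag2 p x.
Proof.
case: x => [i|] //=; rewrite mulr_ge0 ?ler0n //.
have := pi_geK p; have := pi_gt1 p => h1 h2.
have -> : iq p - (k - 1) * iq p ^+ 2 = ((pi p)%:R - k) * iq p ^+ 2 by field; lra.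
by rewrite mulr_ge0 ?sqr_ge0 //; lra.
Qed.

Lemma model2_lower (y : colouring -> R) :
  \sum_(s : colouring) (\prod_p diag2 p (s p)) *
     (\sum_r y r * \prod_p coef2 p (s p) (r p)) ^+ 2 <=
  \sum_(X : colouring) (\prod_p density2 p (X p)) * sieve_weight y X ^+ 2.
Proof.
pose S := (col + K * K)%type.
(* Under [density2] the indicators of two distinct colours other than [m] have covariance
   [- iq ^+ 2]. Squares of differences over ordered pairs, each of weight [iq ^+ 2 / 2], reproduce
   it; the diagonal they add is what [diag2] subtracts. The row [coef2 p None] is the mean of
   [psi]. *)
pose rho p (x : S) : R :=
  match x with inl x => diag2 p x | inr (i, j) => u i * u j * (iq p ^+ 2 / 2) end.
pose f p (r : col) (x : S) : R :=
  match x with inl x => coef2 p x r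
  | inr (i, j) => if r is Some a then (i == a)%:R - (j == a)%:R else 0 end.
have := gram_expansion y density2 (fun p => psi p); rewrite -/(sieve_weight _) => ->.
have E : \sum_r \sum_r' y r * y r' *
      \prod_p \sum_s density2 p s * (psi p (r p) s * psi p (r' p) s) =
   \sum_r \sum_r' y r * y r' *
      \prod_p \sum_s rho p s * (f p (r p) s * f p (r' p) s).
  apply: eq_bigr => r _; apply: eq_bigr => r' _; congr (_ * _); apply: eq_bigr => p _.
  rewrite psi_moment; last by rewrite /= -mulr_suml sum_u; ring.
  have := pi_gt1 p => h1.
  have pairE (F : K * K -> R) : \sum_ij F ij = \sum_i \sum_j F (i, j).
    by rewrite pair_bigA; apply: eq_bigr => -[].
  rewrite big_sumType /= sum_option pairE /=.
  case: (r p) (r' p) => [a|] [b|] /=.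
  - have -> : \sum_i \sum_j u i * u j * (iq p ^+ 2 / 2) *
       (((i == a)%:R - (j == a)%:R) * ((i == b)%:R - (j == b)%:R)) =
       ((k - 1) * u a * (a == b)%:R - u a * u b) * iq p ^+ 2.
      rewrite (eq_bigr (fun i => ((i == a)%:R * ((i == b)%:R * (u i * (k - 1)))
         - (i == a)%:R * (u i * u b) - (i == b)%:R * (u i * u a)
         + u i * ((a == b)%:R * u a)) * (iq p ^+ 2 / 2))).
        rewrite -mulr_suml big_split /= !sumrB !sum_delta -mulr_suml sum_u.
        by case: eqP => [->|_] /=; field; lra.
      move=> i _; rewrite (eq_bigr (fun j => ((i == a)%:R * ((i == b)%:R * u i) * u j
         - (j == b)%:R * ((i == a)%:R * (u i * u j)) - (j == a)%:R * ((i == b)%:R * (u i * u j))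
         + (j == a)%:R * ((j == b)%:R * (u i * u j))) * (iq p ^+ 2 / 2))).
        by rewrite -mulr_suml big_split /= !sumrB !sum_delta -mulr_sumr sum_u; ring.
      by move=> j _; ring.
    rewrite (eq_bigr (fun i => (i == a)%:R * ((i == b)%:R * (u i * (iq p - (k - 1) * iq p ^+ 2))))).
      rewrite sum_delta; by ring.
    by move=> i _; rewrite (eq_sym a) (eq_sym b); ring.
  - rewrite big1 => [|i _]; last by rewrite !mulr0.
    rewrite big1 => [|i _]; last by rewrite big1 // => j _; rewrite !mulr0.
    by ring.
  - rewrite big1 => [|i _]; last by rewrite mul0r mulr0.
    rewrite big1 => [|i _]; last by rewrite big1 // => j _; rewrite mul0r !mulr0.
    by ring.
  - rewrite big1 => [|i _]; last by rewrite mul0r mulr0.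
    rewrite big1 => [|i _]; last by rewrite big1 // => j _; rewrite mul0r !mulr0.
    by ring.
rewrite E -gram_expansion.
pose h (X : colouring) : {ffun T -> S} := [ffun p => inl (X p)].
rewrite (eq_bigr (fun X => (fun X' : {ffun T -> S} => (\prod_p rho p (X' p)) *
    (\sum_r y r * \prod_p f p (r p) (X' p)) ^+ 2) (h X))).
  apply: (sum_inj_le (P := xpredT)).
    by move=> X X' _ _ E'; apply/ffunP => p; have := congr1 (fun g : {ffun T -> S} => g p) E';
       rewrite !ffunE => -[].
  move=> X'; rewrite mulr_ge0 ?sqr_ge0 //; apply: prodr_ge0 => p _.
  rewrite /rho; case: (X' p) => [x|[i j]]; first exact: diag2_ge0.
  by rewrite !mulr_ge0 ?sqr_ge0 ?invr_ge0 ?ler0n ?subr_ge0 ?ler1n ?(ltnW (prime_gt1 _)) // prime_gt0.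
move=> X _; congr (_ * _ ^+ 2); first by apply: eq_bigr => p _; rewrite ffunE.
by apply: eq_bigr => r _; congr (_ * _); apply: eq_bigr => p _; rewrite ffunE.
Qed.

End Model.

Lemma prodr_ge_1Bsum (R : realFieldType) (I : finType) (P : pred I) (x : I -> R) :
  (forall i, P i -> 0 <= x i <= 1) ->
  1 - \sum_(i | P i) x i <= \prod_(i | P i) (1 - x i).
Proof.
(* Weierstrass' product inequality; the induction must carry the upper bound 1 and both signs
   along. *)
move=> H; suff : 1 - \sum_(i | P i) x i <= \prod_(i | P i) (1 - x i) <= 1 /\
  0 <= \prod_(i | P i) (1 - x i) /\ 0 <= \sum_(i | P i) x i by move=> [/andP[]].
elim/big_rec2: _ => [|i s t /H /andP[h1 h2] [/andP[h3 h4] [h5 h6]]].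
  by rewrite subr0 lexx ler01.
do ![split]; first (apply/andP; split); by nra.
Qed.

Lemma sum_image_ge (R : numDomainType) (I J : finType) (P : pred I) (h : I -> J) (G : J -> R)
  (Q : pred J) :
  {in P &, injective h} -> (forall j, 0 <= G j) ->
  (forall j, ~~ Q j -> G j != 0 -> exists2 i, P i & h i = j) ->
  \sum_j G j <= \sum_(i | P i) G (h i) + \sum_(j | Q j) G j.
Proof.
move=> hI G0 HQ; have -> : \sum_(i | P i) G (h i) = \sum_(j in imset h (mem (finset P))) G j.
  rewrite big_imset /=; first by apply: eq_bigl => i; rewrite finset.inE.
  by move=> i j; rewrite !finset.inE; exact: hI.
rewrite [leLHS](bigID Q) /= addrC lerD2r big_mkcond [leRHS]big_mkcond /=.
apply: ler_sum => j _; case: ifP => [nQ|_]; last by case: ifP.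
case: ifPn => // jh; have [->//|G1] := eqVneq (G j) 0.
have [i Pi ij] := HQ j nQ G1; case/imsetP: jh.
by exists i; rewrite ?finset.inE.
Qed.

(** * Selberg variables and their dual sums *)

Section Forms.
Variables (R : realFieldType) (Z W : nat) (T K : finType) (pi : T -> nat).
Hypotheses (prime_pi : forall p, prime (pi p)) (pi_inj : injective pi).
Hypothesis (pi_W : forall p, coprime (pi p) W).
Hypothesis K_gt1 : (1 < #|K|)%N.
Hypothesis pi_gt : forall p, (#|K| < pi p)%N.
Local Notation V := 'I_Z.+1.
Local Notation colouring := {ffun T -> option K}.
Local Notation ip p := ((pi p)%:R^-1 : R).
Local Notation iq p := (((pi p)%:R - 1)^-1 : R).
Local Notation k := (#|K|%:R : R).
Local Notation mass := (mass R Z W).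
Local Notation cw := (cw R W).
Local Notation tup := (colour_tuple Z pi).

Variable Y : {ffun K -> V} -> R.

(** The Moebius sign of the product of the coloured primes. It turns the entry [- ip] of [coef2] for
    colour [m] into [ip], so that the dual sum becomes a positive sum over the m-th coordinate. *)
Definition colour_sign (r : colouring) : R := \prod_p (if r p is Some _ then -1 else 1).
Definition colour_value (r : colouring) : R :=
  if (colour_norm pi r <= Z)%N then Y (tup r) else 0.
Definition signed_value r : R := colour_sign r * colour_value r.

Lemma colour_sign_sqr r : colour_sign r ^+ 2 = 1.
Proof.
rewrite /colour_sign -prodrXl big1 // => p _; case: (r p) => [_|]; by rewrite ?sqrrN expr1n.
Qed.

Lemma quadratic_form_upper :
  \sum_(X : colouring) (\prod_p density1 R pi p (X p)) * sieve_weight pi signed_value X ^+ 2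
  <= \sum_u twt R W [set: K] u * Y u ^+ 2.
Proof.
apply: (le_trans (model1_upper _ _ _)) => //.
rewrite (bigID (fun r => colour_norm pi r <= Z)%N) /= [X in _ + X]big1 ?addr0; last first.
  move=> r /negbTE nr; by rewrite /signed_value /colour_value nr mulr0 expr0n mul0r.
rewrite (eq_bigr (fun r => (colour_norm pi r)%:R^-1 * Y (tup r) ^+ 2)); last first.
  by move=> r rZ; rewrite /signed_value /colour_value rZ exprMn colour_sign_sqr mul1r mulrC.
apply: (sum_colour_le prime_pi pi_inj pi_W (G := fun u => Y u ^+ 2)) => // *.
  by rewrite sqr_ge0.
Qed.

Variable m : K.
Local Notation A := (~: [set m])%SET.

(** An uncoloured prime may acquire colour [m] at cost [1 / p], which is the main term, or another
    colour at cost [iq - ip], of order [p ^- 2]; the latter are collected in [extra]. *)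
Definition abs_coef p (s r : option K) : R :=
  match s, r with
  | None, None => 1
  | None, Some i => if i == m then ip p else iq p - ip p
  | Some _, None => 0
  | Some i, Some j => (j == i)%:R
  end.

Definition signed_coef p (s r : option K) : R :=
  match s, r with
  | None, Some i => if i == m then ip p else - (iq p - ip p)
  | _, _ => abs_coef p s r
  end.

Definition dual_value (s : colouring) : R :=
  \sum_r signed_value r * \prod_p coef2 R pi m p (s p) (r p).

Lemma dual_valueE s :
  colour_sign s * dual_value s = \sum_r colour_value r * \prod_p signed_coef p (s p) (r p).
Proof.
rewrite /dual_value mulr_sumr; apply: eq_bigr => r _.
rewrite /signed_value mulrCA -!mulrA mulrC -!mulrA; congr (_ * _).
rewrite mulrC -!big_split /=; apply: eq_bigr => p _.
case: (s p) (r p) => [i|] [j|] /=; [by ring|by ring| |by ring].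
by case: eqP => _ /=; ring.
Qed.

Definition extends (s r : colouring) : bool :=
  [forall p, if s p is Some _ then r p == s p else (r p == None) || (r p == Some m)].

Lemma iq_ip_ge0 p : 0 <= iq p - ip p.
Proof.
have := pi_gt1 R prime_pi p => h; rewrite subr_ge0 lef_pV2 ?posrE; lra.
Qed.

Lemma ip_gt0 p : 0 < ip p.
Proof. by rewrite invr_gt0 ltr0n prime_gt0. Qed.

Lemma abs_coef_ge0 p s r : 0 <= abs_coef p s r.
Proof.
case: s r => [i|] [j|] //=.
by case: ifP => _; [exact: ltW (ip_gt0 p) | exact: iq_ip_ge0].
Qed.

Lemma signed_prod_ge s r :
  (if extends s r then 1 else -1) * \prod_p abs_coef p (s p) (r p) <=
  \prod_p signed_coef p (s p) (r p).
Proof.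
case: ifP => [/forallP H|_].
  rewrite mul1r le_eqVlt; apply/orP; left; apply/eqP; apply: eq_bigr => p _.
  have := H p; case: (s p) (r p) => [i|] [j|] //= /eqP[->]; by rewrite eqxx.
have -> : \prod_p abs_coef p (s p) (r p) = `| \prod_p signed_coef p (s p) (r p) |.
  rewrite normr_prod; apply: eq_bigr => p _.
  have := abs_coef_ge0 p (s p) (r p); case: (s p) (r p) => [i|] [j|] /=.
  - by move=> /ger0_norm ->.
  - by move=> /ger0_norm ->.
  - by case: ifP => _ /ger0_norm; rewrite ?normrN => ->.
  - by move=> /ger0_norm ->.
by rewrite mulN1r lerNnormlW.
Qed.

Definition extra : R := \prod_p (1 + (k - 1) * (iq p - ip p)) - 1.

Lemma sum_subsets_le :
  \sum_(J : {set T} | (\prod_(p in J) pi p <= Z)%N) (\prod_(p in J) pi p)%:R^-1 <= mass.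
Proof.
pose h (J : {set T}) : V := inord (\prod_(p in J) pi p)%N.
rewrite (eq_bigr (fun J : {set T} => cw (h J))).
  apply: (@sum_inj_le _ _ _ (fun J : {set T} => \prod_(p in J) pi p <= Z)%N h (fun v : V => cw v)).
    move=> J J'; rewrite !unfold_in => HJ HJ' /(congr1 val); rewrite /= !inordK ?ltnS // => E.
    by apply/setP => p; have := prodpi_inj prime_pi pi_inj E p.
  by move=> j; exact: cw_ge0.
move=> J HJ; rewrite inordK ?ltnS // /cw coprime_prodpi //.
Qed.

Lemma K_geR : 1 <= k. Proof. by rewrite ler1n ltnW. Qed.

Lemma extra_factor_ge0 p : 0 <= (k - 1) * (iq p - ip p).
Proof. by rewrite mulr_ge0 ?iq_ip_ge0 // subr_ge0 K_geR. Qed.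

Lemma extra_ge0 : 0 <= extra.
Proof.
rewrite /extra subr_ge0; apply: (big_ind (fun x => 1 <= x)) => // [x y h1 h2|p _]; first by nra.
by rewrite lerDl extra_factor_ge0.
Qed.

Lemma sum_abs_coef_Some p (s : option K) : s != Some m ->
  \sum_(j | (j == Some m) == false) abs_coef p s j =
  1 + (s == None)%:R * ((k - 1) * (iq p - ip p)).
Proof.
move=> sm; rewrite big_mkcond sum_option /=.
case: s sm => [i|] im /=.
  rewrite mul0r addr0 add0r (eq_bigr (fun j => (j == i)%:R * (j != m)%:R)).
    by rewrite sum_delta; move: im; rewrite (inj_eq Some_inj) => ->.
  by move=> j _; rewrite (inj_eq Some_inj); case: (j == m); rewrite /= ?mulr1 ?mulr0.
rewrite mul1r; congr (_ + _).
rewrite (eq_bigr (fun j => (j != m)%:R * (iq p - ip p))).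
  by rewrite -mulr_suml sum_u.
by move=> j _; rewrite (inj_eq Some_inj); case: (j == m); rewrite /= ?mul1r ?mul0r.
Qed.

(** For a fixed set [H] of primes of colour [m] the sum over all colourings factorises and is at
    most [\prod_p b p * (1 + extra)]. Extending colourings already account for [\prod_p b p], which
    leaves [extra] times a quantity below the inverse of the product of [H]; summing over [H] gives
    [mass]. *)
Lemma sum_not_extends (s : colouring) : (forall p, s p != Some m) ->
  \sum_(r | (colour_part pi r m <= Z)%N && ~~ extends s r) \prod_p abs_coef p (s p) (r p)
  <= extra * mass.
Proof.
move=> sm; pose J (r : colouring) := (finset (fun p => r p == Some m)).
rewrite (partition_big J xpredT) //= mulrC.
apply: (@le_trans _ _ (\sum_(H : {set T} | (\prod_(p in H) pi p <= Z)%N)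
   (\prod_(p in H) pi p)%:R^-1 * extra)); last first.
  by rewrite -mulr_suml ler_wpM2r ?sum_subsets_le // extra_ge0.
rewrite [leRHS]big_mkcond; apply: ler_sum => H _.
case: ifPn => HZ; last first.
  rewrite big1 // => r /andP[/andP[rZ _] /eqP rH]; case/negP: HZ.
  by rewrite (leq_trans _ rZ) // /colour_part -rH /J; under eq_bigl => p do rewrite finset.inE.
pose Q p : pred (option K) := fun j => (j == Some m) == (p \in H).
pose Q' p : pred (option K) := fun j => if s p is Some _ then j == s p else
   (if p \in H then j == Some m else j == None).
(* Local factor of the one colouring that extends [s] with exactly [H] in colour [m]; it vanishes
   when [H] meets the support of [s]. *)
pose b p : R := if p \in H then (s p == None)%:R * ip p else 1.
have famQ : \prod_p \sum_(j | Q p j) abs_coef p (s p) j =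
   \sum_(r : colouring | J r == H) \prod_p abs_coef p (s p) (r p).
  rewrite bigA_distr_big_dep; apply: eq_bigl => r.
  apply/familyP/eqP => [Hr|HJ p]; last by rewrite unfold_in /Q -HJ finset.inE eqxx.
  by apply/setP => p; have := Hr p; rewrite unfold_in finset.inE => /eqP.
have b0 p : 0 <= b p.
  by rewrite /b; case: ifP => // _; rewrite mulr_ge0 ?ler0n ?ltW ?ip_gt0.
have Qsum p : \sum_(j | Q p j) abs_coef p (s p) j <=
   b p * (1 + (k - 1) * (iq p - ip p)).
  have x0 := extra_factor_ge0 p.
  rewrite /Q /b; case: (p \in H).
    rewrite (eq_bigl (pred1 (Some m))); last by move=> j; rewrite /= eqb_id.
    rewrite big_pred1_eq; case: (s p) (sm p) => [i|] /=; last first.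
      by rewrite eqxx mul1r ler_peMr ?lerDl // ltW ?ip_gt0.
    by rewrite (inj_eq Some_inj) eq_sym => /negbTE ->; rewrite !mul0r.
  rewrite sum_abs_coef_Some // mul1r lerD2l.
  by case: eqP => _; rewrite ?mul1r ?mul0r.
have ext : \prod_p b p <= \sum_(r : colouring | (J r == H) && extends s r)
   \prod_p abs_coef p (s p) (r p).
  have [/forallP Hs|] := boolP [forall p in H, s p == None]; last first.
    rewrite negb_forall => /existsP[p]; rewrite negb_imply => /andP[pH sp].
    rewrite (bigD1 p) //= /b pH (negbTE sp) !mul0r; apply: sumr_ge0 => r _.
    by apply: prodr_ge0 => q _; exact: abs_coef_ge0.
  pose r0 : colouring := [ffun p => if p \in H then Some m else s p].
  rewrite (bigD1 r0) /=; last first.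
    apply/andP; split.
      apply/eqP/setP => p; rewrite finset.inE ffunE; case: ifP => _; first by rewrite eqxx.
      by apply/negbTE.
    apply/forallP => p; rewrite ffunE; have := Hs p.
    by case: (p \in H) => /= [/eqP ->|_]; case: (s p) => *; rewrite ?eqxx ?orbT.
  have -> : \prod_p b p = \prod_p abs_coef p (s p) (r0 p).
    apply: eq_bigr => p _; rewrite /b ffunE; have := Hs p.
    case: (p \in H) => /= [/eqP ->|_]; first by rewrite /= eqxx mul1r.
    by case: (s p) => [i|] //=; rewrite eqxx.
  by rewrite lerDl; apply: sumr_ge0 => r _; apply: prodr_ge0 => q _; exact: abs_coef_ge0.
have step1 : \sum_(r : colouring | ((colour_part pi r m <= Z)%N && ~~ extends s r) && (J r == H))
   \prod_p abs_coef p (s p) (r p) <= (\prod_p b p) * extra.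
  apply: (@le_trans _ _ (\sum_(r : colouring | (J r == H) && ~~ extends s r)
    \prod_p abs_coef p (s p) (r p))).
    rewrite big_mkcond [leRHS]big_mkcond; apply: ler_sum => r _.
    have ge0 : 0 <= \prod_p abs_coef p (s p) (r p).
      by apply: prodr_ge0 => q _; exact: abs_coef_ge0.
    by case: (_ <= Z)%N; case: extends; case: (_ == H).
  have := famQ; rewrite (bigID (extends s)) /= => /esym E.
  have E2 : \prod_p \sum_(j | Q p j) abs_coef p (s p) j <= (\prod_p b p) * (1 + extra).
    rewrite /extra addrC subrK -big_split /=; apply: ler_prod => p _.
    by rewrite Qsum andbT; apply: sumr_ge0 => j _; exact: abs_coef_ge0.
  by move: E2 ext; rewrite -E; lra.
apply: (le_trans step1); rewrite ler_wpM2r ?extra_ge0 //.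
rewrite natr_prod -prodfV [leRHS]big_mkcond; apply: ler_prod => p _; rewrite b0 /= /b.
case: ifP => // _; case: eqP => _; rewrite ?mul1r ?mul0r //; exact: ltW (ip_gt0 p).
Qed.

End Forms.

(** * Lower bound for the form in which the m-th linear form is prime *)

Section LowerForm.
Variables (R : realFieldType) (Z W : nat) (T K : finType) (pi : T -> nat).
Hypotheses (prime_pi : forall p, prime (pi p)) (pi_inj : injective pi).
Hypothesis (pi_W : forall p, coprime (pi p) W).
Hypothesis pi_surj : forall q, prime q -> (q <= Z)%N -> coprime q W -> exists p, pi p = q.
Hypotheses (Z_gt0 : (0 < Z)%N) (K_gt1 : (1 < #|K|)%N).
Hypothesis pi_gt : forall p, (#|K| < pi p)%N.
Local Notation V := 'I_Z.+1.
Local Notation colouring := {ffun T -> option K}.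
Local Notation ip p := ((pi p)%:R^-1 : R).
Local Notation iq p := (((pi p)%:R - 1)^-1 : R).
Local Notation k := (#|K|%:R : R).
Local Notation mass := (mass R Z W).
Local Notation cw := (cw R W).
Local Notation tup := (colour_tuple Z pi).

Variables (Y : {ffun K -> V} -> R) (B : R).
Hypothesis Y_bound : forall u, 0 <= Y u <= B.
Hypothesis Y_supp : forall u : {ffun K -> V}, (Z < \prod_i u i)%N -> Y u = 0.

Local Notation colour_value := (colour_value pi Y).
Local Notation signed_value := (signed_value pi Y).
Local Notation colour_sign := (@colour_sign R T K).
Variable m : K.
Local Notation A := (~: [set m])%SET.
Local Notation abs_coef := (abs_coef R pi m).
Local Notation dual_value := (dual_value pi Y m).
Local Notation extends := (@extends T K m).
Local Notation extra := (extra R K pi).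

Definition set_coord (u : {ffun K -> V}) (v : V) : {ffun K -> V} :=
  [ffun i => if i == m then v else u i].
(** Discrete version of the inner integral of [F] in the variable [t_m]. *)
Definition fibre_sum (u : {ffun K -> V}) : R := \sum_(v : V) cw v * Y (set_coord u v).
Definition supp_sum (s : colouring) : R := \sum_(p | s p != None) ip p.
Definition inv_sq_sum : R := \sum_p ip p ^+ 2.

Let Y_ge0 u : 0 <= Y u. Proof. by have /andP[] := Y_bound u. Qed.
Let Y_le u : Y u <= B. Proof. by have /andP[] := Y_bound u. Qed.
Let B_ge0 : 0 <= B. Proof. by have /andP[/le_trans] := Y_bound [ffun=> ord0]; apply. Qed.

Lemma fibre_sum_bound u : 0 <= fibre_sum u <= B * mass.
Proof.
apply/andP; split; first by apply: sumr_ge0 => v _; rewrite mulr_ge0 ?cw_ge0.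
rewrite /fibre_sum mulr_sumr; apply: ler_sum => v _; by rewrite mulrC ler_wpM2r ?cw_ge0.
Qed.

Lemma extends_part (s r : colouring) i : (forall p, s p != Some m) -> extends s r -> i != m ->
  colour_part pi r i = colour_part pi s i.
Proof.
move=> sm /forallP H im; apply: eq_bigl => p; have := H p; case: (s p) => [j|] /=.
  by move=> /eqP ->.
by case/orP => /eqP -> //; rewrite (inj_eq Some_inj) eq_sym (negbTE im).
Qed.

Lemma extends_abs_coef (s r : colouring) : (forall p, s p != Some m) -> extends s r ->
  \prod_p abs_coef p (s p) (r p) = (colour_part pi r m)%:R^-1.
Proof.
move=> sm /forallP H; rewrite /colour_part natr_prod -prodfV [RHS]big_mkcond /=.
apply: eq_bigr => p _; have := H p; have := sm p; case: (s p) => [j|] /=.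
  by move=> jm /eqP -> /=; rewrite eqxx (negbTE jm).
by move=> _ /orP[] /eqP -> /=; rewrite ?eqxx.
Qed.

(** A value [v] of the m-th coordinate corresponds to an extension of [s] unless [v] has a square
    factor or shares a prime with [s]. Such values have total weight at most
    [mass * (inv_sq_sum + supp_sum s)]. *)
Lemma fibre_sum_le (s : colouring) : (forall p, s p != Some m) -> (colour_norm pi s <= Z)%N ->
  fibre_sum (tup s) <=
  \sum_(r | extends s r) colour_value r * \prod_p abs_coef p (s p) (r p)
  + B * mass * (inv_sq_sum + supp_sum s).
Proof.
move=> sm sZ.
pose good (v : V) := [forall p, ~~ (pi p ^ 2 %| v)%N && ((s p == None) || ~~ (pi p %| v)%N)].
rewrite /fibre_sum (bigID good) /=; apply: lerD; last first.
  apply: (@le_trans _ _ (B * \sum_(v : V | ~~ good v) cw v)).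
    by rewrite mulr_sumr; apply: ler_sum => v _; rewrite mulrC ler_wpM2r ?cw_ge0.
  rewrite -mulrA ler_wpM2l //.
  apply: (@le_trans _ _ (\sum_(v : V) (\sum_p (pi p ^ 2 %| v)%N%:R * cw v +
      \sum_(p | s p != None) (pi p %| v)%N%:R * cw v))).
    rewrite big_mkcond; apply: ler_sum => v _.
    have g1 : 0 <= \sum_p (pi p ^ 2 %| v)%N%:R * cw v.
      by apply: sumr_ge0 => p _; rewrite mulr_ge0 ?ler0n ?cw_ge0.
    have g2 : 0 <= \sum_(p | s p != None) (pi p %| v)%N%:R * cw v.
      by apply: sumr_ge0 => p _; rewrite mulr_ge0 ?ler0n ?cw_ge0.
    case: ifPn => [|_]; last by rewrite addr_ge0.
    rewrite negb_forall => /existsP[p]; rewrite negb_and negbK negb_or negbK.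
    case/orP => [pv|/andP[sp pv]].
      apply: ler_wpDr => //; rewrite (bigD1 p) //= pv mul1r lerDl.
      by apply: sumr_ge0 => q _; rewrite mulr_ge0 ?ler0n ?cw_ge0.
    apply: ler_wpDl => //; rewrite (bigD1 p) //= pv mul1r lerDl.
    by apply: sumr_ge0 => q _; rewrite mulr_ge0 ?ler0n ?cw_ge0.
  rewrite big_split /= mulrDr; apply: lerD.
    rewrite exchange_big mulr_sumr; apply: ler_sum => p _.
    rewrite exprVn -natrX.
    apply: le_trans (sum_cw_dvd R Z W _) => //; last by rewrite expn_gt0 prime_gt0.
    rewrite [leRHS]big_mkcond; apply: ler_sum => v _.
    by case: (_ %| _)%N; rewrite ?mul1r ?mul0r.
  rewrite exchange_big mulr_sumr; apply: ler_sum => p _.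
  apply: le_trans (sum_cw_dvd R Z W _) => //; last by rewrite prime_gt0.
  rewrite [leRHS]big_mkcond; apply: ler_sum => v _.
  by case: (_ %| _)%N; rewrite ?mul1r ?mul0r.
pose G (v : V) := if good v then cw v * Y (set_coord (tup s) v) else 0.
pose h (r : colouring) : V := inord (colour_part pi r m).
pose P (r : colouring) := extends s r && (colour_norm pi r <= Z)%N.
have G0 v : 0 <= G v by rewrite /G; case: ifP => // _; rewrite mulr_ge0 ?cw_ge0.
have hE r : P r -> h r = colour_part pi r m :> nat.
  by move=> /andP[_ rZ]; rewrite inordK // ltnS (leq_trans _ rZ) // colour_part_le.
have upE r : P r -> set_coord (tup s) (h r) = tup r.
  move=> Pr; have /andP[sr rZ] := Pr; apply/ffunP => i; apply: val_inj.
  rewrite /= [in RHS]colour_tupleE // ffunE; case: eqP => [->|/eqP im]; first exact: hE.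
  by rewrite colour_tupleE // (extends_part sm sr).
rewrite big_mkcond -[X in X <= _]/(\sum_v G v).
apply: (le_trans (sum_image_ge (P := P) (h := h) (Q := xpred0) _ G0 _)).
- move=> r r'; rewrite !unfold_in => Pr Pr' /(congr1 val); rewrite /= !hE // => E.
  apply: (colour_part_inj prime_pi pi_inj) => i.
  have [->//|im] := eqVneq i m.
  have /andP[e _] := Pr; have /andP[e' _] := Pr'.
  by rewrite (extends_part sm e) // (extends_part sm e').
- move=> v _; rewrite /G; case: ifPn => [gv|]; last by rewrite eqxx.
  rewrite mulf_eq0 negb_or => /andP[cv Yv].
  have [v0 vW] : (0 < v)%N /\ coprime v W.
    move: cv; rewrite /cw; case: ifPn => [vW|_]; last by rewrite eqxx.
    by rewrite invr_eq0 pnatr_eq0 -lt0n.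
  have vZ : (\prod_i set_coord (tup s) v i <= Z)%N.
    by rewrite leqNgt; apply/negP => /Y_supp E; rewrite E eqxx in Yv.
  have gp p : ~~ (pi p ^ 2 %| v)%N by have /forallP/(_ p)/andP[] := gv.
  have gs p : s p != None -> ~~ (pi p %| v)%N.
    by have /forallP/(_ p)/andP[_ /orP[->|]] := gv.
  pose r : colouring := [ffun p => if s p is Some _ then s p else
                                  if (pi p %| v)%N then Some m else None].
  have sr : extends s r.
    apply/forallP => p; rewrite ffunE; case: (s p) => [i|]; first by rewrite eqxx.
    by case: ifP => _; rewrite eqxx ?orbT.
  have rm : colour_part pi r m = v.
    rewrite /colour_part (eq_bigl (fun p => pi p %| v)%N).
      apply: (prodpi_squarefree prime_pi pi_inj (Z := Z) (W := W)) => //.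
      by rewrite -ltnS ltn_ord.
    move=> p; rewrite ffunE; have := sm p; have := gs p; case: (s p) => [i|] /=.
      by move=> /(_ isT) /negbTE -> /negbTE ->.
    by move=> _ _; case: ifP; rewrite ?eqxx.
  have rZ : (colour_norm pi r <= Z)%N.
    rewrite colour_normE; apply: leq_trans vZ; apply: eq_leq; apply: eq_bigr => i _.
    rewrite ffunE; case: eqP => [->|/eqP im]; first by rewrite rm.
    by rewrite (extends_part sm sr) // colour_tupleE.
  exists r; first by rewrite /P sr.
  by apply: val_inj; rewrite /= hE // /P sr.
rewrite [X in _ + X]big_pred0 // addr0 big_mkcond [leRHS]big_mkcond; apply: ler_sum => r _.
rewrite /P; case: ifPn => [Pr|nP]; last first.
  case: ifP => // _; rewrite mulr_ge0 //; last by apply: prodr_ge0 => q _; exact: abs_coef_ge0.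
  by rewrite /colour_value; case: ifP.
have /andP[sr rZ] := Pr; rewrite sr (extends_abs_coef sm sr) /G upE // hE //.
rewrite /colour_value rZ mulrC.
have -> : cw (colour_part pi r m) = (colour_part pi r m)%:R^-1.
  by rewrite /cw coprime_prodpi.
by case: ifP => // _; rewrite mulr_ge0 ?invr_ge0 ?ler0n.
Qed.

Lemma dual_value_lower (s : colouring) : (forall p, s p != Some m) -> (colour_norm pi s <= Z)%N ->
  fibre_sum (tup s) - B * mass * (inv_sq_sum + supp_sum s + extra) <=
  colour_sign s * dual_value s.
Proof.
move=> sm sZ; rewrite dual_valueE.
apply: (@le_trans _ _ (\sum_(r | extends s r) colour_value r * \prod_p abs_coef p (s p) (r p)
   - \sum_(r | ~~ extends s r) colour_value r * \prod_p abs_coef p (s p) (r p))).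
  have H1 := fibre_sum_le sm sZ.
  suff : \sum_(r | ~~ extends s r) colour_value r * \prod_p abs_coef p (s p) (r p) <=
    B * mass * extra by lra.
  have H2 := @sum_not_extends R Z W T K pi prime_pi pi_inj pi_W K_gt1 m s sm.
  apply: (@le_trans _ _ (B * (extra * mass))); last by rewrite le_eqVlt; apply/orP; left; apply/eqP; ring.
  apply: (le_trans _ (ler_wpM2l B_ge0 H2)); rewrite mulr_sumr big_mkcond [leRHS]big_mkcond.
  apply: ler_sum => r _; rewrite andbC; case: extends => //=.
  have p0 : 0 <= \prod_p abs_coef p (s p) (r p).
    by apply: prodr_ge0 => q _; exact: abs_coef_ge0.
  rewrite /colour_value; case: ifPn => rZ.
    rewrite ifT; first by rewrite ler_wpM2r.
    by rewrite (leq_trans _ rZ) // colour_part_le.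
  by rewrite mul0r; case: ifP => // _; rewrite mulr_ge0.
rewrite [leRHS](bigID (extends s)) /= -sumrN; apply: lerD; apply: ler_sum => r er.
  have v0 : 0 <= colour_value r by rewrite /colour_value; case: ifP.
  by have := signed_prod_ge R prime_pi m s r; rewrite er mul1r => ?; rewrite ler_wpM2l.
have v0 : 0 <= colour_value r by rewrite /colour_value; case: ifP.
have := signed_prod_ge R prime_pi m s r; rewrite (negbTE er) mulN1r => ?.
by rewrite -mulrN ler_wpM2l.
Qed.

(** For a colour other than [m] the local factor is [(p - k) / (p - 1) ^ 2], which lies between
    [(1 - k / p) / p] and [1 / p]; the upper estimate uses [k >= 2]. *)
Lemma diag2_lower (s : colouring) : (forall p, s p != Some m) ->
  (colour_norm pi s)%:R^-1 * (1 - k * supp_sum s) <= \prod_p diag2 R pi m p (s p)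
  <= (colour_norm pi s)%:R^-1.
Proof.
move=> sm; rewrite -prod_ip.
have loc p : (if s p is Some _ then ip p else 1) *
    (1 - (if s p != None then k * ip p else 0)) <= diag2 R pi m p (s p) <=
    (if s p is Some _ then ip p else 1).
  have := sm p; case: (s p) => [i|] /=; last by rewrite subr0 mulr1 lexx.
  rewrite (inj_eq Some_inj) => /negbTE -> /=; rewrite mul1r.
  have := pi_geK R pi_gt p; have := pi_gt1 R prime_pi p; set x := (pi p)%:R => x1 xk.
  have k2 : 2 <= k by rewrite ler_nat.
  have e1 : x^-1 * (1 - k * x^-1) = (x - k) / x ^+ 2 by field; lra.
  have e2 : (x - 1)^-1 - (k - 1) * (x - 1)^-1 ^+ 2 = (x - k) / (x - 1) ^+ 2 by field; lra.
  have e3 : x^-1 = x / x ^+ 2 by field; lra.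
  have sq1 : 0 < x ^+ 2 by rewrite exprn_gt0 //; lra.
  have sq2 : 0 < (x - 1) ^+ 2 by rewrite exprn_gt0 //; lra.
  rewrite e1 e2; apply/andP; split.
    rewrite ler_wpM2l ?subr_ge0; first by []; first lra.
    rewrite lef_pV2 ?posrE //; nra.
  rewrite ler_pdivrMr // e3 mulrAC ler_pdivlMr //.
  have : (x - k) * x <= (x - 1) ^+ 2 by nra.
  nra.
have ip0 p : 0 <= (if s p is Some _ then ip p else 1).
  by case: (s p) => // _; rewrite ltW ?ip_gt0.
have k1 p : 0 <= 1 - (if s p != None then k * ip p else 0).
  case: ifP => _; last by rewrite subr0.
  have := pi_geK R pi_gt p; have := pi_gt1 R prime_pi p => h1 h2.
  rewrite subr_ge0 ler_pdivrMr ?mul1r; lra.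
apply/andP; split; last first.
  apply: ler_prod => p _; have /andP[_ ->] := loc p; rewrite andbT.
  by rewrite diag2_ge0.
apply: (@le_trans _ _ (\prod_p ((if s p is Some _ then ip p else 1) *
    (1 - (if s p != None then k * ip p else 0))))); last first.
  apply: ler_prod => p _; have /andP[-> _] := loc p; by rewrite andbT mulr_ge0.
rewrite big_split /= ler_wpM2l ?prodr_ge0 //.
apply: le_trans (prodr_ge_1Bsum _) => /=; last first.
  move=> p _; have := k1 p; rewrite subr_ge0 => ->; rewrite andbT.
  by case: ifP => // _; rewrite mulr_ge0 ?ler0n ?ltW ?ip_gt0.
rewrite lerB // /supp_sum mulr_sumr -big_mkcond /=; exact: lexx.
Qed.

Let mass_ge0 : 0 <= mass := mass_ge0 R Z W.

Lemma supp_sum_ge0 (s : colouring) : 0 <= supp_sum s.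
Proof. by apply: sumr_ge0 => p _; rewrite ltW ?ip_gt0. Qed.

Lemma inv_sq_sum_ge0 : 0 <= inv_sq_sum.
Proof. by apply: sumr_ge0 => p _; rewrite sqr_ge0. Qed.

Lemma dual_value_sqr_lower (s : colouring) : (forall p, s p != Some m) -> (colour_norm pi s <= Z)%N ->
  (colour_norm pi s)%:R^-1 * (fibre_sum (tup s) ^+ 2 -
     (B * mass) ^+ 2 * (2 * (inv_sq_sum + extra) + (k + 2) * supp_sum s)) <=
  (\prod_p diag2 R pi m p (s p)) * dual_value s ^+ 2.
Proof.
move=> sm sZ; have /andP[D1 D2] := diag2_lower sm.
have H := dual_value_lower sm sZ.
have sq : dual_value s ^+ 2 = (colour_sign s * dual_value s) ^+ 2.
  by rewrite exprMn colour_sign_sqr mul1r.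
rewrite {}sq; move: H; set x := colour_sign s * _.
have /andP[f0 f1] := fibre_sum_bound (tup s).
set f := fibre_sum _ in f0 f1 *; set D := \prod_p _ in D1 D2 *.
have e0 := extra_ge0 R prime_pi K_gt1; have i0 := inv_sq_sum_ge0; have s0 := supp_sum_ge0 s.
set e := inv_sq_sum + supp_sum s + extra.
set Bm := B * mass in f1 *; set N := (_)^-1 in D1 D2 * => H.
have N0 : 0 <= N by rewrite invr_ge0 ler0n.
have D0 : 0 <= D by apply: prodr_ge0 => p _; exact: diag2_ge0.
have ege : 0 <= e by rewrite /e; lra.
have Bm0 : 0 <= Bm by lra.
(* Squaring [f - Bm * e <= x] is legitimate when the left side is positive; otherwise
   [f ^+ 2 <= f * (Bm * e) <= Bm ^+ 2 * e] and the claimed bound is at most 0. *)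
have B1 : f ^+ 2 - 2 * Bm ^+ 2 * e <= x ^+ 2.
  have Be : 0 <= Bm * e by rewrite mulr_ge0.
  have [fe|fe] := leP (f - Bm * e) 0.
    apply: (@le_trans _ _ 0); last exact: sqr_ge0.
    have : f * f <= f * (Bm * e) by rewrite ler_wpM2l //; lra.
    have : f * (Bm * e) <= Bm * (Bm * e) by rewrite ler_wpM2r.
    have : 0 <= Bm * (Bm * e) by rewrite mulr_ge0.
    by rewrite !expr2; lra.
  have : (f - Bm * e) ^+ 2 <= x ^+ 2 by rewrite ler_pXn2r ?nnegrE //; lra.
  have : f * (Bm * e) <= Bm * (Bm * e) by rewrite ler_wpM2r.
  have := sqr_ge0 (Bm * e); rewrite !expr2; lra.
have h1 : D * (f ^+ 2 - 2 * Bm ^+ 2 * e) <= D * x ^+ 2 by rewrite ler_wpM2l.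
have h2 : N * (1 - k * supp_sum s) * f ^+ 2 <= D * f ^+ 2 by rewrite ler_wpM2r ?sqr_ge0.
have h3 : D * (2 * Bm ^+ 2 * e) <= N * (2 * Bm ^+ 2 * e).
  by rewrite ler_wpM2r // !mulr_ge0 ?sqr_ge0.
have h4 : N * (k * supp_sum s) * f ^+ 2 <= N * (k * supp_sum s) * Bm ^+ 2.
  rewrite ler_wpM2l ?mulr_ge0 ?ler0n //; by rewrite ler_pXn2r ?nnegrE.
have -> : N * (f ^+ 2 - Bm ^+ 2 * (2 * (inv_sq_sum + extra) + (k + 2) * supp_sum s)) =
   N * f ^+ 2 - N * (k * supp_sum s) * Bm ^+ 2 - N * (2 * Bm ^+ 2 * e) by rewrite /e; ring.
move: h1 h2; rewrite !mulrBr ?mulrBl ?mulrBr mulr1; lra.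
Qed.

Lemma sum_twt_dvd1 d i : (1 < d)%N ->
  \sum_(u : {ffun K -> V}) (d %| u i)%N%:R * twt R W A u <= mass ^+ #|A| / d%:R.
Proof.
move=> d1; have := @sum_twt_dvd R Z W K A Z_gt0 [set i]%SET d d1.
rewrite cards1 expr1; apply: le_trans; rewrite [leRHS]big_mkcond; apply: ler_sum => u _.
case: ifPn => [_|]; first by case: (_ %| _)%N; rewrite ?mul1r ?mul0r ?twt_ge0.
case: (boolP (d %| u i)%N) => [du /forallPn[j]|_ _]; last by rewrite mul0r.
by rewrite negb_imply finset.inE => /andP[/eqP ->]; rewrite du.
Qed.

Lemma sum_twt_dvd2 d i j : (1 < d)%N ->
  \sum_(u : {ffun K -> V}) [&& i != j, (d %| u i)%N & (d %| u j)%N]%:R * twt R W A u <=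
  mass ^+ #|A| * d%:R^-1 ^+ 2.
Proof.
move=> d1; have [ij|ij] := boolP (i != j); last first.
  rewrite big1 ?mulr_ge0 ?exprn_ge0 ?invr_ge0 ?mass_ge0 ?ler0n // => u _.
  by rewrite mul0r.
have := @sum_twt_dvd R Z W K A Z_gt0 [set i; j]%SET d d1.
rewrite cards2 ij -exprVn; apply: le_trans; rewrite [leRHS]big_mkcond; apply: ler_sum => u _.
case: ifPn => [_|]; first by case: (_ && _); rewrite ?mul1r ?mul0r ?twt_ge0.
case: (boolP [&& _, _ & _]) => [/and3P[_ du dv] /forallPn[l]|_ _]; last by rewrite mul0r.
by rewrite negb_imply !finset.inE => /andP[/orP[]/eqP ->]; rewrite ?du ?dv.
Qed.

(** The error is a multiple of [mass ^+ (#|A| + 2)], the size of the main term, with a factor that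
    is small when all primes are large. Its three parts are the loss in the dual sums, the average
    of [supp_sum], and the tuples that do not come from colourings. *)
Lemma quadratic_form_lower :
  \sum_u twt R W A u * fibre_sum u ^+ 2 - (B * mass) ^+ 2 * mass ^+ #|A| *
     (2 * (inv_sq_sum + extra) + (k + 2) * k * inv_sq_sum + (k + k ^+ 2) * inv_sq_sum) <=
  \sum_(X : colouring) (\prod_p density2 R pi m p (X p)) * sieve_weight pi signed_value X ^+ 2.
Proof.
apply: le_trans (model2_lower prime_pi pi_gt m _).
pose S (s : colouring) := [forall p, s p != Some m] && (colour_norm pi s <= Z)%N.
pose bad (u : {ffun K -> V}) := [exists p, exists i, (pi p ^ 2 %| u i)%N] ||
   [exists p, exists i, exists j, [&& i != j, (pi p %| u i)%N & (pi p %| u j)%N]].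
have i0 := inv_sq_sum_ge0.
have tw0 u : 0 <= twt R W A u by exact: twt_ge0.
have SA s p i : S s -> s p = Some i -> i \in A.
  by move=> /andP[/forallP/(_ p) + _] E; rewrite E !finset.inE (inj_eq Some_inj).
have S1 : \sum_(s | S s) (colour_norm pi s)%:R^-1 * (fibre_sum (tup s) ^+ 2 -
     (B * mass) ^+ 2 * (2 * (inv_sq_sum + extra) + (k + 2) * supp_sum s)) <=
   \sum_(s : colouring) (\prod_p diag2 R pi m p (s p)) *
     (\sum_r signed_value r * \prod_p coef2 R pi m p (s p) (r p)) ^+ 2.
  rewrite [leRHS](bigID S) /= ler_wpDr //.
    apply: sumr_ge0 => s _; rewrite mulr_ge0 ?sqr_ge0 // prodr_ge0 // => p _.
    exact: diag2_ge0.
  by apply: ler_sum => s /andP[/forallP sm sZ]; exact: dual_value_sqr_lower.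
apply: le_trans S1; rewrite (eq_bigr (fun s => (colour_norm pi s)%:R^-1 * fibre_sum (tup s) ^+ 2 -
     (colour_norm pi s)%:R^-1 * ((B * mass) ^+ 2 * (2 * (inv_sq_sum + extra) + (k + 2) * supp_sum s)))); last first.
  by move=> s _; rewrite mulrBr.
rewrite sumrB.
have M1 : \sum_u twt R W A u * fibre_sum u ^+ 2 <=
   \sum_(s | S s) (colour_norm pi s)%:R^-1 * fibre_sum (tup s) ^+ 2 +
   \sum_(u | bad u) twt R W A u * fibre_sum u ^+ 2.
  pose G u := twt R W A u * fibre_sum u ^+ 2.
  rewrite (eq_bigr (fun s => G (tup s))); last first.
    move=> s Ss; have /andP[/forallP sm sZ] := Ss.
    rewrite /G; congr (_ * _); apply/esym/twt_colour_tuple => // p i; exact: SA.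
  apply: sum_image_ge => [s s'||u nbad].
  - by rewrite !unfold_in => /andP[_ sZ] /andP[_ sZ']; apply: (colour_tuple_inj prime_pi pi_inj).
  - by move=> u; rewrite mulr_ge0 ?sqr_ge0.
  rewrite /G mulf_eq0 negb_or sqrf_eq0 => /andP[tu fu].
  have wi i : wt R W A i (u i) != 0.
    by move: tu; rewrite /twt; apply: contra_neq => w0; rewrite (bigD1 i) //= w0 mul0r.
  have uA i : i \in A -> (0 < u i)%N && coprime (u i) W.
    move=> iA; have := wi i; rewrite /wt iA /cw; case: ifPn => _; last by rewrite eqxx.
    by rewrite invr_eq0 pnatr_eq0 -lt0n => ->.
  have um i : i \notin A -> u i = 1%N :> nat.
    by move=> iA; have := wi i; rewrite /wt (negbTE iA) pnatr_eq0 eqb0 negbK => /eqP.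
  have uZ : (\prod_i u i <= Z)%N.
    rewrite leqNgt; apply/negP => uZ; move: fu; rewrite /fibre_sum big1 ?eqxx // => v _.
    have [v0|v0] := posnP v; first by rewrite v0 /cw invr0; case: ifP; rewrite mul0r.
    rewrite Y_supp ?mulr0 // (leq_trans uZ) // (bigD1 m) //= [leqRHS](bigD1 m) //=.
    rewrite ffunE eqxx um ?finset.inE ?eqxx // mul1n.
    rewrite [X in (_ <= _ * X)%N](eq_bigr (fun i => u i : nat)) ?leq_pmull //.
    by move=> i /negbTE im; rewrite ffunE im.
  move: nbad; rewrite /bad negb_or => /andP[/existsPn b1 /existsPn b2].
  have [] := colour_surj prime_pi pi_inj pi_surj uZ uA um.
  - by move=> p i; have /existsPn := b1 p; apply.
  - move=> p i j pi1 pj; apply/eqP/negPn/negP => ij.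
    by have /existsPn/(_ i)/existsPn/(_ j)/negP[] := b2 p; rewrite ij pi1.
  move=> s [sZ <- sA]; exists s => //; rewrite /S sZ andbT; apply/forallP => p.
  by apply/eqP => E; have := sA p m E; rewrite !finset.inE eqxx.
have M2 : \sum_(u | bad u) twt R W A u * fibre_sum u ^+ 2 <=
    (B * mass) ^+ 2 * (mass ^+ #|A| * ((k + k ^+ 2) * inv_sq_sum)).
  apply: (@le_trans _ _ ((B * mass) ^+ 2 * \sum_(u | bad u) twt R W A u)).
    rewrite mulr_sumr; apply: ler_sum => u _; rewrite mulrC ler_wpM2r //.
    have /andP[f0 f1] := fibre_sum_bound u; rewrite ler_pXn2r ?nnegrE //; exact: le_trans f1.
  rewrite ler_wpM2l ?sqr_ge0 //.
  pose b1 (u : {ffun K -> V}) p i := (pi p ^ 2 %| u i)%N.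
  pose b2 (u : {ffun K -> V}) p i j := [&& i != j, (pi p %| u i)%N & (pi p %| u j)%N].
  apply: (@le_trans _ _ (\sum_u (\sum_p (\sum_i (b1 u p i)%:R * twt R W A u +
      \sum_i \sum_j (b2 u p i j)%:R * twt R W A u)))).
    rewrite big_mkcond; apply: ler_sum => u _.
    have g (b : bool) : 0 <= b%:R * twt R W A u by rewrite mulr_ge0 ?ler0n.
    have gs p : 0 <= \sum_i (b1 u p i)%:R * twt R W A u +
      \sum_i \sum_j (b2 u p i j)%:R * twt R W A u.
      by rewrite addr_ge0 ?sumr_ge0 // => i _; rewrite sumr_ge0.
    case: ifPn => [|_]; last by apply: sumr_ge0.
    case/orP => /existsP[p /existsP[i]].
      move=> pu; rewrite (bigD1 p) //= ler_wpDr ?sumr_ge0 // ler_wpDr ?sumr_ge0 //.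
        by move=> j _; rewrite sumr_ge0.
      by rewrite (bigD1 i) //= [b1 u p i]pu mul1r lerDl sumr_ge0.
    case/existsP => j pu; rewrite (bigD1 p) //= ler_wpDr ?sumr_ge0 // ler_wpDl ?sumr_ge0 //.
    rewrite (bigD1 i) //= ler_wpDr ?sumr_ge0 // => [l _|]; first by rewrite sumr_ge0.
    by rewrite (bigD1 j) //= [b2 u p i j]pu mul1r lerDl sumr_ge0.
  rewrite exchange_big /= /inv_sq_sum !mulr_sumr; apply: ler_sum => p _.
  rewrite big_split /= mulrDl mulrDr; apply: lerD.
    rewrite exchange_big /= [leRHS](_ : _ = \sum_(i : K) mass ^+ #|A| * ip p ^+ 2); last first.
      by rewrite sumr_const -mulr_natl; ring.
    apply: ler_sum => i _; rewrite exprVn -natrX; apply: sum_twt_dvd1.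
    by rewrite -[1%N](exp1n 2) ltn_exp2r // prime_gt1.
  rewrite exchange_big /= [leRHS](_ : _ = \sum_(i : K) \sum_(j : K) mass ^+ #|A| * ip p ^+ 2); last first.
    by rewrite sumr_const -mulr_natl sumr_const -[_ *+ #|_|]mulr_natl; ring.
  apply: ler_sum => i _; rewrite exchange_big /=; apply: ler_sum => j _.
  by apply: sum_twt_dvd2; rewrite prime_gt1.
have E1 : \sum_(s | S s) (colour_norm pi s)%:R^-1 * ((B * mass) ^+ 2 *
     (2 * (inv_sq_sum + extra) + (k + 2) * supp_sum s)) <=
   (B * mass) ^+ 2 * (mass ^+ #|A| * (2 * (inv_sq_sum + extra) + (k + 2) * (k * inv_sq_sum))).
  (* Extension of [supp_sum] from colourings to all tuples. Averaging over tuples, [p] divides an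
     entry with weight at most [1 / p], so each prime contributes [p ^- 2]. *)
  pose c (u : {ffun K -> V}) := \sum_p (\sum_i (pi p %| u i)%N%:R) * ip p.
  pose G u := (B * mass) ^+ 2 * (2 * (inv_sq_sum + extra) + (k + 2) * c u).
  have e0 := extra_ge0 R prime_pi K_gt1.
  have c0 u : 0 <= c u.
    by apply: sumr_ge0 => p _; rewrite mulr_ge0 ?sumr_ge0 // ltW ?ip_gt0.
  have k0 : 0 <= k by rewrite ler0n.
  have G0 u : 0 <= G u.
    have h1 : 0 <= 2 * (inv_sq_sum + extra) by lra.
    have h2 : 0 <= (k + 2) * c u by have := c0 u => ?; rewrite mulr_ge0 //; lra.
    by rewrite /G mulr_ge0 ?sqr_ge0 // addr_ge0.
  apply: (@le_trans _ _ (\sum_(s | S s) (colour_norm pi s)%:R^-1 * G (tup s))).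
    apply: ler_sum => s Ss; have /andP[_ sZ] := Ss.
    have k2 : 0 <= k + 2 by lra.
    rewrite ler_wpM2l ?invr_ge0 ?ler0n // ler_wpM2l ?sqr_ge0 // lerD2l ler_wpM2l //.
    rewrite /supp_sum big_mkcond; apply: ler_sum => p _.
    case: ifPn => [|_]; last by rewrite mulr_ge0 ?sumr_ge0 // ltW ?ip_gt0.
    case E: (s p) => [i|] // _; rewrite ler_peMl ?(ltW (ip_gt0 R prime_pi p)) //.
    rewrite (bigD1 i) //= colour_tupleE // (prime_dvd_colour_part prime_pi pi_inj) E eqxx.
    by rewrite -[leLHS]addr0 lerD // sumr_ge0.
  apply: le_trans (sum_colour_le prime_pi pi_inj pi_W (A := A) G0 _ _) _.
  - by move=> s /andP[].
  - by move=> s p i; exact: SA.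
  rewrite (eq_bigr (fun u => (B * mass) ^+ 2 * (twt R W A u * (2 * (inv_sq_sum + extra)) +
     (k + 2) * (twt R W A u * c u)))); last by move=> u _; rewrite /G; ring.
  rewrite -mulr_sumr ler_wpM2l ?sqr_ge0 // big_split /= -mulr_suml -mulr_sumr sum_twt // [leRHS]mulrDr.
  rewrite lerD2l mulrCA ler_wpM2l; [by []|by lra|].
  rewrite /inv_sq_sum !mulr_sumr (eq_bigr (fun u : {ffun K -> V} => \sum_p \sum_i (pi p %| u i)%N%:R * twt R W A u * ip p)).
    rewrite exchange_big /=; apply: ler_sum => p _.
    rewrite exchange_big /= [leRHS](_ : _ = \sum_(i : K) mass ^+ #|A| * ip p * ip p); last first.
      by rewrite sumr_const -mulr_natl; ring.
    apply: ler_sum => i _; rewrite -mulr_suml ler_wpM2r ?(ltW (ip_gt0 R prime_pi p)) //.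
    by apply: sum_twt_dvd1; rewrite prime_gt1.
  move=> u _; rewrite /c mulr_sumr; apply: eq_bigr => p _; rewrite mulr_suml mulr_sumr.
  by apply: eq_bigr => i _; ring.
have fin (X S0 Bd Er b mm a c i d : R) : Er <= b * (mm * (a + c * (k * i))) -> X <= S0 + Bd ->
    Bd <= b * (mm * (d * i)) -> X - b * mm * (a + c * k * i + d * i) <= S0 - Er.
  have -> : b * mm * (a + c * k * i + d * i) =
    b * (mm * (a + c * (k * i))) + b * (mm * (d * i)) by ring.
  lra.
exact: fin E1 M1 M2.
Qed.

End LowerForm.

(** * Sums over integers coprime to W *)

Section Harmonic.
Variable (R : realType).

Lemma sum_nat_recr (f : nat -> R) n :
  \sum_(1 <= u < n.+2) f u = \sum_(1 <= u < n.+1) f u + f n.+1.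
Proof. exact: big_nat_recr. Qed.

Lemma ln_leB1 (x : R) : 0 < x -> ln x <= x - 1.
Proof.
move=> x0; have := @le_ln1Dx R (x - 1); have -> : 1 + (x - 1) = x by ring.
by apply; lra.
Qed.

Lemma ln_succ_bound (n : nat) : (0 < n)%N ->
  (n.+1%:R)^-1 <= ln n.+1%:R - ln n%:R :> R /\ ln n.+1%:R - ln n%:R <= n%:R^-1 :> R.
Proof.
move=> n0; have n0' : 0 < n%:R :> R by rewrite ltr0n.
have n1' : 0 < n.+1%:R :> R by rewrite ltr0n.
have e1 : n.+1%:R = n%:R + 1 :> R by rewrite natr1.
split.
  have := @ln_leB1 (n%:R / n.+1%:R) (divr_gt0 n0' n1').
  rewrite ln_div ?posrE // e1; have -> : n%:R / (n%:R + 1) - 1 = - (n%:R + 1)^-1 :> R.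
    field; lra.
  by lra.
have := @ln_leB1 (n.+1%:R / n%:R) (divr_gt0 n1' n0').
by rewrite ln_div ?posrE // e1; have -> : (n%:R + 1) / n%:R - 1 = n%:R^-1 :> R by field; lra.
Qed.

Lemma harmonic_bound (n : nat) : (0 < n)%N ->
  ln (n%:R : R) <= \sum_(1 <= u < n.+1) u%:R^-1 <= 1 + ln (n%:R : R).
Proof.
move=> n0; suff /andP[h ->] : ln (n.+1%:R : R) <= \sum_(1 <= u < n.+1) u%:R^-1
    <= 1 + ln (n%:R : R).
  by rewrite andbT (le_trans _ h) // ler_ln ?posrE ?ltr0n // ler_nat.
elim: n n0 => // -[|n] IH _.
  rewrite big_nat1 ln1 invr1 addr0 lexx andbT.
  by apply: (le_trans (ln_leB1 _)); rewrite ?ltr0n //; lra.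
have /andP[h1 h2] := IH isT; have [h3 h4] := @ln_succ_bound n.+1 isT.
have [h5 h6] := @ln_succ_bound n.+2 isT.
rewrite sum_nat_recr; move: h1 h2 h3 h6; set H := \sum_(_ <= _ < _) _.
move: (ln n.+3%:R) (ln n.+2%:R) (ln n.+1%:R) (n.+2%:R^-1) => a b c d h1 h2 h3 h6.
by clear - h1 h2 h3 h6; apply/andP; split; lra.
Qed.

Variable (W : nat).
Hypothesis W_gt0 : (0 < W)%N.
Definition cop_density : R := (totient W)%:R / W%:R.
Local Notation rho := cop_density.

Lemma cop_density_bound : 0 <= rho <= 1.
Proof.
rewrite /rho divr_ge0 ?ler0n //= ler_pdivrMr ?ltr0n // mul1r ler_nat.
rewrite totient_count_coprime; apply: (@leq_trans (\sum_(0 <= d < W) 1)%N).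
  by apply: leq_sum => i _; case: coprime.
by rewrite sum_nat_const_nat subn0 muln1.
Qed.

(** Discrepancy of the coprimality indicator on an initial segment. It vanishes on a full period,
    hence is periodic and bounded by [W]. *)
Let S n : R := \sum_(0 <= u < n) ((coprime u W)%:R - rho).

Let S_W : S W = 0.
Proof.
rewrite /S sumrB sumr_const_nat subn0 -natr_sum -[_ *+ W]mulr_natl.
rewrite (_ : (\sum_(0 <= i < W) _)%N = totient W).
  by rewrite /cop_density; field; rewrite pnatr_eq0 -lt0n.
by rewrite totient_count_coprime; apply: eq_bigr => i _; rewrite coprime_sym.
Qed.

Let S_add n : S (W + n) = S n.
Proof.
rewrite /S (@big_cat_nat _ _ _ W) //= ?leq_addr // -/(S W) S_W add0r.
rewrite -{1}[W]add0n big_addn addKn; apply: eq_bigr => i _.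
by rewrite -coprime_modl modnDr coprime_modl.
Qed.

Let S_bound n : `|S n| <= W%:R.
Proof.
elim/ltn_ind: n => n IH; have [nW|Wn] := ltnP n W; last first.
  rewrite -(subnKC Wn) S_add; apply: IH.
  by rewrite ltn_subrL W_gt0 (leq_trans W_gt0 Wn).
rewrite /S; apply: le_trans (ler_norm_sum _ _ _) _.
apply: (@le_trans _ _ (\sum_(0 <= u < n) 1)); last first.
  by rewrite sumr_const_nat subn0 ler_nat ltnW.
apply: ler_sum => i _; have /andP[h1 h2] := cop_density_bound.
by case: coprime; rewrite ler_norml; apply/andP; split; rewrite /=; lra.
Qed.

Lemma sum_cw_harmonic n : (0 < n)%N ->
  `|\sum_(1 <= u < n.+1) (cw R W u - rho * u%:R^-1)| <= 3 * W%:R.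
Proof.
move=> n0; have S_succ u : S u.+1 - S u = (coprime u W)%:R - rho.
  have -> : S u.+1 = S u + ((coprime u W)%:R - rho) by exact: big_nat_recr.
  by move: (S u) => a; ring.
have cwE u : cw R W u - rho * u%:R^-1 = (S u.+1 - S u) * u%:R^-1.
  by rewrite S_succ mulrBl /cw; case: coprime; rewrite ?mul1r ?mul0r.
(* Summation by parts with boundary term [S n.+1 / n]; the remaining bound telescopes to
   [W * (2 - 1 / n)]. *)
have key : `|\sum_(1 <= u < n.+1) (cw R W u - rho * u%:R^-1) - S n.+1 / n%:R|
    <= W%:R * (2 - n%:R^-1).
  case: n n0 => // n _; elim: n => [|n IH].
    rewrite big_nat1 cwE; have -> : (S 2 - S 1) * 1%:R^-1 - S 2 / 1%:R = - S 1 by field.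
    by rewrite normrN (le_trans (S_bound 1)) // ler_peMr ?ler0n // invr1; lra.
  rewrite sum_nat_recr cwE.
  set X := \sum_(_ <= _ < _) _ in IH *.
  have -> : X + (S n.+3 - S n.+2) / n.+2%:R - S n.+3 / n.+2%:R =
    (X - S n.+2 / n.+1%:R) + S n.+2 * (n.+1%:R^-1 - n.+2%:R^-1) by ring.
  apply: le_trans (ler_normD _ _) _; rewrite normrM.
  have d0 : 0 <= n.+1%:R^-1 - n.+2%:R^-1 :> R.
    by rewrite subr_ge0 lef_pV2 ?posrE ?ltr0n // ler_nat.
  rewrite (ger0_norm d0).
  have : `|S n.+2| * (n.+1%:R^-1 - n.+2%:R^-1) <= W%:R * (n.+1%:R^-1 - n.+2%:R^-1).
    by rewrite ler_wpM2r.
  move=> H2; apply: le_trans (lerD IH H2) _.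
  by rewrite le_eqVlt; apply/orP; left; apply/eqP; ring.
have h : `|S n.+1 / n%:R| <= W%:R.
  rewrite normrM normfV (ger0_norm (ler0n _ n)) ler_pdivrMr ?ltr0n //.
  by rewrite (le_trans (S_bound _)) // ler_peMr ?ler0n // ler1n.
have := ler_normD (\sum_(1 <= u < n.+1) (cw R W u - rho * u%:R^-1) - S n.+1 / n%:R) (S n.+1 / n%:R).
rewrite subrK => /le_trans; apply; apply: le_trans (lerD key h) _.
have : 0 <= W%:R * n%:R^-1 :> R by rewrite mulr_ge0 ?invr_ge0 ?ler0n.
lra.
Qed.

Local Notation C0 := (3 * W%:R + 1 : R).

Lemma sum_cw_ln n : (0 < n)%N ->
  `|\sum_(1 <= u < n.+1) cw R W u - rho * ln n%:R| <= C0.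
Proof.
move=> n0; have := sum_cw_harmonic n0; rewrite sumrB -mulr_sumr.
set X := \sum_(_ <= _ < _) cw _ _ _; set H := \sum_(_ <= _ < _) _^-1 => h1.
have /andP[h2 h3] := harmonic_bound n0; rewrite -/H in h2 h3.
have /andP[r0 r1] := cop_density_bound.
have -> : X - rho * ln n%:R = (X - rho * H) + rho * (H - ln n%:R) by ring.
apply: le_trans (ler_normD _ _) _; apply: lerD => //.
rewrite normrM (ger0_norm r0) ger0_norm; last by lra.
by have := @ler_pM R rho 1 (H - ln n%:R) 1 r0; lra.
Qed.

(** The quotient is the integral of [t ^ i] over [[a, b]], which lies between [(b - a) * a ^+ i] and
    [(b - a) * b ^+ i]. *)
Lemma power_mean_bound (a b : R) i : 0 <= a -> a <= b ->
  0 <= (b - a) * b ^+ i - (b ^+ i.+1 - a ^+ i.+1) / i.+1%:R <= (b - a) * (b ^+ i - a ^+ i).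
Proof.
move=> a0 ab; have b0 : 0 <= b by apply: le_trans ab.
have n0 : 0 < i.+1%:R :> R by rewrite ltr0n.
set s := \sum_(j < i.+1) b ^+ (i - j) * a ^+ j.
have sE : b ^+ i.+1 - a ^+ i.+1 = (b - a) * s by rewrite subrXX.
have s1 : s <= i.+1%:R * b ^+ i.
  rewrite /s (le_trans (_ : _ <= \sum_(j < i.+1) b ^+ i)) //; last first.
    by rewrite sumr_const card_ord mulr_natl.
  apply: ler_sum => j _; rewrite -[in leRHS](subnK (leq_ord j)) exprD.
  by rewrite ler_wpM2l ?exprn_ge0 // lerXn2r ?nnegrE.
have s2 : i.+1%:R * a ^+ i <= s.
  rewrite /s (le_trans (_ : _ <= \sum_(j < i.+1) a ^+ i)) //.
    by rewrite sumr_const card_ord mulr_natl.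
  apply: ler_sum => j _; rewrite -[in leLHS](subnK (leq_ord j)) exprD.
  by rewrite ler_wpM2r ?exprn_ge0 // lerXn2r ?nnegrE.
rewrite sE -mulrA -!mulrBr; have ba : 0 <= b - a by rewrite subr_ge0.
have q1 : s / i.+1%:R <= b ^+ i by rewrite ler_pdivrMr // mulrC.
have q2 : a ^+ i <= s / i.+1%:R by rewrite ler_pdivlMr // mulrC.
apply/andP; split; first by rewrite mulr_ge0 // subr_ge0.
by rewrite ler_wpM2l // lerD2l lerN2.
Qed.

(** Partial summation done by induction: [D n - D0 n * ln n ^+ i] stands for minus the integral of
    [D0] against [d (ln t) ^ i], and its increments are at most [C0 + 1] times those of
    [ln n ^+ i]. *)
Lemma sum_cw_ln_pow i n : (0 < n)%N ->
  `|\sum_(1 <= u < n.+1) cw R W u * ln u%:R ^+ i - rho * ln n%:R ^+ i.+1 / i.+1%:R|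
  <= (2 * C0 + 1) * ln n%:R ^+ i.
Proof.
move=> n0; pose D0 n := \sum_(1 <= u < n.+1) cw R W u - rho * ln n%:R.
pose D n := \sum_(1 <= u < n.+1) cw R W u * ln u%:R ^+ i - rho * ln n%:R ^+ i.+1 / i.+1%:R.
have hD0 n' : (0 < n')%N -> `|D0 n'| <= C0 by exact: sum_cw_ln.
have l0 n' : (0 < n')%N -> 0 <= ln n'%:R :> R by move=> ?; rewrite ln_ge0 // ler1n.
have C00 : 0 <= C0 by rewrite addr_ge0 ?mulr_ge0 ?ler0n.
suff key : `|D n - D0 n * ln n%:R ^+ i| <= (C0 + 1) * ln n%:R ^+ i.
  rewrite -/(D n); have -> : D n = (D n - D0 n * ln n%:R ^+ i) + D0 n * ln n%:R ^+ i by ring.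
  apply: le_trans (ler_normD _ _) _.
  have : `|D0 n * ln n%:R ^+ i| <= C0 * ln n%:R ^+ i.
    by rewrite normrM (ger0_norm (exprn_ge0 _ (l0 n n0))) ler_wpM2r ?exprn_ge0 ?l0 ?hD0.
  by move: key; rewrite !mulrDl; lra.
have [i0|i0] := posnP i.
  have -> : D n = D0 n.
    rewrite /D /D0 i0 expr1 divr1; congr (_ - _).
    by apply: eq_bigr => u _; rewrite expr0 mulr1.
  by rewrite i0 expr0 !mulr1 subrr normr0 addr_ge0.
case: n n0 => // n _; elim: n => [|n IH].
  rewrite /D /D0 !big_nat1 ln1 !expr0n /= (gtn_eqF i0) !mulr0 !mul0r !subr0 normr0 //.
have -> : D n.+2 - D0 n.+2 * ln n.+2%:R ^+ i = (D n.+1 - D0 n.+1 * ln n.+1%:R ^+ i)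
    + (rho * ((ln n.+2%:R - ln n.+1%:R) * ln n.+2%:R ^+ i -
        (ln n.+2%:R ^+ i.+1 - ln n.+1%:R ^+ i.+1) / i.+1%:R)
       - D0 n.+1 * (ln n.+2%:R ^+ i - ln n.+1%:R ^+ i)).
  rewrite /D /D0 !(sum_nat_recr _ n.+1); ring.
apply: le_trans (ler_normD _ _) _.
have lm : ln n.+1%:R <= ln n.+2%:R :> R by rewrite ler_ln ?posrE ?ltr0n // ler_nat.
have lm1 : ln n.+2%:R - ln n.+1%:R <= 1 :> R.
  have [_ /le_trans] := @ln_succ_bound n.+1 isT; apply.
  by rewrite invf_le1 ?ltr0n // ler1n.
have /andP[b1 b2] := @power_mean_bound _ _ i (l0 n.+1 isT) lm.
set br := _ - _ / _ in b1 b2 *.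
have dp : 0 <= ln n.+2%:R ^+ i - ln n.+1%:R ^+ i :> R.
  by rewrite subr_ge0 lerXn2r ?nnegrE ?l0.
set dl := ln n.+2%:R ^+ i - ln n.+1%:R ^+ i in b2 dp *.
have /andP[r0 r1] := cop_density_bound.
have t1 : `|rho * br - D0 n.+1 * dl| <= (C0 + 1) * dl.
  apply: le_trans (ler_normB _ _) _; rewrite normrM (normrM (D0 _)).
  rewrite (ger0_norm r0) (ger0_norm b1) (ger0_norm dp).
  have : `|D0 n.+1| * dl <= C0 * dl by rewrite ler_wpM2r ?hD0.
  have : rho * br <= 1 * dl.
    apply: ler_pM => //; apply: le_trans b2 _; rewrite -[leRHS]mul1r ler_wpM2r //.
  by rewrite mulrDl; lra.
have -> : (C0 + 1) * ln n.+2%:R ^+ i = (C0 + 1) * ln n.+1%:R ^+ i + (C0 + 1) * dl.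
  by rewrite /dl; ring.
exact: lerD.
Qed.

End Harmonic.

(** * Sums over the simplex and Dirichlet integrals *)

Section SimplexSums.
Variable (R : realType).

(** The Beta integral of [t ^ i * (1 - t) ^ j] over the unit interval. *)
Definition beta_coef (i j : nat) : R := (i`! * j`!)%N%:R / ((i + j).+1)`!%:R.

(** The integral of [y ^ a * q ^ b] over the [n]-dimensional simplex, with [y = 1 - sum t] and
    [q = sum t ^ 2]. One coordinate [t] is split off: [(t ^ 2 + q') ^ b] is expanded binomially, and
    the remaining simplex is scaled by [1 - t], which accounts for the exponent [n' + a + 2 * j]. *)
Fixpoint simplex_moment (n a b : nat) : R :=
  if n is n'.+1 then
    \sum_(j < b.+1) 'C(b, j)%:R * simplex_moment n' a j * beta_coef (2 * (b - j)) (n' + a + 2 * j)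
  else (b == 0)%:R.

Lemma beta_coef0 i : beta_coef i 0 = i.+1%:R^-1.
Proof.
rewrite /beta_coef addn0 muln1 factS natrM invfM mulrA mulrAC divff ?mul1r //.
Qed.

Lemma beta_coefS i j : beta_coef i j.+1 = beta_coef i j - beta_coef i.+1 j.
Proof.
rewrite /beta_coef addSn addnS (factS (i + j).+1) (factS j) (factS i).
have := fact_gt0 (i + j).+1; move: (i + j).+1`! i`! j`! => F x y F0.
have e : (i + j).+2%:R = i.+1%:R + j.+1%:R :> R by rewrite -natrD addSn addnS.
have : (i + j).+2%:R != 0 :> R by rewrite pnatr_eq0.
have : F%:R != 0 :> R by rewrite pnatr_eq0 -lt0n.
rewrite !natrM; have -> : j.+1%:R = (i + j).+2%:R - i.+1%:R :> R by rewrite e addrC addKr.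
clear e; move: (F%:R) ((i + j).+2%:R) (i.+1%:R) (x%:R) (y%:R) => f s t a b f0 s0.
by field; rewrite ?f0 ?s0.
Qed.

Lemma beta_coef_ge0 i j : 0 <= beta_coef i j.
Proof. by rewrite divr_ge0 ?ler0n. Qed.

Lemma simplex_moment_ge0 n a b : 0 <= simplex_moment n a b.
Proof.
elim: n b => [|n IH] b /=; first by rewrite ler0n.
by apply: sumr_ge0 => j _; rewrite !mulr_ge0 ?ler0n ?beta_coef_ge0.
Qed.

Variable W : nat.
Hypothesis W_gt0 : (0 < W)%N.
Local Notation rho := (cop_density R W).
Definition cw_error : R := 2 * (3 * W%:R + 1) + 2.
Local Notation C1 := cw_error.

Lemma cw_error_ge0 : 0 <= C1.
Proof. by have := ler0n R W; rewrite /cw_error; lra. Qed.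

Section Level.
Variable Z : nat.
Local Notation V := 'I_Z.+1.
Local Notation L := (ln (Z%:R : R)).
Hypothesis L_ge1 : 1 <= L.

Definition log_size (u : nat) : R := ln u%:R / L.
Local Notation tl := log_size.

Lemma Z_gt1 : (1 < Z)%N.
Proof.
by move: L_ge1; case: Z => [|[|//]]; rewrite ?ln1 ?ln0 // ler10.
Qed.

Let L_gt0 : 0 < L. Proof. by apply: lt_le_trans L_ge1. Qed.

Lemma log_size_ge0 u : 0 <= tl u.
Proof.
rewrite /tl divr_ge0 ?(ltW L_gt0) //; case: u => [|u]; first by rewrite ln0.
by rewrite ln_ge0 // ler1n.
Qed.

Lemma log_size1 : tl 1 = 0. Proof. by rewrite /tl ln1 mul0r. Qed.

Lemma cw0 : cw R W 0 = 0. Proof. by rewrite /cw invr0; case: ifP. Qed.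

Lemma sum_cw_range (P : pred nat) (F : nat -> R) n : F 0%N = 0 -> (n <= Z)%N ->
  (forall u, (0 < u)%N -> P u = (u <= n)%N) ->
  \sum_(u : V | P u) F u = \sum_(1 <= u < n.+1) F u.
Proof.
move=> F0 nZ HP; rewrite -(big_mkord P F) big_mkcond /= big_ltn // F0 if_same add0r.
rewrite [RHS](big_nat_widen _ _ Z.+1) ?ltnS // [RHS]big_mkcond /=.
apply: eq_big_nat => u /andP[u0 _]; by rewrite HP // ltnS.
Qed.

Lemma sum_cw_pow i (x : R) : 0 <= x <= 1 ->
  `|\sum_(u : V | tl u <= x) cw R W u * tl u ^+ i - rho * L * (beta_coef i 0 * x ^+ i.+1)| <= C1.
Proof.
(* [e] is [Z ^ x], so the condition [log_size u <= x] reads [u <= e]. Replacing [e] by its integer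
   part [n] moves the logarithm by at most 1. *)
move=> /andP[x0 x1]; set e := expR (L * x).
have e1 : 1 <= e by rewrite -expR0 ler_expR mulr_ge0 // ltW.
have Z0 : 0 < Z%:R :> R by rewrite ltr0n (ltn_trans _ Z_gt1).
have eZ : e <= Z%:R by rewrite -[leRHS]lnK ?posrE // ler_expR ler_piMr // ltW.
set n := Num.truncn e.
have /andP[ne en] : n%:R <= e < n.+1%:R.
  by apply: truncn_itv; apply: le_trans e1.
have n0 : (0 < n)%N by rewrite truncn_gt0.
have nZ : (n <= Z)%N by rewrite -(ler_nat R) (le_trans ne).
rewrite (sum_cw_range (P := fun u => tl u <= x) (F := fun u => cw R W u * tl u ^+ i) (n := n)) //.
- rewrite (eq_bigr (fun u => cw R W u * ln u%:R ^+ i * (L ^+ i)^-1)); last first.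
    by move=> u _; rewrite /tl expr_div_n mulrA.
  rewrite -mulr_suml.
  have := @sum_cw_ln_pow R W W_gt0 i n n0; set M := \sum_(_ <= _ < _) _ => HM.
  set l := ln n%:R in HM; have [y yE] : exists y, y = l / L by exists (l / L).
  have l0 : 0 <= l by rewrite ln_ge0 // ler1n.
  have lx : l <= L * x by rewrite -[leRHS]expRK ler_ln ?posrE ?expR_gt0 ?ltr0n.
  have xl : L * x - l <= 1.
    have [_ h] := @ln_succ_bound R n n0.
    have h2 : L * x <= ln n.+1%:R.
      by rewrite -[leLHS]expRK ler_ln ?posrE ?expR_gt0 ?ltr0n // ltW.
    have h3 : n%:R^-1 <= 1 :> R by rewrite invf_le1 ?ltr0n // ler1n.
    rewrite -/l in h; lra.
  have y0 : 0 <= y by rewrite yE divr_ge0 // ltW.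
  have yx : y <= x by rewrite yE ler_pdivrMr // mulrC.
  have y1 : y <= 1 by apply: le_trans x1.
  have lE : l = L * y by rewrite yE mulrC divfK // gt_eqF.
  have Li : 0 < L ^+ i by rewrite exprn_gt0.
  have /andP[r0 r1] := cop_density_bound R W_gt0.
  have A1 : `|M / L ^+ i - rho * L * (y ^+ i.+1 / i.+1%:R)| <= 2 * (3 * W%:R + 1) + 1.
    have -> : M / L ^+ i - rho * L * (y ^+ i.+1 / i.+1%:R) =
       (M - rho * l ^+ i.+1 / i.+1%:R) / L ^+ i.
      rewrite mulrBl lE exprMn (exprS L); congr (_ - _).
      move: (L ^+ i) Li (y ^+ i.+1) => e0 e00 e2.
      have : i.+1%:R != 0 :> R by rewrite pnatr_eq0.
      by move: (i.+1%:R) => s s0; field; rewrite ?s0 gt_eqF.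
    rewrite normrM normfV (ger0_norm (ltW Li)) ler_pdivrMr // (le_trans HM) //.
    rewrite ler_wpM2l ?addr_ge0 ?mulr_ge0 ?addr_ge0 ?mulr_ge0 ?ler0n //.
    by rewrite lE lerXn2r ?nnegrE ?mulr_ge0 ?(ltW L_gt0) // ler_piMr // ltW.
  have A2 : `|rho * L * (x ^+ i.+1 / i.+1%:R) - rho * L * (y ^+ i.+1 / i.+1%:R)| <= 1.
    have /andP[p1 p2] := @power_mean_bound R y x i y0 yx.
    have p3 : (x ^+ i.+1 - y ^+ i.+1) / i.+1%:R <= x - y.
      have : (x - y) * x ^+ i <= x - y by rewrite ler_piMr ?subr_ge0 // exprn_ile1.
      by move=> h; apply: le_trans h; rewrite -subr_ge0.
    have p4 : 0 <= (x ^+ i.+1 - y ^+ i.+1) / i.+1%:R.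
      by rewrite divr_ge0 ?ler0n // subr_ge0 lerXn2r ?nnegrE.
    rewrite -mulrBr -mulrBl (ger0_norm (mulr_ge0 (mulr_ge0 r0 (ltW L_gt0)) p4)).
    have : L * ((x ^+ i.+1 - y ^+ i.+1) / i.+1%:R) <= 1.
      apply: le_trans (_ : L * (x - y) <= 1); first by rewrite ler_wpM2l ?(ltW L_gt0).
      by rewrite mulrBr -lE.
    rewrite -mulrA => h; have h0 : 0 <= L * ((x ^+ i.+1 - y ^+ i.+1) / i.+1%:R).
      by rewrite mulr_ge0 // ltW.
    by rewrite -[leRHS]mulr1; apply: ler_pM.
  rewrite beta_coef0 [i.+1%:R^-1 * _]mulrC.
  have -> : M * (L ^+ i)^-1 - rho * L * (x ^+ i.+1 / i.+1%:R) =
    (M / L ^+ i - rho * L * (y ^+ i.+1 / i.+1%:R)) -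
    (rho * L * (x ^+ i.+1 / i.+1%:R) - rho * L * (y ^+ i.+1 / i.+1%:R)) by ring.
  apply: le_trans (ler_normB _ _) _; rewrite /cw_error; apply: le_trans (lerD A1 A2) _.
  by rewrite -addrA lerD2l; lra.
- by rewrite cw0 mul0r.
move=> u u0; rewrite ler_pdivrMr // [x * _]mulrC -[in LHS](expRK (L * x)).
rewrite ler_ln ?posrE ?expR_gt0 ?ltr0n // -/e.
apply/idP/idP => [ue|un]; last by rewrite (le_trans _ ne) // ler_nat.
by rewrite -ltnS -(ltr_nat R) (le_lt_trans ue).
Qed.

(** Induction on [j] through [(x - t) ^ (j + 1) = x * (x - t) ^ j - t * (x - t) ^ j], which matches
    [beta_coefS]; each step doubles the error. *)
Lemma sum_cw_beta j i (x : R) : 0 <= x <= 1 ->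
  `|\sum_(u : V | tl u <= x) cw R W u * (tl u ^+ i * (x - tl u) ^+ j) -
    rho * L * (beta_coef i j * x ^+ (i + j).+1)| <= 2 ^+ j * C1.
Proof.
move=> x01; have /andP[x0 x1] := x01; elim: j i => [|j IH] i.
  rewrite expr0 mul1r addn0; apply: le_trans (sum_cw_pow i x01).
  rewrite le_eqVlt; apply/orP; left; apply/eqP; congr `|_ - _|.
  by apply: eq_bigr => u _; rewrite expr0 mulr1.
have -> : \sum_(u : V | tl u <= x) cw R W u * (tl u ^+ i * (x - tl u) ^+ j.+1) =
   x * (\sum_(u : V | tl u <= x) cw R W u * (tl u ^+ i * (x - tl u) ^+ j)) -
   \sum_(u : V | tl u <= x) cw R W u * (tl u ^+ i.+1 * (x - tl u) ^+ j).
  rewrite mulr_sumr -sumrB; apply: eq_bigr => u _; rewrite !exprS; ring.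
have := IH i; have := IH i.+1; rewrite beta_coefS addSn addnS.
set S1 := \sum_(_ | _) _; set S2 := \sum_(_ | _) _ => h1 h2.
have -> : x * S2 - S1 - rho * L * ((beta_coef i j - beta_coef i.+1 j) * x ^+ (i + j).+2) =
   x * (S2 - rho * L * (beta_coef i j * x ^+ (i + j).+1)) -
   (S1 - rho * L * (beta_coef i.+1 j * x ^+ (i + j).+2)) by rewrite !exprS; ring.
apply: le_trans (ler_normB _ _) _.
have -> : 2 ^+ j.+1 * C1 = 2 ^+ j * C1 + 2 ^+ j * C1 by rewrite exprS; ring.
apply: lerD => //; rewrite normrM (ger0_norm x0); apply: le_trans h2.
by rewrite ler_piMl.
Qed.

Section Tuples.
Variable K : finType.
Implicit Types (u : {ffun K -> V}) (A : {set K}).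

Definition log_sum u : R := \sum_i tl (u i).
Definition log_sq_sum u : R := \sum_i tl (u i) ^+ 2.
Definition simplex_sum A a b x : R :=
  \sum_(u | log_sum u <= x) twt R W A u * ((x - log_sum u) ^+ a * log_sq_sum u ^+ b).

Lemma log_sum_ge0 u : 0 <= log_sum u.
Proof. by apply: sumr_ge0 => i _; exact: log_size_ge0. Qed.

Lemma sum_ffun_coord i (H : {ffun K -> V} -> R) :
  \sum_u H u = \sum_(v : V) \sum_(u : {ffun K -> V} | u i == inord 1) H (set_coord i u v).
Proof.
rewrite (partition_big (fun u : {ffun K -> V} => u i) xpredT) //=; apply: eq_bigr => v _.
rewrite (reindex_onto (fun u : {ffun K -> V} => set_coord i u v) (fun u => set_coord i u (inord 1))).
  apply: eq_bigl => u; rewrite ffunE eqxx eqxx /=; apply/eqP/eqP => [<-|ui].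
    by rewrite ffunE eqxx.
  by apply/ffunP => j; rewrite !ffunE; case: eqP => [->|] //.
move=> u /eqP ui; apply/ffunP => j; rewrite !ffunE; by case: eqP => [->|].
Qed.

Lemma twt_set_coord A i u v : i \notin A -> u i = inord 1 ->
  twt R W (i |: A)%SET (set_coord i u v) = cw R W v * twt R W A u.
Proof.
move=> iA ui; rewrite /twt (bigD1 i) //= [in RHS](bigD1 i) //= ffunE eqxx.
have -> : wt R W (i |: A)%SET i v = cw R W v by rewrite /wt setU11.
have -> : wt R W A i (u i) = 1.
  by rewrite /wt (negbTE iA) ui inordK ?ltnS ?(ltnW Z_gt1) // eqxx.
rewrite mul1r; congr (_ * _); apply: eq_bigr => j /negbTE ji.
by rewrite ffunE ji /wt !finset.inE ji.
Qed.

Lemma twt_coord_eq0 A i u : i \notin A -> u i != inord 1 -> twt R W A u = 0.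
Proof.
move=> iA ui; rewrite /twt (bigD1 i) //= /wt (negbTE iA).
case: eqP => [E|_]; last by rewrite mul0r.
by case/eqP: ui; apply: val_inj; rewrite /= inordK // ltnS ltnW // Z_gt1.
Qed.

Lemma sum_set_coord (F : K -> nat -> R) i u v : u i = inord 1 -> F i 1%N = 0 ->
  \sum_j F j (set_coord i u v j) = F i v + \sum_j F j (u j).
Proof.
move=> ui F1; rewrite (bigD1 i) //= [in RHS](bigD1 i) //= ffunE eqxx ui inordK; last first.
  by rewrite ltnS ltnW // Z_gt1.
rewrite F1 add0r; congr (_ + _); by apply: eq_bigr => j /negbTE ji; rewrite ffunE ji.
Qed.

(** Discrete counterpart of the recursion defining [simplex_moment]: the value of coordinate [i] is
    summed last and the rest lives on the simplex of size [x - tl v]. *)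
Lemma simplex_sum_step A i a b x : i \notin A ->
  simplex_sum (i |: A)%SET a b x =
  \sum_(j < b.+1) 'C(b, j)%:R *
    \sum_(v : V | tl v <= x) cw R W v * (tl v ^+ (2 * (b - j)) * simplex_sum A a j (x - tl v)).
Proof.
move=> iA; rewrite /simplex_sum big_mkcond (sum_ffun_coord i) /=.
under [RHS]eq_bigr => j _ do rewrite mulr_sumr.
rewrite [RHS]exchange_big /= [RHS]big_mkcond; apply: eq_bigr => v _.
have E1 u : u i == inord 1 -> log_sum (set_coord i u v) = tl v + log_sum u.
  by move=> /eqP ui; exact: (@sum_set_coord (fun _ => tl) i u v ui log_size1).
have E2 u : u i == inord 1 -> log_sq_sum (set_coord i u v) = tl v ^+ 2 + log_sq_sum u.
  move=> /eqP ui; apply: (@sum_set_coord (fun _ w => tl w ^+ 2) i u v ui).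
  by rewrite log_size1 expr0n.
case: ifPn => [vx|]; last first.
  rewrite -ltNge => vx; rewrite big1 // => u ui; rewrite E1 // ifF //.
  by apply/negbTE; rewrite -ltNge (lt_le_trans vx) // lerDl log_sum_ge0.
under [RHS]eq_bigr => j _ do rewrite !mulr_sumr.
rewrite [RHS]exchange_big /= big_mkcond [RHS]big_mkcond; apply: eq_bigr => u _.
have [ui|ui] := boolP (u i == inord 1); last first.
  case: ifP => // _; rewrite big1 // => j _; by rewrite (twt_coord_eq0 iA ui) !(mul0r, mulr0).
rewrite E1 // E2 // -lerBrDl; case: ifP => // ux.
rewrite (twt_set_coord _ iA (eqP ui)) [(_ + log_sq_sum u) ^+ b]exprDn !mulr_sumr; apply: eq_bigr => j _.
rewrite -mulr_natl exprM opprD addrA; ring.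
Qed.

End Tuples.
End Level.

(** The induction needs uniformity in [x], since the remaining simplex shrinks with the coordinate
    split off. The error is one power of the logarithm below the main term; the factor [ln Z] on the
    left avoids a negative exponent for [n = 0]. *)
Lemma simplex_sum_asymptotic n : exists c : nat -> nat -> R, forall a b,
  0 <= c a b /\ forall Z (K : finType) (A : {set K}) (x : R), 1 <= ln (Z%:R : R) -> #|A| = n ->
    0 <= x <= 1 ->
  `|@simplex_sum Z K A a b x - (rho * ln Z%:R) ^+ n * simplex_moment n a b * x ^+ (n + a + 2 * b)|
     * ln Z%:R <= c a b * ln Z%:R ^+ n.
Proof.
elim: n => [|n [c Hc]].
  exists (fun _ _ => 0) => a b; split=> // Z K A x L1 /cards0_eq -> /andP[x0 x1].
  have L0 : 0 < ln Z%:R :> R by apply: lt_le_trans L1.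
  rewrite mul0r pmulr_lle0 // normr_le0 subr_eq0 expr0 mul1r /=.
  pose u1 : {ffun K -> 'I_Z.+1} := [ffun=> inord 1].
  have one i : u1 i = 1%N :> nat by rewrite ffunE inordK // ltnS (ltnW (Z_gt1 L1)).
  have s1 : log_sum u1 = 0.
    by rewrite /log_sum big1 // => i _; rewrite one log_size1.
  have s2 : log_sq_sum u1 = 0.
    by rewrite /log_sq_sum big1 // => i _; rewrite one log_size1 expr0n.
  rewrite /simplex_sum (bigD1 u1) /= ?s1 // s2 subr0 expr0n [X in _ + X]big1 ?addr0.
    rewrite /twt big1 => [|i _]; last by rewrite /wt finset.inE one eqxx.
    by case: b => [|b]; rewrite ?mulr0 ?mul0r ?muln0 ?addn0 //= ?mul1r ?mulr1.
  move=> u /andP[_ /eqP nu]; suff /existsP[i ui] : [exists i, u i != inord 1].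
    by rewrite (twt_coord_eq0 L1 _ ui) ?finset.inE ?mul0r.
  apply: contra_notT nu => /existsPn H; apply/ffunP => i; rewrite ffunE.
  by apply/eqP; have := H i; rewrite negbK.
pose B j a := 2 ^+ (n + a + 2 * j) * C1.
exists (fun a b => \sum_(j < b.+1) 'C(b, j)%:R * (c a j * (1 + C1) + simplex_moment n a j * B j a)).
have C10 := cw_error_ge0.
move=> a b; split.
  apply: sumr_ge0 => j _; have [cj _] := Hc a j.
  by rewrite mulr_ge0 ?ler0n // addr_ge0 ?mulr_ge0 ?addr_ge0 ?exprn_ge0 ?simplex_moment_ge0.
move=> Z K A x L1 An x01; have /andP[x0 x1] := x01; set L := ln Z%:R.
have L0 : 0 < L by apply: lt_le_trans L1.
have /andP[r0 r1] := cop_density_bound R W_gt0.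
have [i iA] : exists i, i \in A by apply/set0Pn; rewrite -card_gt0 An.
pose A' := (A :\ i)%SET; have AE : A = (i |: A')%SET by rewrite /A' finset.setD1K.
have A'n : #|A'| = n by have := cardsD1 i A; rewrite iA An => -[].
have iA' : i \notin A' by rewrite !finset.inE eqxx.
rewrite AE (simplex_sum_step L1 a b x iA').
pose S j := \sum_(v : 'I_Z.+1 | log_size Z v <= x)
    cw R W v * (log_size Z v ^+ (2 * (b - j)) * (x - log_size Z v) ^+ (n + a + 2 * j)).
have SE j : (j <= b)%N -> `|S j - rho * L * (beta_coef (2 * (b - j)) (n + a + 2 * j) * x ^+ (n.+1 + a + 2 * b))|
    <= B j a.
  move=> jb; have := sum_cw_beta L1 (n + a + 2 * j) (2 * (b - j)) x01.
  rewrite (_ : (2 * (b - j) + (n + a + 2 * j)).+1 = n.+1 + a + 2 * b)%N //.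
  by rewrite mulnBr; move: jb; rewrite -(leq_pmul2l (isT : 0 < 2)%N); lia.
have mb : \sum_(v : 'I_Z.+1 | log_size Z v <= x) cw R W v <= (1 + C1) * L.
  have := sum_cw_beta L1 0 0 x01; rewrite expr0 mul1r /beta_coef /= divr1 mul1r expr1.
  under eq_bigr => v _ do rewrite expr0 mulr1 mulr1.
  set M := \sum_(_ | _) _; rewrite ler_norml => /andP[_ h].
  have : rho * L * x <= L.
    by rewrite -mulrA mulrCA ler_piMr ?(ltW L0) // mulr_ile1.
  have : C1 <= C1 * L by rewrite ler_peMr.
  have -> : (1 + C1) * L = L + C1 * L by ring.
  by move: h; rewrite -/L; lra.
pose X j := \sum_(v : 'I_Z.+1 | log_size Z v <= x)
   cw R W v * (log_size Z v ^+ (2 * (b - j)) * simplex_sum Z A' a j (x - log_size Z v)).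
(* Two errors: the inner sums are replaced by their main terms, at a cost proportional to the weight
   of the outer variable, and then the outer sum by its Beta integral. *)
have step j : (j <= b)%N -> `|X j - (rho * L) ^+ n * simplex_moment n a j *
    (rho * L * (beta_coef (2 * (b - j)) (n + a + 2 * j) * x ^+ (n.+1 + a + 2 * b)))| * L <=
    (c a j * (1 + C1) + simplex_moment n a j * B j a) * L ^+ n.+1.
  move=> jb; have [c0 Hcj] := Hc a j.
  have m0 := simplex_moment_ge0 n a j.
  have tn0 : 0 <= (rho * L) ^+ n by rewrite exprn_ge0 // mulr_ge0 // ltW.
  have tnL : (rho * L) ^+ n <= L ^+ n.
    by rewrite lerXn2r ?nnegrE ?mulr_ge0 ?(ltW L0) // ler_piMl ?(ltW L0).
  have h1 : `|X j - (rho * L) ^+ n * simplex_moment n a j * S j| * L <= c a j * (1 + C1) * L ^+ n.+1.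
    rewrite /X /S mulr_sumr -sumrB.
    apply: (@le_trans _ _ (\sum_(v : 'I_Z.+1 | log_size Z v <= x) cw R W v * (c a j * L ^+ n))).
      apply: le_trans (ler_wpM2r (ltW L0) (ler_norm_sum _ _ _)) _.
      rewrite mulr_suml; apply: ler_sum => v vx.
      have t0 := log_size_ge0 L1 v.
      have t1 : log_size Z v <= 1 by apply: le_trans x1.
      have -> : cw R W v * (log_size Z v ^+ (2 * (b - j)) * simplex_sum Z A' a j (x - log_size Z v)) -
         (rho * L) ^+ n * simplex_moment n a j * (cw R W v * (log_size Z v ^+ (2 * (b - j)) * (x - log_size Z v) ^+ (n + a + 2 * j))) =
        cw R W v * (log_size Z v ^+ (2 * (b - j)) * (simplex_sum Z A' a j (x - log_size Z v) -
          (rho * L) ^+ n * simplex_moment n a j * (x - log_size Z v) ^+ (n + a + 2 * j))) by ring.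
      rewrite normrM (ger0_norm (cw_ge0 _ _ _)) -mulrA ler_wpM2l ?cw_ge0 //.
      have xv : 0 <= x - log_size Z v <= 1.
        by rewrite subr_ge0 vx /= lerBlDr (le_trans x1) // lerDl.
      apply: le_trans (Hcj Z K A' _ L1 A'n xv); rewrite ler_wpM2r ?(ltW L0) // normrM.
      by rewrite ler_piMl // ger0_norm ?exprn_ge0 // exprn_ile1.
    rewrite -mulr_suml exprS mulrA; apply: le_trans (ler_wpM2r _ mb) _.
      by rewrite mulr_ge0 ?exprn_ge0 // ltW.
    by rewrite le_eqVlt; apply/orP; left; apply/eqP; ring.
  have h2 : `|(rho * L) ^+ n * simplex_moment n a j * S j - (rho * L) ^+ n * simplex_moment n a j *
    (rho * L * (beta_coef (2 * (b - j)) (n + a + 2 * j) * x ^+ (n.+1 + a + 2 * b)))| * L <=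
    simplex_moment n a j * B j a * L ^+ n.+1.
    rewrite -mulrBr normrM (ger0_norm (mulr_ge0 tn0 m0)) exprS.
    have -> : simplex_moment n a j * B j a * (L * L ^+ n) = L ^+ n * simplex_moment n a j * B j a * L by ring.
    rewrite ler_wpM2r ?(ltW L0) //; apply: ler_pM => //; first exact: mulr_ge0.
      by rewrite ler_wpM2r.
    exact: SE.
  rewrite mulrDl; apply: le_trans (lerD h1 h2); rewrite -mulrDl ler_wpM2r ?(ltW L0) //.
  apply: le_trans (ler_normD _ _); rewrite le_eqVlt; apply/orP; left; apply/eqP; congr `|_|.
  by ring.
rewrite /= mulr_sumr mulr_suml -sumrB mulr_suml.
apply: le_trans (ler_wpM2r (ltW L0) (ler_norm_sum _ _ _)) _.
rewrite mulr_suml; apply: ler_sum => j _.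
have -> : 'C(b, j)%:R * X j - (rho * L) ^+ n.+1 * ('C(b, j)%:R * simplex_moment n a j *
     beta_coef (2 * (b - j)) (n + a + 2 * j)) * x ^+ (n.+1 + a + 2 * b) =
   'C(b, j)%:R * (X j - (rho * L) ^+ n * simplex_moment n a j *
    (rho * L * (beta_coef (2 * (b - j)) (n + a + 2 * j) * x ^+ (n.+1 + a + 2 * b)))).
  by rewrite exprS; ring.
rewrite normrM (ger0_norm (ler0n _ _)) -[leLHS]mulrA -[leRHS]mulrA.
by apply: ler_wpM2l; [exact: ler0n | apply: step; rewrite -ltnS].
Qed.

End SimplexSums.

(** * Moments on the simplex *)

Section Moments.
Variable R : realType.
Local Notation mom := (simplex_moment R).

Lemma beta_moment (n M i m : nat) (x : R) : M = (i + m).+1 ->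
  x / m`!%:R * beta_coef R i m = x * i`!%:R / M`!%:R.
Proof.
move=> ->; rewrite /beta_coef natrM.
have h k : k`!%:R != 0 :> R by rewrite pnatr_eq0 -lt0n fact_gt0.
move: (h m) (h (i + m).+1); move: (m`!%:R) ((i + m).+1`!%:R) (i`!%:R) => a b c a0 b0.
by field; rewrite ?a0 ?b0.
Qed.

(** Closed forms are obtained by induction on [n]. Since [F] and its fibre integral are linear in
    [q], their squares only involve [b <= 2]. *)
Lemma simplex_moment0 n a : mom n a 0 = a`!%:R / (n + a)`!%:R.
Proof.
elim: n => [|n IH]; first by rewrite /= divff // pnatr_eq0 -lt0n fact_gt0.
rewrite /= big_ord_recl big_ord0 addr0 /= IH bin0 mul1r muln0 addn0.
by rewrite (@beta_moment 0 (n.+1 + a)) // fact0 mulr1.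
Qed.

Lemma simplex_moment1 n a : mom n a 1 = 2 * n%:R * a`!%:R / (n + a + 2)`!%:R.
Proof.
elim: n => [|n IH]; first by rewrite /= mulr0 !mul0r.
rewrite /= !big_ord_recl big_ord0 addr0 /= simplex_moment0 IH bin0 bin1 !mul1r muln0 addn0.
rewrite (@beta_moment 0 (n.+1 + a + 2)); last by lia.
rewrite (@beta_moment 0 (n.+1 + a + 2)); last by lia.
rewrite fact0 (_ : (2 * (1 - 0))`! = 2)%N // -mulrDl -[n.+1%:R]natr1.
by congr (_ / _); ring.
Qed.

Lemma simplex_moment_rec2 n a : mom n.+1 a 2 = mom n a 0 * beta_coef R 4 (n + a)
  + 2 * mom n a 1 * beta_coef R 2 (n + a + 2) + mom n a 2 * beta_coef R 0 (n + a + 4).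
Proof.
rewrite [LHS]/= !big_ord_recl big_ord0 addr0 addrA bin0 bin1 binn !mul1r muln0 addn0.
by [].
Qed.

Lemma simplex_moment2 n a : mom n a 2 = (4 * n%:R ^+ 2 + 20 * n%:R) * a`!%:R / (n + a + 4)`!%:R.
Proof.
elim: n => [|n IH]; first by rewrite /= expr0n mulr0 mulr0 addr0 !mul0r.
rewrite simplex_moment_rec2 simplex_moment0 simplex_moment1 IH -[2 * _ * _]mulrA.
rewrite (@beta_moment 0 (n.+1 + a + 4)); last by lia.
rewrite (@beta_moment 0 (n.+1 + a + 4)); last by lia.
rewrite (@beta_moment 0 (n.+1 + a + 4)); last by lia.
move: ((n.+1 + a + 4)`!) => F; rewrite -[n.+1%:R]natr1 !factS fact0 !natrM.
by move: (F%:R^-1) => x; ring.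
Qed.

Lemma factS_R n : n.+1`!%:R = n.+1%:R * n`!%:R :> R.
Proof. by rewrite factS natrM. Qed.

Let f0 : 0`!%:R = 1 :> R. Proof. by rewrite fact0. Qed.
Let f1 : 1`!%:R = 1 :> R. Proof. by rewrite (factS_R 0) f0 mulr1. Qed.
Let f2 : 2`!%:R = 2 :> R. Proof. by rewrite (factS_R 1) f1 mulr1. Qed.
Let f3 : 3`!%:R = 6 :> R. Proof. by rewrite (factS_R 2) f2; ring. Qed.
Let f4 : 4`!%:R = 24 :> R. Proof. by rewrite (factS_R 3) f3; ring. Qed.
Let f5 : 5`!%:R = 120 :> R. Proof. by rewrite (factS_R 4) f4; ring. Qed.
Let f6 : 6`!%:R = 720 :> R. Proof. by rewrite (factS_R 5) f5; ring. Qed.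
Let f7 : 7`!%:R = 7 * 720 :> R. Proof. by rewrite (factS_R 6) f6; ring. Qed.
Let f8 : 8`!%:R = 56 * 720 :> R. Proof. by rewrite (factS_R 7) f7; ring. Qed.
Let f9 : 9`!%:R = 504 * 720 :> R. Proof. by rewrite (factS_R 8) f8; ring. Qed.
Let f10 : 10`!%:R = 10 * 504 * 720 :> R. Proof. by rewrite (factS_R 9) f9; ring. Qed.
Let f11 : 11`!%:R = 110 * 504 * 720 :> R. Proof. by rewrite (factS_R 10) f10; ring. Qed.

Let mom0 n a X Y : a`!%:R = X :> R -> (n + a)`!%:R = Y :> R -> mom n a 0 = X / Y.
Proof. by move=> <- <-; exact: simplex_moment0. Qed.
Let mom1 n a X Y : a`!%:R = X :> R -> (n + a + 2)`!%:R = Y :> R -> mom n a 1 = 2 * n%:R * X / Y.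
Proof. by move=> <- <-; exact: simplex_moment1. Qed.
Let mom2 n a X Y : a`!%:R = X :> R -> (n + a + 4)`!%:R = Y :> R ->
  mom n a 2 = (4 * n%:R ^+ 2 + 20 * n%:R) * X / Y.
Proof. by move=> <- <-; exact: simplex_moment2. Qed.

(** The terms are those of [(y + 4 * y ^ 2 + q) ^ 2]; the value is [I = 29 / 60480]. *)
Lemma square_integral : mom 6 2 0 + 16 * mom 6 4 0 + mom 6 0 2 + 8 * mom 6 3 0
  + 2 * mom 6 1 1 + 8 * mom 6 2 1 = 29 / (240 * 252).
Proof.
rewrite (@mom0 6 2 _ _ f2 f8) (@mom0 6 4 _ _ f4 f10) (@mom0 6 3 _ _ f3 f9).
rewrite (@mom1 6 1 _ _ f1 f9) (@mom1 6 2 _ _ f2 f10) (@mom2 6 0 _ _ f0 f10).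
by field.
Qed.

(** Integrating [F] in one coordinate gives [y ^ 2 / 2 + 5 / 3 * y ^ 3 + y * q], where
    [5 / 3 = 4 / 3 + 1 / 3] and the last third comes from the square of the integrated coordinate.
    The terms are those of its square. *)
Lemma fibre_integral : mom 5 4 0 / 4 + 25 / 9 * mom 5 6 0 + mom 5 2 2 + 5 / 3 * mom 5 5 0
  + mom 5 3 1 + 10 / 3 * mom 5 4 1 = 1 / (60 * 99).
Proof.
rewrite (@mom0 5 4 _ _ f4 f9) (@mom0 5 6 _ _ f6 f11) (@mom0 5 5 _ _ f5 f10).
rewrite (@mom1 5 3 _ _ f3 f10) (@mom1 5 4 _ _ f4 f11) (@mom2 5 2 _ _ f2 f11).
by field.
Qed.

End Moments.

(** The coefficients add up to [1 + 16 + 1 + 8 + 2 + 8 = 36]. *)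
Lemma six_term_upper (R : realFieldType) (T d s1 s2 s3 s4 s5 s6 m1 m2 m3 m4 m5 m6 : R) :
  s1 - T * m1 <= d / 36 * T -> s2 - T * m2 <= d / 36 * T -> s3 - T * m3 <= d / 36 * T ->
  s4 - T * m4 <= d / 36 * T -> s5 - T * m5 <= d / 36 * T -> s6 - T * m6 <= d / 36 * T ->
  s1 + 16 * s2 + s3 + 8 * s4 + 2 * s5 + 8 * s6 <=
  T * (m1 + 16 * m2 + m3 + 8 * m4 + 2 * m5 + 8 * m6 + d).
Proof. lra. Qed.

(** The coefficients add up to less than 11, so errors of [d / 22] stay below [d / 2]. *)
Lemma six_term_lower (R : realFieldType) (T d s1 s2 s3 s4 s5 s6 m1 m2 m3 m4 m5 m6 : R) :
  0 <= d * T ->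
  - (d / 22 * T) <= s1 - T * m1 -> - (d / 22 * T) <= s2 - T * m2 -> - (d / 22 * T) <= s3 - T * m3 ->
  - (d / 22 * T) <= s4 - T * m4 -> - (d / 22 * T) <= s5 - T * m5 -> - (d / 22 * T) <= s6 - T * m6 ->
  T * (m1 / 4 + 25 / 9 * m2 + m3 + 5 / 3 * m4 + m5 + 10 / 3 * m6 - d / 2) <=
  s1 / 4 + 25 / 9 * s2 + s3 + 5 / 3 * s4 + s5 + 10 / 3 * s6.
Proof. lra. Qed.

(** * The test function and its two sums *)

Section TestFunction.
Variables (R : realType) (W : nat).
Hypothesis W_gt0 : (0 < W)%N.
Local Notation rho := (cop_density R W).
Local Notation C1 := (cw_error R W).
Local Notation mom := (simplex_moment R).
Local Notation tau Z := (rho * ln (Z%:R : R)).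

Lemma cop_density_gt0 : 0 < rho.
Proof. by rewrite divr_gt0 ?ltr0n ?totient_gt0. Qed.

Lemma simplex_sum_near n a b (d : R) : 0 < d -> exists2 L0 : R, 1 <= L0 &
  forall Z (K : finType) (A : {set K}), L0 <= ln (Z%:R : R) -> #|A| = n ->
  `|simplex_sum W Z A a b (1 : R) - tau Z ^+ n * mom n a b| <= d * tau Z ^+ n.
Proof.
move=> d0; have [c /(_ a b) [c0 Hc]] := simplex_sum_asymptotic R W_gt0 n.
have r0 := cop_density_gt0.
have rn0 : 0 < rho ^+ n * d by rewrite mulr_gt0 // exprn_gt0.
exists (1 + c a b / (rho ^+ n * d)); first by rewrite lerDl divr_ge0 // ltW.
move=> Z K A HL An; set L := ln _ in HL *.
have q0 : 0 <= c a b / (rho ^+ n * d) by rewrite divr_ge0 // ltW.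
have L1 : 1 <= L by lra.
have L0 : 0 < L by lra.
have := Hc Z K A 1 L1 An; rewrite ler01 lexx => /(_ isT); rewrite expr1n mulr1 -/L.
set X := `|_| => HX; rewrite -(ler_pM2r L0); apply: le_trans HX _.
have Ln : 0 <= L ^+ n by rewrite exprn_ge0 // ltW.
have h : c a b <= L * (rho ^+ n * d) by rewrite -ler_pdivrMr //; lra.
apply: le_trans (ler_wpM2r Ln h) _; rewrite -/L [(rho * L) ^+ n]exprMn le_eqVlt.
by apply/orP; left; apply/eqP; ring.
Qed.

Definition test_fun Z (u : {ffun 'I_6 -> 'I_Z.+1}) : R :=
  if log_sum R u <= 1 then (1 - log_sum R u) + 4 * (1 - log_sum R u) ^+ 2 + log_sq_sum R u else 0.

Section Level.
Variable Z : nat.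
Local Notation L := (ln (Z%:R : R)).
Hypothesis L_ge1 : 1 <= L.
Local Notation t := (tau Z).
Implicit Types u : {ffun 'I_6 -> 'I_Z.+1}.

Let L_gt0 : 0 < L. Proof. by apply: lt_le_trans L_ge1. Qed.

Lemma log_sq_sum_ge0 u : 0 <= log_sq_sum R u.
Proof. by apply: sumr_ge0 => i _; rewrite sqr_ge0. Qed.

Lemma log_sq_sum_le u : log_sum R u <= 1 -> log_sq_sum R u <= 1.
Proof.
move=> u1; apply: le_trans u1; apply: ler_sum => i _.
have t0 := log_size_ge0 L_ge1 (u i).
have t1 : log_size R Z (u i) <= 1.
  rewrite /log_size ler_pdivrMr // mul1r; case: (posnP (u i)) => [->|ui].
    by rewrite ln0 // ltW.
  by rewrite ler_ln ?posrE ?ltr0n ?(ltnW (Z_gt1 L_ge1)) // ler_nat -ltnS.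
by rewrite expr2 ler_piMr.
Qed.

(** On the simplex [y] and [q] are at most 1, whence [1 + 4 + 1]. *)
Lemma test_fun_bound u : 0 <= test_fun u <= 6.
Proof.
rewrite /test_fun; case: ifP => [u1|_]; last by rewrite lexx ler0n.
have q0 := log_sq_sum_ge0 u; have q1 := log_sq_sum_le u1; have p0 := log_sum_ge0 L_ge1 u.
apply/andP; split; nra.
Qed.

Lemma test_fun_supp u : (Z < \prod_i u i)%N -> test_fun u = 0.
Proof.
move=> uZ; rewrite /test_fun ifF //; apply/negbTE; rewrite -ltNge.
have upos i : (0 < u i)%N.
  by rewrite lt0n; apply: contraTneq uZ => ui; rewrite (bigD1 i) //= ui mul0n.
have -> : log_sum R u = ln (\prod_i u i)%N%:R / L.
  rewrite /log_sum /log_size -mulr_suml; congr (_ / _).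
  have : forall s : seq 'I_6, \sum_(i <- s) ln (u i)%:R = ln (\prod_(i <- s) u i)%N%:R :> R.
    elim=> [|i s IH]; first by rewrite !big_nil ln1.
    rewrite !big_cons IH natrM lnM ?posrE ?ltr0n //.
    by elim/big_ind: _ => // a b; rewrite muln_gt0 => -> ->.
  exact.
rewrite ltr_pdivlMr // mul1r ltr_ln ?posrE ?ltr0n ?ltr_nat //; first exact: ltn_trans (Z_gt1 L_ge1).
by apply: leq_ltn_trans uZ.
Qed.

Lemma mass_le : mass R Z W <= t + C1.
Proof.
have := sum_cw_beta W_gt0 L_ge1 0 0 (x := 1); rewrite ler01 lexx => /(_ isT).
have E : \sum_(u < Z.+1 | log_size R Z u <= 1) cw R W u * (log_size R Z u ^+ 0 * (1 - log_size R Z u) ^+ 0) = mass R Z W.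
  rewrite /mass big_mkcond; apply: eq_bigr => u _; rewrite !expr0 !mulr1 ifT //.
  rewrite /log_size ler_pdivrMr // mul1r; case: (posnP u) => [->|ui].
    by rewrite ln0 // ltW.
  by rewrite ler_ln ?posrE ?ltr0n ?(ltnW (Z_gt1 L_ge1)) // ler_nat -ltnS.
rewrite E (_ : beta_coef R 0 0 = 1); last by rewrite ?beta_coefS !beta_coef0; field.
by rewrite expr1n expr0 !mulr1 mul1r ler_norml => /andP[_]; rewrite lerBlDl.
Qed.

Lemma square_sumE (A : {set 'I_6}) : \sum_(u : {ffun 'I_6 -> 'I_Z.+1}) twt R W A u * test_fun u ^+ 2 =
  simplex_sum W Z A 2 0 1 + 16 * simplex_sum W Z A 4 0 1 + simplex_sum W Z A 0 2 1
  + 8 * simplex_sum W Z A 3 0 1 + 2 * simplex_sum W Z A 1 1 1 + 8 * simplex_sum W Z A 2 1 1.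
Proof.
rewrite /simplex_sum !mulr_sumr -!big_split /= [RHS]big_mkcond; apply: eq_bigr => u _.
rewrite /test_fun; case: ifP => _; last by rewrite expr0n mulr0.
by ring.
Qed.

Definition fibre_poly (y q : R) : R := y ^+ 2 / 2 + 5 / 3 * y ^+ 3 + y * q.

Lemma fibre_sum_near (m : 'I_6) u : u m = inord 1 -> log_sum R u <= 1 ->
  t * fibre_poly (1 - log_sum R u) (log_sq_sum R u) - 20 * C1 <=
  fibre_sum W (@test_fun Z) m u.
Proof.
move=> um u1; set y := 1 - _; set q := log_sq_sum R u.
have p0 := log_sum_ge0 L_ge1 u.
have y01 : 0 <= y <= 1 by rewrite /y; lra.
have q0 : 0 <= q := log_sq_sum_ge0 u.
have q1 : q <= 1 := log_sq_sum_le u1.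
pose S i j := \sum_(v < Z.+1 | log_size R Z v <= y) cw R W v * (log_size R Z v ^+ i * (y - log_size R Z v) ^+ j).
have E : fibre_sum W (@test_fun Z) m u = S 0%N 1%N + 4 * S 0%N 2 + S 2 0%N + q * S 0%N 0%N.
  rewrite /S !mulr_sumr -!big_split /= [RHS]big_mkcond; apply: eq_bigr => v _.
  have a1 : log_sum R (set_coord m u v) = log_size R Z v + log_sum R u.
    exact: (@sum_set_coord R Z L_ge1 'I_6 (fun _ => log_size R Z) m u v um (log_size1 R Z)).
  have a2 : log_sq_sum R (set_coord m u v) = log_size R Z v ^+ 2 + q.
    apply: (@sum_set_coord R Z L_ge1 'I_6 (fun _ w => log_size R Z w ^+ 2) m u v um).
    by rewrite log_size1 expr0n.
  rewrite /test_fun a1 a2.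
  have -> : (log_size R Z v + log_sum R u <= 1) = (log_size R Z v <= y) by rewrite /y lerBrDr.
  by case: ifP => _; rewrite ?mulr0 // /y; ring.
have H i j := sum_cw_beta W_gt0 L_ge1 j i y01.
have h01 := H 0%N 1%N; have h02 := H 0%N 2%N; have h20 := H 2%N 0%N; have h00 := H 0%N 0%N.
move: h01 h02 h20 h00; rewrite -/(S _ _) -/(S _ _) -/(S _ _) -/(S _ _) E.
have -> : beta_coef R 0 1 = 1 / 2 by rewrite ?beta_coefS !beta_coef0; field.
have -> : beta_coef R 0 2 = 1 / 3 by rewrite ?beta_coefS !beta_coef0; field.
have -> : beta_coef R 2 0 = 1 / 3 by rewrite ?beta_coefS !beta_coef0; field.
have -> : beta_coef R 0 0 = 1 by rewrite ?beta_coefS !beta_coef0; field.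
rewrite !addn0 !add0n !ler_norml => /andP[h01 _] /andP[h02 _] /andP[h20 _] /andP[h00 _].
have C0 := cw_error_ge0 R W.
have h00' : q * (- (2 ^+ 0 * C1)) <= q * (S 0%N 0%N - t * (1 * y ^+ 1)) by rewrite ler_wpM2l.
have qC : q * C1 <= C1 by rewrite ler_piMl.
rewrite /fibre_poly; move: h01 h02 h20 h00'; rewrite expr0 !expr1 !mul1r mulrBr mulrN.
have -> : 2 ^+ 2 = 4 :> R by ring.
have e1 : t * (y ^+ 2 / 2 + 5 / 3 * y ^+ 3 + y * q) = t * (1 / 2 * y ^+ 2) + 4 * (t * (1 / 3 * y ^+ 3))
   + t * (1 / 3 * y ^+ 3) + q * (t * y) by field.
rewrite e1; lra.
Qed.

Lemma fibre_square_sum_ge (m : 'I_6) :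
  t ^+ 2 * (simplex_sum W Z (~: [set m])%SET 4 0 1 / 4 + 25 / 9 * simplex_sum W Z (~: [set m])%SET 6 0 1
    + simplex_sum W Z (~: [set m])%SET 2 2 1 + 5 / 3 * simplex_sum W Z (~: [set m])%SET 5 0 1
    + simplex_sum W Z (~: [set m])%SET 3 1 1 + 10 / 3 * simplex_sum W Z (~: [set m])%SET 4 1 1)
  - 160 * C1 * t * mass R Z W ^+ 5 <=
  \sum_(u : {ffun 'I_6 -> 'I_Z.+1}) twt R W (~: [set m])%SET u * fibre_sum W (@test_fun Z) m u ^+ 2.
Proof.
set A := (~: [set m])%SET.
have mA : m \notin A by rewrite !finset.inE eqxx.
have A5 : #|A| = 5%N by rewrite cardsC1 card_ord.
have C0 := cw_error_ge0 R W.
have t0 : 0 <= t by rewrite mulr_ge0 ?(ltW cop_density_gt0) ?(ltW L_gt0).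
have Z0 := ltnW (Z_gt1 L_ge1).
have -> : mass R Z W ^+ 5 = \sum_(u : {ffun 'I_6 -> 'I_Z.+1}) twt R W A u.
  by rewrite (sum_twt R W A Z0) A5.
rewrite [160 * C1 * t * _]mulr_sumr /simplex_sum !mulr_sumr !mulr_suml -!big_split /= mulr_sumr.
rewrite big_mkcond /= -sumrB; apply: ler_sum => u _.
have tw := twt_ge0 R W A u.
have f0 : 0 <= fibre_sum W (@test_fun Z) m u.
  by have /andP[] := fibre_sum_bound W (@test_fun_bound) m u.
have K0 : 0 <= 160 * C1 * t * twt R W A u := mulr_ge0 (mulr_ge0 (mulr_ge0 (ler0n R 160) C0) t0) tw.
case: ifPn => [u1|_]; last first.
  by rewrite sub0r; apply: (@le_trans _ _ 0); rewrite ?oppr_le0 // mulr_ge0 // sqr_ge0.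
have [um|um] := eqVneq (u m) (inord 1); last first.
  by rewrite (twt_coord_eq0 W L_ge1 mA um) !(mul0r, mulr0, addr0, subr0).
have := fibre_sum_near um u1; set y := 1 - _; set q := log_sq_sum R u.
set f := fibre_sum _ _ _ _ in f0 *; set G := fibre_poly y q => h.
have p0 := log_sum_ge0 L_ge1 u.
have y0 : 0 <= y by rewrite /y; lra.
have y1 : y <= 1 by rewrite /y; lra.
have q0 : 0 <= q := log_sq_sum_ge0 u.
have q1 : q <= 1 := log_sq_sum_le u1.
have G0 : 0 <= G by rewrite /G /fibre_poly !addr_ge0 ?mulr_ge0 ?exprn_ge0 ?divr_ge0.
have G4 : G <= 4.
  have y2 : y ^+ 2 <= 1 by rewrite exprn_ile1.
  have y3 : y ^+ 3 <= 1 by rewrite exprn_ile1.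
  have yq : y * q <= 1 by rewrite mulr_ile1.
  by rewrite /G /fibre_poly; lra.
(* [160 = 2 * 20 * 4], the cross term of the square with [G <= 4]. *)
have key : t ^+ 2 * G ^+ 2 - 160 * C1 * t <= f ^+ 2.
  have tG : 0 <= t * G by rewrite mulr_ge0.
  have Ct : 0 <= C1 * t by rewrite mulr_ge0.
  have CtG : C1 * t * G <= C1 * t * 4 by rewrite ler_wpM2l.
  have [neg|pos] := leP (t * G - 20 * C1) 0.
    have : (t * G) * (t * G) <= (t * G) * (20 * C1) by rewrite ler_wpM2l //; lra.
    have := sqr_ge0 f; rewrite !expr2; lra.
  have : (t * G - 20 * C1) ^+ 2 <= f ^+ 2 by rewrite ler_pXn2r ?nnegrE //; lra.
  have := sqr_ge0 (20 * C1); rewrite !expr2; lra.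
have := ler_wpM2l tw key; apply: le_trans; rewrite le_eqVlt; apply/orP; left; apply/eqP.
by rewrite /G /fibre_poly; field.
Qed.

End Level.

Lemma square_sum_limit (d : R) : 0 < d -> exists2 L0 : R, 1 <= L0 &
  forall Z, L0 <= ln (Z%:R : R) ->
  \sum_(u : {ffun 'I_6 -> 'I_Z.+1}) twt R W [set: 'I_6] u * test_fun u ^+ 2 <=
  tau Z ^+ 6 * (29 / (240 * 252) + d).
Proof.
move=> d0; have e0 : 0 < d / 36 by lra.
have [l1 k1 H1] := simplex_sum_near 6 2 0 e0.
have [l2 k2 H2] := simplex_sum_near 6 4 0 e0.
have [l3 k3 H3] := simplex_sum_near 6 0 2 e0.
have [l4 k4 H4] := simplex_sum_near 6 3 0 e0.
have [l5 k5 H5] := simplex_sum_near 6 1 1 e0.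
have [l6 k6 H6] := simplex_sum_near 6 2 1 e0.
exists (l1 + l2 + l3 + l4 + l5 + l6); first by lra.
move=> Z HL; have c6 : #|[set: 'I_6]%SET| = 6%N by rewrite cardsT card_ord.
have L1 : 1 <= ln (Z%:R : R) by lra.
rewrite square_sumE // -square_integral.
have M1 : l1 <= ln (Z%:R : R) by lra.
have := H1 Z 'I_6 [set: 'I_6]%SET M1 c6; rewrite ler_norml => /andP[_ h1].
have M2 : l2 <= ln (Z%:R : R) by lra.
have := H2 Z 'I_6 [set: 'I_6]%SET M2 c6; rewrite ler_norml => /andP[_ h2].
have M3 : l3 <= ln (Z%:R : R) by lra.
have := H3 Z 'I_6 [set: 'I_6]%SET M3 c6; rewrite ler_norml => /andP[_ h3].
have M4 : l4 <= ln (Z%:R : R) by lra.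
have := H4 Z 'I_6 [set: 'I_6]%SET M4 c6; rewrite ler_norml => /andP[_ h4].
have M5 : l5 <= ln (Z%:R : R) by lra.
have := H5 Z 'I_6 [set: 'I_6]%SET M5 c6; rewrite ler_norml => /andP[_ h5].
have M6 : l6 <= ln (Z%:R : R) by lra.
have := H6 Z 'I_6 [set: 'I_6]%SET M6 c6; rewrite ler_norml => /andP[_ h6].
exact: six_term_upper.
Qed.

Lemma fibre_square_sum_limit (d : R) : 0 < d -> exists2 L0 : R, 1 <= L0 &
  forall Z, L0 <= ln (Z%:R : R) -> mass R Z W <= 2 * tau Z /\ forall m : 'I_6,
  tau Z ^+ 7 * (1 / (60 * 99) - d) <=
  \sum_(u : {ffun 'I_6 -> 'I_Z.+1}) twt R W (~: [set m])%SET u * fibre_sum W (@test_fun Z) m u ^+ 2.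
Proof.
move=> d0; have e0 : 0 < d / 22 by lra.
have [l1 k1 H1] := simplex_sum_near 5 4 0 e0.
have [l2 k2 H2] := simplex_sum_near 5 6 0 e0.
have [l3 k3 H3] := simplex_sum_near 5 2 2 e0.
have [l4 k4 H4] := simplex_sum_near 5 5 0 e0.
have [l5 k5 H5] := simplex_sum_near 5 3 1 e0.
have [l6 k6 H6] := simplex_sum_near 5 4 1 e0.
have C0 := cw_error_ge0 R W; have r0 := cop_density_gt0.
have [D DE] : exists D, D = 160 * C1 by exists (160 * C1).
have D0 : 0 <= D by rewrite DE; exact: mulr_ge0 (ler0n R 160) C0.
have Dd : 0 <= 64 * D / d by rewrite divr_ge0 ?mulr_ge0 // ltW.
(* Above this level [mass <= 2 * tau], and the error [D * tau * (2 * tau) ^+ 5 = 32 * D * tau ^+ 6]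
   is at most [d / 2 * tau ^+ 7]. *)
have [l7 l7E] : exists l7, l7 = (C1 + 64 * D / d) / rho by eexists.
have l70 : 0 <= l7 by rewrite l7E divr_ge0 ?addr_ge0 // ltW.
exists (l1 + l2 + l3 + l4 + l5 + l6 + l7); first by lra.
move=> Z HL; have L1 : 1 <= ln (Z%:R : R) by lra.
have t1 : C1 + 64 * D / d <= tau Z.
  by rewrite [rho * _]mulrC -ler_pdivrMr // -l7E; lra.
have t0 : 0 <= tau Z by lra.
have m2 : mass R Z W <= 2 * tau Z by have := mass_le L1; lra.
split=> // m; apply: le_trans (fibre_square_sum_ge L1 m).
have c5 : #|(~: [set m])%SET| = 5%N by rewrite cardsC1 card_ord.
rewrite -fibre_integral.
have M1 : l1 <= ln (Z%:R : R) by lra.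
have := H1 Z 'I_6 (~: [set m])%SET M1 c5; rewrite ler_norml => /andP[h1 _].
have M2 : l2 <= ln (Z%:R : R) by lra.
have := H2 Z 'I_6 (~: [set m])%SET M2 c5; rewrite ler_norml => /andP[h2 _].
have M3 : l3 <= ln (Z%:R : R) by lra.
have := H3 Z 'I_6 (~: [set m])%SET M3 c5; rewrite ler_norml => /andP[h3 _].
have M4 : l4 <= ln (Z%:R : R) by lra.
have := H4 Z 'I_6 (~: [set m])%SET M4 c5; rewrite ler_norml => /andP[h4 _].
have M5 : l5 <= ln (Z%:R : R) by lra.
have := H5 Z 'I_6 (~: [set m])%SET M5 c5; rewrite ler_norml => /andP[h5 _].
have M6 : l6 <= ln (Z%:R : R) by lra.
have := H6 Z 'I_6 (~: [set m])%SET M6 c5; rewrite ler_norml => /andP[h6 _].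
have m5 : 160 * C1 * tau Z * mass R Z W ^+ 5 <= d / 2 * tau Z ^+ 7.
  rewrite -DE; have h : mass R Z W ^+ 5 <= (2 * tau Z) ^+ 5.
    by rewrite lerXn2r ?nnegrE ?mass_ge0 // mulr_ge0.
  apply: le_trans (ler_wpM2l (mulr_ge0 D0 t0) h) _.
  have h' : 64 * D <= tau Z * d by rewrite -ler_pdivrMr //; lra.
  have := ler_wpM2r (exprn_ge0 6 t0) h'.
  have -> : D * tau Z * (2 * tau Z) ^+ 5 = 64 * D * tau Z ^+ 6 / 2 by field.
  have -> : d / 2 * tau Z ^+ 7 = tau Z * d * tau Z ^+ 6 / 2 by field.
  by clear; move: (64 * D * _) (tau Z * d * _) => x y; lra.
have dT : 0 <= d * tau Z ^+ 5 := mulr_ge0 (ltW d0) (exprn_ge0 5 t0).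
have XJ := six_term_lower dT h1 h2 h3 h4 h5 h6.
have fin (x J X M : R) : x ^+ 2 * (x ^+ 5 * (J - d / 2)) <= x ^+ 2 * X -> M <= d / 2 * x ^+ 7 ->
    x ^+ 7 * (J - d) <= x ^+ 2 * X - M.
  have -> : x ^+ 7 * (J - d) = x ^+ 2 * (x ^+ 5 * (J - d / 2)) - d / 2 * x ^+ 7 by field.
  by move=> ? ?; apply: lerB.
exact: fin (ler_wpM2l (sqr_ge0 _) XJ) m5.
Qed.

End TestFunction.

(** * Sieved sums over integers *)

Section LambdaBound.
Variables (R : realFieldType) (Z W : nat) (T K : finType) (pi : T -> nat).
Hypotheses (prime_pi : forall p, prime (pi p)) (pi_inj : injective pi).
Hypothesis (pi_W : forall p, coprime (pi p) W).
Hypothesis (Z_gt0 : (0 < Z)%N).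
Local Notation V := 'I_Z.+1.
Local Notation colouring := {ffun T -> option K}.
Local Notation ip p := ((pi p)%:R^-1 : R).
Local Notation mass := (mass R Z W).
Local Notation nrm := (@colour_norm T K pi).
Variables (Y : {ffun K -> V} -> R) (B : R).
Hypothesis Y_bound : forall u, 0 <= Y u <= B.
Local Notation lam := (lambda pi (signed_value pi Y)).

Definition sub_colour (d r : colouring) : bool :=
  [forall p, if d p is Some _ then r p == d p else true].

Lemma psi_coef_bound p (r d : option K) : `|psi_coef R pi p r d| <=
  (if d is Some _ then (r == d)%:R else if r is Some _ then ip p else 1).
Proof.
have i0 : 0 <= ip p by rewrite invr_ge0 ler0n.
case: r d => [i|] [j|] //=; rewrite ?normr0 ?normrN ?normr1 ?ger0_norm ?ler0n //.
by rewrite (inj_eq Some_inj) eq_sym (inj_eq Some_inj).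
Qed.

Lemma colour_norm_mono (d r : colouring) : (forall p, d p != None -> r p != None) ->
  (nrm d <= nrm r)%N.
Proof.
move=> H; rewrite /colour_norm big_mkcond [leqRHS]big_mkcond /=.
apply: leq_prod => p _; have := H p; case: (d p) => [i|] /=.
  by move=> ->.
by move=> _; case: ifP => // _; rewrite prime_gt0.
Qed.

Lemma sum_inv_norm : \sum_(r : colouring | (nrm r <= Z)%N) (nrm r)%:R^-1 <= mass ^+ #|K|.
Proof.
have := @sum_colour_le R Z W T K pi prime_pi pi_inj pi_W [set: K]%SET
  (fun r => nrm r <= Z)%N (fun=> 1) (fun _ => ler01) (fun _ rZ => rZ)
  (fun _ _ i _ _ => finset.in_setT i).
rewrite (eq_bigr (fun r => (nrm r)%:R^-1)) => [|r _]; last by rewrite mulr1.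
move=> /le_trans; apply; rewrite (eq_bigr (twt R W [set: K]%SET)) => [|u _]; last by rewrite mulr1.
by rewrite sum_twt // cardsT.
Qed.

(** Only colourings [r] that agree with [d] on the support of [d] contribute, and each contributes
    the inverse of the product of its other primes. Hence a bound uniform in [d]. *)
Lemma lambda_bound d : `|lam d| <= if (nrm d <= Z)%N then B * mass ^+ #|K| else 0.
Proof.
have B0 : 0 <= B by have /andP[/le_trans] := Y_bound [ffun=> ord0]; apply.
pose c (r : colouring) := \prod_(p | (d p == None) && (r p != None)) ip p.
have c0 r : 0 <= c r by apply: prodr_ge0 => p _; rewrite invr_ge0 ler0n.
have step : `|lam d| <= \sum_(r : colouring | sub_colour d r && (nrm r <= Z)%N) B * c r.
  apply: le_trans (ler_norm_sum _ _ _) _; rewrite [leRHS]big_mkcond; apply: ler_sum => r _.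
  rewrite normrM normr_prod.
  have y1 : `|signed_value pi Y r| <= if (nrm r <= Z)%N then B else 0.
    rewrite /signed_value normrM /colour_value.
    have -> : `|colour_sign R r| = 1.
      apply/eqP; rewrite -(@eqrXn2 _ 2) // expr1n -normrX colour_sign_sqr normr1 //.
    rewrite mul1r; case: ifP => _; last by rewrite normr0.
    by have /andP[h1 h2] := Y_bound (colour_tuple Z pi r); rewrite ger0_norm.
  have p1 : \prod_p `|psi_coef R pi p (r p) (d p)| <= if sub_colour d r then c r else 0.
    apply: (@le_trans _ _ (\prod_p (if d p is Some _ then (r p == d p)%:R else if r p is Some _ then ip p else 1))).
      by apply: ler_prod => p _; rewrite normr_ge0 psi_coef_bound.
    case: ifPn => [/forallP H|].
      rewrite /c [leRHS]big_mkcond le_eqVlt; apply/orP; left; apply/eqP; apply: eq_bigr => p _.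
      have := H p; case: (d p) => [i|] /=; first by move=> ->.
      by case: (r p).
    rewrite negb_forall => /existsP[p]; rewrite (bigD1 p) //=.
    by case: (d p) => // i /negbTE ->; rewrite mul0r.
  apply: le_trans (ler_pM (normr_ge0 _) _ y1 p1) _; first by apply: prodr_ge0.
  by case: sub_colour; case: (_ <= _)%N; rewrite ?mulr0 ?mul0r.
apply: le_trans step _; case: ifPn => [dZ|]; last first.
  rewrite -ltnNge => dZ; rewrite big1 // => r /andP[/forallP dr rZ].
  have : (nrm d <= nrm r)%N.
    by apply: colour_norm_mono => p; have := dr p; case: (d p) => // i /eqP ->.
  by move/(leq_trans dZ); rewrite ltnNge rZ.
rewrite -mulr_sumr ler_wpM2l //.
(* Removing [d] from [r] is injective on the colourings that contain [d], so the sum embeds into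
   that of [sum_inv_norm]. *)
pose h (r : colouring) : colouring := [ffun p => if d p is Some _ then None else r p].
pose G (r : colouring) := if (nrm r <= Z)%N then (nrm r)%:R^-1 else 0 : R.
have hr r : (nrm r <= Z)%N -> (nrm (h r) <= Z)%N.
  move=> rZ; apply: leq_trans rZ; apply: colour_norm_mono => p; rewrite ffunE.
  by case: (d p).
apply: (@le_trans _ _ (\sum_(r : colouring | sub_colour d r && (nrm r <= Z)%N) G (h r))).
  apply: ler_sum => r /andP[_ rZ]; rewrite /G hr // /c /colour_norm natr_prod -prodfV.
  rewrite le_eqVlt; apply/orP; left; apply/eqP; apply: eq_bigl => p.
  by rewrite ffunE; case: (d p).
apply: le_trans sum_inv_norm; rewrite [X in _ <= X]big_mkcond /=.
apply: sum_inj_le.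
  move=> r r'; rewrite !unfold_in => /andP[/forallP dr _] /andP[/forallP dr' _] E.
  apply/ffunP => p; have := congr1 (fun g : colouring => g p) E; rewrite !ffunE.
  by have := dr p; have := dr' p; case: (d p) => // i /eqP -> /eqP ->.
by move=> r; rewrite /G; case: ifP => // _; rewrite invr_ge0 ler0n.
Qed.

(** Rankin's trick: [1 <= Z / nrm r] for every colouring counted. *)
Lemma card_colour_le : \sum_(r : colouring | (nrm r <= Z)%N) 1 <= Z%:R * mass ^+ #|K| :> R.
Proof.
apply: le_trans (ler_wpM2l (ler0n _ Z) sum_inv_norm).
rewrite mulr_sumr; apply: ler_sum => r rZ.
by rewrite ler_pdivlMr ?ltr0n ?colour_norm_gt0 // mul1r ler_nat.
Qed.

(** Both the arithmetic sum and the model are expanded in the divisor weights [lambda], so the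
    difference is controlled pair by pair. This is the only passage from integers to the local
    models; it serves the count of all integers and the sum over primes alike. *)
Lemma sieve_sum_error (N : nat) (g : nat -> R) (X : nat -> colouring) (w : T -> option K -> R)
  (M : R) (E : colouring -> colouring -> R) :
  (forall d e, (nrm d <= Z)%N -> (nrm e <= Z)%N ->
    `|\sum_(n < N) g n * (sub_ind R d (X n) * sub_ind R e (X n)) -
      M * \prod_p \sum_x w p x * ((incl (d p) x)%:R * (incl (e p) x)%:R)| <= E d e) ->
  `|\sum_(n < N) g n * sieve_weight pi (signed_value pi Y) (X n) ^+ 2 -
    M * \sum_(x : colouring) (\prod_p w p (x p)) * sieve_weight pi (signed_value pi Y) x ^+ 2|
  <= (B * mass ^+ #|K|) ^+ 2 *
     \sum_(d : colouring | (nrm d <= Z)%N) \sum_(e : colouring | (nrm e <= Z)%N) E d e.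
Proof.
move=> HE; rewrite model_expand.
have -> : \sum_(n < N) g n * sieve_weight pi (signed_value pi Y) (X n) ^+ 2 =
  \sum_d \sum_e lam d * lam e * \sum_(n < N) g n * (sub_ind R d (X n) * sub_ind R e (X n)).
  under eq_bigr => n _ do rewrite sieve_weightE expr2 big_distrlr /= mulr_sumr.
  rewrite exchange_big /=; apply: eq_bigr => d _.
  under eq_bigr => n _ do rewrite mulr_sumr.
  rewrite exchange_big /=; apply: eq_bigr => e _; rewrite mulr_sumr.
  by apply: eq_bigr => n _; ring.
rewrite mulr_sumr -sumrB; apply: le_trans (ler_norm_sum _ _ _) _.
rewrite mulr_sumr [leRHS]big_mkcond; apply: ler_sum => d _.
rewrite mulr_sumr -sumrB; apply: le_trans (ler_norm_sum _ _ _) _.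
have ld := lambda_bound d.
case: ifPn ld => [dZ ld|_ ld]; last first.
  rewrite big1 // => e _; have /eqP -> : lam d == 0 by rewrite -normr_le0.
  by rewrite !mul0r mulr0 subrr normr0.
rewrite mulr_sumr [leRHS]big_mkcond; apply: ler_sum => e _.
have le := lambda_bound e.
case: ifPn le => [eZ le|_ le]; last first.
  have /eqP -> : lam e == 0 by rewrite -normr_le0.
  by rewrite !mulr0 !mul0r mulr0 subrr normr0.
rewrite mulrCA -mulrBr normrM; apply: ler_pM => //; last exact: HE.
by rewrite normrM expr2; apply: ler_pM.
Qed.

End LambdaBound.

(** * Counting in residue classes *)

Section Counting.
Variable R : realFieldType.

Lemma count_residue_period (m a c : nat) : (0 < m)%N ->
  (\sum_(n < m) nat_of_bool (a + n == c %[mod m]) = 1)%N.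
Proof.
move=> m0; elim: a => [|a IH].
  rewrite (bigD1 (Ordinal (ltn_pmod c m0))) //= add0n modn_mod eqxx big1 // => i /eqP ic.
  rewrite add0n; case: eqP => // E; case: ic; apply: val_inj => /=.
  by rewrite -E modn_small.
case: m m0 IH => // m _ <-; rewrite big_ord_recr [in RHS]big_ord_recl /= addn0 addnC.
congr (_ + _)%N; last by apply: eq_bigr => i _; rewrite addSnnS.
by rewrite addSnnS modnDr.
Qed.

Lemma count_residue (m a c l : nat) : (0 < m)%N ->
  `|\sum_(n < l) (a + n == c %[mod m])%N%:R - l%:R / m%:R| <= 1 :> R.
Proof.
move=> m0; have m0R : 0 < m%:R :> R by rewrite ltr0n.
elim/ltn_ind: l a => l IH a; have [lm|ml] := ltnP l m.
  have c1 : (\sum_(n < l) nat_of_bool (a + n == c %[mod m]) <= 1)%N.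
    rewrite -(count_residue_period a c m0) -!(big_mkord xpredT (fun n => nat_of_bool (a + n == c %[mod m])%N)).
    by rewrite [leqRHS](@big_cat_nat _ _ _ l) //= ?(ltnW lm) // leq_addr.
  rewrite -natr_sum ler_norml; have h1 : 0 <= l%:R / m%:R :> R by rewrite divr_ge0 ?ler0n.
  have h2 : l%:R / m%:R <= 1 :> R by rewrite ler_pdivrMr // mul1r ler_nat ltnW.
  move: c1; case: (\sum_(n < l) _)%N => [|[|//]] _; apply/andP; split; lra.
rewrite -(subnKC ml) big_split_ord /=.
rewrite -natr_sum count_residue_period //.
have := IH (l - m)%N _ (a + m)%N; rewrite ltn_subrL m0 (leq_trans m0 ml) => /(_ isT).
rewrite natrD mulrDl divff ?gt_eqF // opprD addrACA subrr add0r.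
by under [in X in X -> _]eq_bigr => i _ do rewrite -addnA.
Qed.

Lemma crt_two (m1 m2 a b : nat) : coprime m1 m2 ->
  exists c, forall n, (n == c %[mod m1 * m2])%N = (n == a %[mod m1])%N && (n == b %[mod m2])%N.
Proof.
move=> co; exists (chinese m1 m2 a b) => n.
by rewrite chinese_remainder // chinese_modl // chinese_modr.
Qed.

Lemma crt_primes (T : finType) (pi : T -> nat) (P : pred T) (a : T -> nat) :
  (forall p, prime (pi p)) -> injective pi ->
  exists c, forall n, (n == c %[mod \prod_(p | P p) pi p])%N =
    [forall (p | P p), n == a p %[mod pi p]]%N.
Proof.
move=> prime_pi pi_inj.
suff [c Hc] : exists c, forall n, (n == c %[mod \prod_(p <- enum P) pi p])%N =
    all (fun p => n == a p %[mod pi p])%N (enum P).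
  exists c => n; rewrite -big_enum /= Hc.
  apply/allP/forallP => H p; first by apply/implyP => Pp; apply: H; rewrite mem_enum.
  by rewrite mem_enum => Pp; have /implyP := H p; apply.
elim: (enum P) (enum_uniq P) => [_|p s IH /= /andP[ps us]].
  by exists 0%N => n; rewrite big_nil !modn1.
have [c Hc] := IH us.
have co : coprime (pi p) (\prod_(q <- s) pi q).
  rewrite prime_coprime //; rewrite Euclid_dvd_prod // big_has; apply/negP.
  move=> /hasP[q qs]; rewrite dvdn_prime2 // => /eqP /pi_inj E.
  by rewrite E qs in ps.
have [c' Hc'] := crt_two (a p) c co.
by exists c' => n; rewrite big_cons Hc' Hc.
Qed.

End Counting.

(** * Divisibility patterns of shifted integers *)

Section SievedSums.
Variables (R : realType) (Z : nat) (T K : finType) (pi : T -> nat).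
Hypotheses (prime_pi : forall p, prime (pi p)) (pi_inj : injective pi).
Local Notation colouring := {ffun T -> option K}.
Local Notation ip p := ((pi p)%:R^-1 : R).
Local Notation iq p := (((pi p)%:R - 1)^-1 : R).
Local Notation nrm := (@colour_norm T K pi).
Variables (h : K -> nat) (H : nat).
Hypotheses (h_inj : injective h) (h_lt : forall i, (h i < H)%N) (H_le : forall p, (H <= pi p)%N).

Lemma dvd_shift_inj p i j n : (pi p %| n + h i)%N -> (pi p %| n + h j)%N -> i = j.
Proof.
wlog hij : i j / (h i <= h j)%N.
  by move=> W; case/orP: (leq_total (h i) (h j)) => [/W//|/W hw a b]; rewrite (hw b a).
move=> di dj; apply: h_inj; apply/eqP; rewrite eqn_leq hij /= leqNgt; apply/negP => lt.
have : (pi p %| h j - h i)%N by rewrite -(subnDl n) dvdn_sub.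
by move/dvdn_leq; rewrite subn_gt0 lt => /(_ isT); have := H_le p; have := h_lt j; lia.
Qed.

(** No information is lost by [pick]: a prime at least [H] divides at most one of the [n + h i]. *)
Definition shift_colouring (n : nat) : colouring :=
  [ffun p => [pick i | (pi p %| n + h i)%N]].

Lemma shift_colouringE n p i : (shift_colouring n p == Some i) = (pi p %| n + h i)%N.
Proof.
rewrite ffunE; case: pickP => [j pj|Hn]; last by rewrite Hn.
by apply/eqP/idP => [[<-] //|pi']; rewrite (dvd_shift_inj pj pi').
Qed.

Definition compatible (d e : colouring) : bool :=
  [forall p, [|| d p == None, e p == None | d p == e p]].
Definition join_colour (d e : colouring) : colouring :=
  [ffun p => if d p is Some i then Some i else e p].

Lemma sub_ind_mul (d e X : colouring) : sub_ind R d X * sub_ind R e X =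
  if compatible d e then sub_ind R (join_colour d e) X else 0.
Proof.
rewrite /sub_ind -big_split /=; case: ifPn => [/forallP C|].
  apply: eq_bigr => p _; have := C p; rewrite ffunE /incl.
  case: (d p) (e p) (X p) => [i|] [j|] x //= ; rewrite ?mulr1 ?mul1r //.
  by move=> /eqP [->]; rewrite -natrM mulnb andbb.
rewrite negb_forall => /existsP[p]; rewrite (bigD1 p) //= /incl.
case: (d p) (e p) => [i|] [j|] //= nij.
case: eqP => [<-|_]; last by rewrite !mul0r.
by rewrite eq_sym (negbTE nij) mulr0 mul0r.
Qed.

Lemma local_density_mul (w : T -> option K -> R) (d e : colouring) :
  \prod_p \sum_x w p x * ((incl (d p) x)%:R * (incl (e p) x)%:R) =
  if compatible d e then \prod_p \sum_x w p x * (incl (join_colour d e p) x)%:R else 0.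
Proof.
case: ifPn => [/forallP C|].
  apply: eq_bigr => p _; apply: eq_bigr => x _; have := C p; rewrite ffunE /incl.
  case: (d p) (e p) => [i|] [j|] //= ; rewrite ?mulr1 ?mul1r //.
  by move=> /eqP [->]; rewrite -natrM mulnb andbb.
rewrite negb_forall => /existsP[p]; rewrite (bigD1 p) //= /incl.
case: (d p) (e p) => [i|] [j|] //= nij.
rewrite big1 ?mul0r // => x _; case: eqP => [<-|_]; last by rewrite !(mul0r, mulr0).
by rewrite eq_sym (negbTE nij) !mulr0.
Qed.

Lemma sum_incl_Some (w : option K -> R) i : \sum_x w x * (incl (Some i) x)%:R = w (Some i).
Proof.
rewrite (bigD1 (Some i)) //= /incl eqxx mulr1 big1 ?addr0 // => x /negbTE xi.
by rewrite /= [Some i == x]eq_sym xi mulr0.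
Qed.

Lemma sum_incl_None (w : option K -> R) : \sum_x w x * (incl None x)%:R = \sum_x w x.
Proof. by apply: eq_bigr => x _; rewrite mulr1. Qed.

Lemma sub_indE (f X : colouring) :
  sub_ind R f X = [forall p, if f p is Some i then X p == Some i else true]%:R.
Proof.
rewrite /sub_ind /incl; case: (boolP [forall p, _]) => [/forallP F|].
  rewrite big1 // => p _; have := F p; case: (f p) => // i /eqP ->; by rewrite eqxx.
rewrite negb_forall => /existsP[p]; rewrite (bigD1 p) //=.
by case: (f p) => // i; rewrite eq_sym => /negbTE -> /=; rewrite mul0r.
Qed.

(** [h i * (pi p).-1] represents [- h i] modulo [pi p] without subtraction. *)
Lemma dvd_shiftE p i n : (pi p %| n + h i)%N = (n == h i * (pi p).-1 %[mod pi p])%N.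
Proof.
rewrite -(eqn_modDr (h i)) -[X in _ == X %[mod _]]/(_ * _ + _)%N -mulnSr prednK ?prime_gt0 //.
by rewrite modnMl.
Qed.

Lemma sub_ind_shift_crt (f : colouring) : exists c, forall n,
  sub_ind R f (shift_colouring n) = (n == c %[mod nrm f])%N%:R.
Proof.
pose a p := if f p is Some i then (h i * (pi p).-1)%N else 0%N.
have [c Hc] := crt_primes (fun p => f p != None) a prime_pi pi_inj.
exists c => n; rewrite sub_indE Hc; congr (nat_of_bool _)%:R; apply: eq_forallb => p.
by rewrite /a; case: (f p) => // i; rewrite shift_colouringE dvd_shiftE.
Qed.

Hypothesis pi_gt : forall p, (#|K| < pi p)%N.

Lemma density1_sum p : \sum_(x : option K) density1 R pi p x = 1 :> R.
Proof. by rewrite sum_option /= sumr_const -[_ *+ #|_|]mulr_natl; ring. Qed.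

Lemma density1_join (f : colouring) :
  \prod_p \sum_x density1 R pi p x * (incl (f p) x)%:R = (nrm f)%:R^-1.
Proof.
rewrite -prod_ip; apply: eq_bigr => p _; case: (f p) => [i|].
  by rewrite sum_incl_Some.
by rewrite sum_incl_None density1_sum.
Qed.

Variable W : nat.
Hypotheses (W_gt0 : (0 < W)%N) (pi_W : forall p, coprime (pi p) W) (Z_gt0 : (0 < Z)%N).
Local Notation V := 'I_Z.+1.
Local Notation mass := (mass R Z W).
Variables (Y : {ffun K -> V} -> R) (B : R).
Hypothesis Y_bound : forall u, 0 <= Y u <= B.
Local Notation weight n := (sieve_weight pi (signed_value pi Y) (shift_colouring n)).

Lemma coprime_norm (f : colouring) : coprime (nrm f) W.
Proof. exact: coprime_prodpi. Qed.

(** A compatible pair [(d, e)] prescribes one class modulo [W] times the norm of the join, and a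
    class is counted with error at most 1; the last term is the bound for the [lambda] times the
    number of pairs. *)
Lemma sieved_count (N l v : nat) :
  \sum_(n < l) (N + n == v %[mod W])%N%:R * weight (N + n) ^+ 2 <=
  l%:R / W%:R * \sum_(u : {ffun K -> V}) twt R W [set: K]%SET u * Y u ^+ 2
  + (B * mass ^+ #|K|) ^+ 2 * (Z%:R * mass ^+ #|K|) ^+ 2.
Proof.
pose Q := \sum_(x : colouring) (\prod_p density1 R pi p (x p)) *
  sieve_weight pi (signed_value pi Y) x ^+ 2.
have QE : Q <= \sum_(u : {ffun K -> V}) twt R W [set: K]%SET u * Y u ^+ 2.
  exact: quadratic_form_upper.
pose D : R := \sum_(r : colouring | (nrm r <= Z)%N) 1.
have D1 : D <= Z%:R * mass ^+ #|K| by exact: card_colour_le.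
have D0 : 0 <= D by apply: sumr_ge0.
have EE : \sum_(d : colouring | (nrm d <= Z)%N) \sum_(e : colouring | (nrm e <= Z)%N) 1 <=
    (Z%:R * mass ^+ #|K|) ^+ 2.
  apply: (@le_trans _ _ (D ^+ 2)); last by rewrite lerXn2r ?nnegrE // (le_trans D0).
  rewrite expr2 big_distrlr /= le_eqVlt; apply/orP; left; apply/eqP.
  by apply: eq_bigr => d _; apply: eq_bigr => e _; rewrite mulr1.
have hyp (d e : colouring) : (nrm d <= Z)%N -> (nrm e <= Z)%N ->
  `|\sum_(n < l) (N + n == v %[mod W])%N%:R * (sub_ind R d (shift_colouring (N + n)) *
      sub_ind R e (shift_colouring (N + n))) -
    l%:R / W%:R * \prod_p \sum_x density1 R pi p x * ((incl (d p) x)%:R * (incl (e p) x)%:R)| <= 1.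
  move=> dZ eZ.
  rewrite local_density_mul; case: ifPn => [de|nde]; last first.
    rewrite mulr0 subr0 big1 ?normr0 // => n _.
    by rewrite sub_ind_mul (negbTE nde) mulr0.
  rewrite density1_join; set f := join_colour d e.
  have [c Hc] := sub_ind_shift_crt f.
  have [c' Hc'] : exists c', forall n, (n == c' %[mod W * nrm f])%N =
      (n == v %[mod W])%N && (n == c %[mod nrm f])%N.
    by apply: crt_two; rewrite coprime_sym coprime_norm.
  rewrite (eq_bigr (fun n : 'I_l => (N + n == c' %[mod W * nrm f])%N%:R)); last first.
    by move=> n _; rewrite sub_ind_mul de Hc Hc' -natrM mulnb.
  rewrite -mulrA -invfM -natrM; apply: count_residue.
  by rewrite muln_gt0 W_gt0 colour_norm_gt0.
have := @sieve_sum_error R Z W T K pi prime_pi pi_inj pi_W Z_gt0 Y B Y_bound l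
  (fun n => (N + n == v %[mod W])%N%:R) (fun n => shift_colouring (N + n))
  (density1 R pi) (l%:R / W%:R) (fun _ _ => 1) hyp.
rewrite -/Q ler_norml => /andP[_]; rewrite lerBlDl => /le_trans; apply; apply: lerD.
  by rewrite ler_wpM2l // divr_ge0 ?ler0n.
by rewrite ler_wpM2l ?sqr_ge0.
Qed.

End SievedSums.

(** * Sieved sums over primes *)

Section PrimeSums.
Variables (R : realType) (Z : nat) (T K : finType) (pi : T -> nat).
Hypotheses (prime_pi : forall p, prime (pi p)) (pi_inj : injective pi).
Local Notation colouring := {ffun T -> option K}.
Local Notation ip p := ((pi p)%:R^-1 : R).
Local Notation iq p := (((pi p)%:R - 1)^-1 : R).
Local Notation nrm := (@colour_norm T K pi).
Variables (h : K -> nat) (H : nat).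
Hypotheses (h_inj : injective h) (h_lt : forall i, (h i < H)%N) (H_le : forall p, (H <= pi p)%N).
Variable W : nat.
Hypotheses (pi_W : forall p, coprime (pi p) W) (Z_gt0 : (0 < Z)%N).
Hypothesis pi_le : forall p, (pi p <= Z)%N.
Local Notation V := 'I_Z.+1.
Local Notation mass := (mass R Z W).
Variables (Y : {ffun K -> V} -> R) (B : R).
Hypothesis Y_bound : forall u, 0 <= Y u <= B.
Variables (m : K) (a Wm b : nat).
Hypotheses (a_gt0 : (0 < a)%N) (a_pi : forall p, ~~ (pi p %| a)%N).
Hypotheses (Wm_gt0 : (0 < Wm)%N) (pi_Wm : forall p, coprime (pi p) Wm) (b_Wm : coprime b Wm).
Variable x : R.
Hypotheses (x_H : H%:R <= x) (x_Z : Z%:R <= x).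

(** Recovers [n] from the value [q] of the m-th linear form, [n + h m = a * q]; for the [q] that
    occur the truncated subtraction is exact. *)
Definition prime_shift (q : nat) : nat := (a * q - h m)%N.
Local Notation X q := (shift_colouring pi h (prime_shift q)).

Lemma totient_prodpi (P : pred T) :
  (totient (\prod_(p | P p) pi p))%:R = \prod_(p | P p) ((pi p)%:R - 1) :> R.
Proof.
move: (index_enum_uniq T); elim: (index_enum T) => [_|p s IH /= /andP[ps us]].
  by rewrite !big_nil.
have {}IH := IH us.
rewrite !big_cons; case: ifP => Pp; last exact: IH.
rewrite totient_coprime; last first.
  rewrite prime_coprime // Euclid_dvd_prod // big_has_cond; apply/negP.
  move=> /hasP[q qs] /andP[_]; rewrite dvdn_prime2 // => /eqP /pi_inj E.
  by rewrite E qs in ps.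
by rewrite natrM IH totient_prime // -subn1 natrB // prime_gt0.
Qed.

Lemma shift_residue p i : i != m -> exists2 c, coprime c (pi p) &
  forall q, (h m <= a * q)%N -> (pi p %| prime_shift q + h i)%N = (q == c %[mod pi p])%N.
Proof.
move=> im; have pp := prime_pi p; have p0 := prime_gt0 pp.
have cop : coprime a (pi p) by rewrite coprime_sym prime_coprime.
have [u Hu] : exists u, (a * u = 1 %[mod pi p])%N.
  have := chinese_modl cop 0 1; have := chinese_modr cop 0 1.
  set c := chinese _ _ _ _ => h1 h2; have /dvdnP[u cu] : (a %| c)%N by rewrite /dvdn h2 mod0n.
  by exists u; rewrite mulnC -cu.
pose w := (h m + h i * (pi p).-1)%N; pose c := (u * w)%N.
have ua z : (u * (a * z) = z %[mod pi p])%N.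
  by rewrite mulnA [(u * a)%N]mulnC -modnMml Hu modnMml mul1n.
have main q : (h m <= a * q)%N -> (pi p %| prime_shift q + h i)%N = (q == c %[mod pi p])%N.
  move=> hq; rewrite dvd_shiftE // -(eqn_modDr (h m)) /prime_shift subnK //.
  rewrite [(h i * _ + _)%N]addnC -/w; apply/eqP/eqP => E.
    by rewrite -[LHS]ua -modnMmr E modnMmr.
  by rewrite -modnMmr E modnMmr /c mulnA -modnMml Hu modnMml mul1n.
(* Were [c] divisible by [p], then [q = p * h m] would lie in the class, and [p] would divide both
   [n + h i] and [n + h m], forcing [i = m]. *)
exists c => //; rewrite coprime_sym prime_coprime //; apply/negP => pc.
have hq : (h m <= a * (pi p * h m))%N by rewrite mulnA leq_pmull // muln_gt0 a_gt0.
have := main _ hq; rewrite modnMr (eqP (pc : c %% pi p == 0)%N) eqxx => di.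
have dm : (pi p %| prime_shift (pi p * h m) + h m)%N.
  by rewrite /prime_shift subnK // mulnCA dvdn_mulr.
by move: im; rewrite (dvd_shift_inj h_inj h_lt H_le di dm) eqxx.
Qed.

Lemma Eq_ge0 y q : 0 <= Eq y q :> R.
Proof. by apply: bigmax_ge_id. Qed.

Lemma Eqa_le_Eq y q c : (0 < q)%N -> coprime c q -> `|Eqa y q c| <= Eq y q :> R.
Proof.
move=> q0 cq; have cq' : coprime (c %% q) q by rewrite coprime_modl.
have -> : Eqa y q c = Eqa y q (c %% q) :> R.
  by rewrite /Eqa /sum_ap; congr (_ - _); apply: eq_bigl => n; rewrite modn_mod.
by rewrite /Eq (bigmaxD1 (Ordinal (ltn_pmod c q0))) //= le_max lexx.
Qed.

Lemma density2_sum p : \sum_(y : option K) density2 R pi m p y = 1.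
Proof. by rewrite sum_option /= -mulr_suml sum_u; ring. Qed.

(** If the join [f] of [d] and [e] does not use colour [m], the conditions on [q] amount to one
    invertible class modulo [Wm * nrm f], of density [1 / phi], and the error is a value of
    [Eqa]. *)
Lemma sieved_primes :
  x / (totient Wm)%:R * (\sum_(y : colouring) (\prod_p density2 R pi m p (y p)) *
     sieve_weight pi (signed_value pi Y) y ^+ 2)
  - (B * mass ^+ #|K|) ^+ 2 * (\sum_(d : colouring | (nrm d <= Z)%N)
      \sum_(e : colouring | (nrm e <= Z)%N) Eq x (Wm * nrm (join_colour d e))) <=
  \sum_(q < (Num.truncn (2 * x)).+1 | (x < q%:R) && (q%:R <= 2 * x) && (q == b %[mod Wm])%N)
    varpi R q * sieve_weight pi (signed_value pi Y) (X q) ^+ 2.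
Proof.
set N := (Num.truncn (2 * x)).+1.
pose g (q : nat) : R := if (x < q%:R) && (q%:R <= 2 * x) && (q == b %[mod Wm])%N
  then varpi R q else 0.
rewrite [leRHS]big_mkcond [leRHS](eq_bigr (fun q : 'I_N => g q *
    sieve_weight pi (signed_value pi Y) (X q) ^+ 2)); last first.
  by move=> q _; rewrite /g; case: ifP => _; rewrite ?mul0r.
have g_prime q : g q != 0 -> [/\ prime q, (Z < q)%N & (h m <= a * q)%N].
  rewrite /g /varpi; case: ifP => [/andP[/andP[xq _] _]|_]; last by rewrite eqxx.
  case: ifP => pq; last by rewrite eqxx.
  move=> _; split=> //; first by rewrite -(ltr_nat R) (le_lt_trans x_Z).
  have Hq : (H < q)%N by rewrite -(ltr_nat R) (le_lt_trans x_H).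
  by rewrite (leq_trans (ltnW (h_lt m))) // (leq_trans (ltnW Hq)) // leq_pmull.
have hyp (d e : colouring) : (nrm d <= Z)%N -> (nrm e <= Z)%N ->
  `|\sum_(q < N) g q * (sub_ind R d (X q) * sub_ind R e (X q)) -
    x / (totient Wm)%:R * \prod_p \sum_y density2 R pi m p y * ((incl (d p) y)%:R * (incl (e p) y)%:R)|
  <= Eq x (Wm * nrm (join_colour d e)).
  move=> dZ eZ; rewrite local_density_mul; case: ifPn => [de|nde]; last first.
    rewrite mulr0 subr0 big1 ?normr0 ?Eq_ge0 // => n _.
    by rewrite sub_ind_mul (negbTE nde) mulr0.
  rewrite (eq_bigr (fun q : 'I_N => g q * sub_ind R (join_colour d e) (X q))); last first.
    by move=> q _; rewrite sub_ind_mul de.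
  set f := join_colour d e.
  (* A prime of colour [m] in the join would divide [a * q]; this is impossible since [q] is a prime
     above [Z], and [density2] is 0 there, so both sides vanish. *)
  have [/existsP[p /eqP fp]|] := boolP [exists p, f p == Some m].
    rewrite (bigD1 p) //= fp sum_incl_Some /= eqxx !mul0r mulr0 subr0.
    rewrite big1 ?normr0 ?Eq_ge0 // => q _.
    have [->|gq] := eqVneq (g q) 0; first by rewrite mul0r.
    have [pq Zq hq] := g_prime q gq.
    rewrite sub_indE (_ : [forall p, _] = false) ?mulr0 //; apply/negbTE.
    rewrite negb_forall; apply/existsP; exists p; rewrite fp (shift_colouringE h_inj h_lt H_le) //.
    rewrite /prime_shift subnK // Euclid_dvdM // negb_or a_pi /=.
    rewrite dvdn_prime2 //; apply/eqP => pq'; by have := pi_le p; rewrite pq' leqNgt Zq.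
  rewrite negb_exists => /forallP fm.
  have /fin_all_exists [c Hc] : forall p, exists c, forall i, f p = Some i ->
      coprime c (pi p) /\ forall q, (h m <= a * q)%N ->
        (pi p %| prime_shift q + h i)%N = (q == c %[mod pi p])%N.
    move=> p; case fp : (f p) => [i|]; last by exists 0%N.
    have im : i != m by have := fm p; rewrite fp.
    have [c c1 c2] := shift_residue p im; exists c => j [<-]; by split.
  have [c1 Hc1] := crt_primes (fun p => f p != None) c prime_pi pi_inj.
  have cW : coprime Wm (nrm f) by rewrite coprime_sym coprime_prodpi.
  have [c2 Hc2] := crt_two b c1 cW.
  set Q := (Wm * nrm f)%N.
  have Q0 : (0 < Q)%N by rewrite muln_gt0 Wm_gt0 colour_norm_gt0.
  have c2Q : coprime c2 Q.
    have := Hc2 c2; rewrite eqxx => /esym/andP[/eqP e1 /eqP e2].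
    rewrite /Q coprimeMr -coprime_modl e1 coprime_modl b_Wm /=.
    have := Hc1 c2; rewrite -e2 eqxx => /esym/forallP Hp.
    rewrite coprime_sym /colour_norm; elim/big_ind: _ => [|u v cu cv|p fp].
    - by rewrite coprime1n.
    - by rewrite coprimeMl cu cv.
    have := Hp p; rewrite fp /= => /eqP ep.
    case fpE : (f p) fp => [i|] // _; have [cp _] := Hc p i fpE.
    by rewrite coprime_sym -coprime_modl ep coprime_modl.
  have -> : \sum_(q < N) g q * sub_ind R f (X q) = sum_ap (varpi R) x Q c2.
    rewrite /sum_ap -/N [RHS]big_mkcond; apply: eq_bigr => q _.
    have [gq|gq] := eqVneq (g q) 0.
      rewrite gq mul0r; case: ifP => // /andP[xq]; rewrite Hc2 => /andP[qb _].
      by move: gq; rewrite /g xq qb.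
    have [pq Zq hq] := g_prime q gq.
    have -> : sub_ind R f (X q) = (q == c1 %[mod nrm f])%N%:R.
      rewrite sub_indE Hc1; congr (nat_of_bool _)%:R; apply: eq_forallb => p.
      case fp : (f p) => [i|] //=; have [_ Hp] := Hc p i fp.
      by rewrite (shift_colouringE h_inj h_lt H_le) Hp.
    rewrite /g Hc2 andbA; case: ifP => //= _; rewrite ?mul0r //.
    by case: eqP => _; rewrite ?mulr1 ?mulr0.
  have -> : \prod_p \sum_y density2 R pi m p y * (incl (f p) y)%:R = (totient (nrm f))%:R^-1.
    rewrite /colour_norm totient_prodpi -prodfV [RHS]big_mkcond /=; apply: eq_bigr => p _.
    have := fm p; case: (f p) => [i|] im.
      by rewrite sum_incl_Some /= (inj_eq Some_inj) in im *; rewrite im mul1r.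
    by rewrite sum_incl_None density2_sum.
  rewrite -mulrA -invfM -natrM -totient_coprime // -/Q.
  exact: Eqa_le_Eq.
have := @sieve_sum_error R Z W T K pi prime_pi pi_inj pi_W Z_gt0 Y B Y_bound N g
  (fun q => X q) (density2 R pi m) (x / (totient Wm)%:R)
  (fun d e => Eq x (Wm * nrm (join_colour d e))) hyp.
by rewrite ler_norml => /andP[+ _]; rewrite lerBrDl addrC.
Qed.

End PrimeSums.

(** * The error term *)

Section ErrorSum.
Variables (R : realType) (T : finType) (pi : T -> nat).
Hypotheses (prime_pi : forall p, prime (pi p)) (pi_inj : injective pi).

Definition support (K : finType) (f : {ffun T -> option K}) : {set T} :=
  finset (fun p => f p != None).

Lemma sum_family_one (J : finType) (Q : T -> pred J) :
  \sum_(f : {ffun T -> J} | [forall p, Q p (f p)]) 1 = \prod_p (#|Q p|)%:R :> R.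
Proof.
rewrite (eq_bigr (fun p => \sum_(j | Q p j) (1 : R))); last by move=> p _; rewrite sumr_const.
rewrite bigA_distr_big_dep; apply: eq_big => [f|f _]; last by rewrite big1.
by apply/forallP/familyP.
Qed.

Lemma card_support_eq (J : finType) (S : {set T}) :
  \sum_(r : {ffun T -> option J} | support r == S) 1 = #|J|%:R ^+ #|S| :> R.
Proof.
rewrite -prodr_const big_mkcond [RHS]big_mkcond /=.
have := sum_family_one (fun p => [pred j : option J | (j != None) == (p \in S)]).
rewrite big_mkcond /= => H; transitivity (\prod_p
   (#|[pred j : option J | (j != None) == (p \in S)]|)%:R : R).
  rewrite -H; apply: eq_bigr => r _; congr (if _ then _ else _).
  apply/eqP/forallP => [<- p|Hr]; first by rewrite finset.inE.
  by apply/setP => p; have /eqP <- := Hr p; rewrite finset.inE.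
apply: eq_bigr => p _; case: (p \in S); last first.
  rewrite (_ : #|_| = 1%N) // -(card1 (None : option J)); apply: eq_card => j.
  by rewrite !inE; case: j.
rewrite (@eq_card _ _ (predC1 (None : option J))) ?cardC1 ?card_option // => j.
by rewrite !inE eqb_id.
Qed.

Lemma card_support_sub (J : finType) (S : {set T}) :
  \sum_(r : {ffun T -> option J} | support r \subset S) 1 = #|J|.+1%:R ^+ #|S| :> R.
Proof.
rewrite -prodr_const big_mkcond [RHS]big_mkcond /=.
have := sum_family_one (fun p => [pred j : option J | (j != None) ==> (p \in S)]).
rewrite big_mkcond /= => H; transitivity (\prod_p
   (#|[pred j : option J | (j != None) ==> (p \in S)]|)%:R : R).
  rewrite -H; apply: eq_bigr => r _; congr (if _ then _ else _).
  apply/fintype.subsetP/forallP => [Hr p|Hr p]; first by apply/implyP => rp; apply: Hr; rewrite finset.inE.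
  by rewrite finset.inE => rp; have /implyP := Hr p; apply.
apply: eq_bigr => p _; case: (p \in S); last first.
  rewrite (_ : #|_| = 1%N) // -(card1 (None : option J)); apply: eq_card => j.
  by rewrite !inE; case: j.
by congr (_%:R); rewrite -card_option; apply: eq_card => j; rewrite !inE implybT.
Qed.

Lemma support_join (K : finType) (d e : {ffun T -> option K}) :
  support (join_colour d e) = (support d :|: support e)%SET.
Proof. by apply/setP => p; rewrite !finset.inE ffunE; case: (d p). Qed.

Lemma colour_norm_support (K : finType) (f : {ffun T -> option K}) :
  colour_norm pi f = (\prod_(p in support f) pi p)%N.
Proof. by apply: eq_bigl => p; rewrite finset.inE. Qed.

(** The modulus depends only on the support [S] of the join, and at most [(k + 1) ^ #|S|] choices of
    [d], and as many of [e], have support inside [S]. *)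
Lemma sum_pairs_support (K : finType) (P : pred {ffun T -> option K}) (Q : pred {set T})
  (F : {set T} -> R) : (forall S, 0 <= F S) ->
  (forall d e, P d -> P e -> Q (support (join_colour d e))) ->
  \sum_(d | P d) \sum_(e | P e) F (support (join_colour d e)) <=
  \sum_(S | Q S) (#|K|.+1 ^ 2)%N%:R ^+ #|S| * F S.
Proof.
move=> F0 PQ; rewrite pair_big /=.
rewrite (partition_big (fun de => support (join_colour de.1 de.2)) Q) /=; last first.
  by move=> [d e] /andP[]; exact: PQ.
apply: ler_sum => S _.
rewrite (eq_bigr (fun=> F S)); last by move=> de /andP[_ /eqP ->].
rewrite -[X in \sum_(_ | _) X]mul1r -mulr_suml ler_wpM2r // natrX expr2 exprMn -!(card_support_sub K).
rewrite big_distrlr pair_big /=.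
rewrite big_mkcond [leRHS]big_mkcond; apply: ler_sum => -[d e] _ /=.
case: ifP => [/andP[_ /eqP <-]|_]; last by case: ifP; rewrite ?mulr1.
rewrite mulr1; by rewrite support_join finset.subsetUl finset.subsetUr.
Qed.

(** [J ^+ #|S|] counts the colourings with [J] colours and support [S], so the divisor-type sum is
    the sum of inverse norms, bounded by the [J]-th power of a harmonic sum. *)
Lemma sum_support_weights (J Z : nat) : (0 < Z)%N ->
  \sum_(S : {set T} | (\prod_(p in S) pi p <= Z)%N) J%:R ^+ #|S| / (\prod_(p in S) pi p)%:R
  <= (1 + ln (Z%:R : R)) ^+ J.
Proof.
move=> Z0; have := @sum_inv_norm R Z 1 T 'I_J pi prime_pi pi_inj (fun p => coprimen1 _) Z0.
rewrite card_ord => H.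
apply: (@le_trans _ _ (mass R Z 1 ^+ J)).
  apply: le_trans H; rewrite (partition_big (@support 'I_J)
     (fun S => \prod_(p in S) pi p <= Z)%N) /=; last by move=> r; rewrite colour_norm_support.
  apply: ler_sum => S SZ; rewrite (eq_bigr (fun=> (\prod_(p in S) pi p)%:R^-1)); last first.
    by move=> r /andP[_ /eqP <-]; rewrite colour_norm_support.
  rewrite -[X in \sum_(_ | _) X]mul1r -mulr_suml ler_wpM2r ?invr_ge0 ?ler0n //.
  rewrite -[J in J%:R]card_ord -card_support_eq le_eqVlt; apply/orP; left; apply/eqP.
  by apply: eq_bigl => r; rewrite andbC; case: eqP => //= E; rewrite colour_norm_support E SZ.
rewrite lerXn2r ?nnegrE ?mass_ge0 ?addr_ge0 ?ln_ge0 ?ler1n //.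
have /andP[_ Hh] := harmonic_bound R Z0; apply: le_trans Hh.
rewrite /mass -(big_mkord xpredT (fun u => cw R 1 u)) big_ltn // cw0 add0r.
by apply: ler_sum => u _; rewrite /cw coprimen1.
Qed.

End ErrorSum.

(** * Trivial bound for the discrepancy of primes *)

Section TrivialBound.
Variable R : realType.

Lemma Eqa_trivial (y x : R) (q c : nat) : 0 < y -> y <= x -> 1 <= x -> (0 < q)%N -> q%:R <= x ->
  `|Eqa y q c| <= 3 * x / q%:R * ln (2 * x) + x / (totient q)%:R.
Proof.
move=> y0 yx x1 q0 qx; have q0R : 0 < q%:R :> R by rewrite ltr0n.
have l0 : 0 <= ln (2 * x) by rewrite ln_ge0 //; lra.
apply: le_trans (ler_normB _ _) _; apply: lerD; last first.
  rewrite normrM normfV !ger0_norm ?ler0n ?(ltW y0) //.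
  by rewrite ler_wpM2r // invr_ge0 ler0n.
set N := Num.truncn (2 * y); set M := Num.truncn y.
have /andP[N1 N2] : N%:R <= 2 * y < N.+1%:R by apply: truncn_itv; lra.
have /andP[M1 M2] : M%:R <= y < M.+1%:R by apply: truncn_itv; lra.
have MN : (M <= N)%N by rewrite le_truncn //; lra.
have v0 n : 0 <= varpi R n.
  rewrite /varpi; case: ifP => // pn; by rewrite ln_ge0 // ler1n prime_gt0.
have S0 : 0 <= sum_ap (varpi R) y q c by apply: sumr_ge0.
rewrite ger0_norm //.
have S1 : sum_ap (varpi R) y q c <= \sum_(n < N - M) (M.+1 + n == c %[mod q])%N%:R * ln (2 * x).
  rewrite /sum_ap -/N -(big_mkord (fun n => (y < n%:R) && (n%:R <= 2 * y) && (n == c %[mod q])%N) (varpi R)) -(big_mkord xpredT (fun n => (M.+1 + n == c %[mod q])%N%:R * ln (2 * x))) /=.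
  have -> : \sum_(0 <= i < N.+1 | (y < i%:R) && (i%:R <= 2 * y) && (i == c %[mod q])%N) varpi R i =
     \sum_(M.+1 <= i < N.+1) (if (y < i%:R) && (i%:R <= 2 * y) && (i == c %[mod q])%N then varpi R i else 0).
    rewrite big_mkcond /= (@big_cat_nat _ _ _ M.+1) //= big_nat_cond big1 ?add0r // => i.
    move=> /andP[/andP[_ iM] _]; case: ifP => // /andP[/andP[yi _] _].
    by move: yi; rewrite ltNge (le_trans _ M1) // ler_nat -ltnS.
  rewrite -[X in \sum_(X <= _ < _) _ <= _]add0n big_addn subSS.
  apply: ler_sum => i _; rewrite addnC; case: ifP => [/andP[/andP[_ iN] ->]|_].
    rewrite mul1r /varpi; case: ifP => [pi|_] //.
    rewrite ler_ln ?posrE ?ltr0n ?prime_gt0 //; last by lra.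
    by apply: le_trans iN _; lra.
  by rewrite mulr_ge0.
apply: le_trans S1 _; rewrite -mulr_suml ler_wpM2r //.
(* The class contains at most [(y + 1) / q + 1] integers of the window, which is at most [3 x / q]
   since [q <= x] and [y <= x]. *)
have := @count_residue R q M.+1 c (N - M) q0; rewrite ler_norml => /andP[_ h].
have NM : (N - M)%:R <= y + 1 :> R.
  by rewrite natrB //; move: M2; rewrite -natr1; lra.
have h2 : (N - M)%:R / q%:R <= (y + 1) / q%:R by rewrite ler_wpM2r // invr_ge0 ler0n.
have h3 : 1 <= x / q%:R by rewrite ler_pdivlMr // mul1r.
have h4 : (y + 1) / q%:R <= 2 * x / q%:R by rewrite ler_wpM2r ?invr_ge0 ?ler0n //; lra.
have -> : 3 * x / q%:R = 2 * x / q%:R + x / q%:R by ring.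
by move: h; lra.
Qed.

Lemma Eq_trivial (y x : R) (q : nat) : 0 < y -> y <= x -> 1 <= x -> (0 < q)%N -> q%:R <= x ->
  Eq y q <= 3 * x / q%:R * ln (2 * x) + x / (totient q)%:R.
Proof.
move=> y0 yx x1 q0 qx; rewrite /Eq; apply/bigmax_leP; split=> [|i _]; last exact: Eqa_trivial.
rewrite addr_ge0 // ?divr_ge0 ?ler0n // ?mulr_ge0 ?invr_ge0 ?ler0n ?ln_ge0 //; lra.
Qed.

(** [sup] dominates its set only when the set is bounded above, and the trivial bound provides
    this. *)
Lemma Eq_le_Estar (x : R) (q : nat) : 1 <= x -> (0 < q)%N -> q%:R <= x -> Eq x q <= Estar x q.
Proof.
move=> x1 q0 qx; apply: ub_le_sup.
  exists (3 * x / q%:R * ln (2 * x) + x / (totient q)%:R) => _ [y /= /andP[y0 yx] <-].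
  exact: Eq_trivial.
by exists x => //=; rewrite lexx andbT; lra.
Qed.

Lemma Estar_ge0 (x : R) (q : nat) : 1 <= x -> (0 < q)%N -> q%:R <= x -> 0 <= Estar x q.
Proof. by move=> *; apply: le_trans (Eq_le_Estar _ _ _) => //; exact: Eq_ge0. Qed.

End TrivialBound.

(** * Averaging the discrepancy over pairs of colourings *)

Section BVError.
Variable R : realType.

Lemma colour_norm_join (T K : finType) (pi : T -> nat) (d e : {ffun T -> option K}) :
  (forall p, 0 < pi p)%N ->
  (colour_norm pi (join_colour d e) <= colour_norm pi d * colour_norm pi e)%N.
Proof.
move=> p0; rewrite /colour_norm big_mkcond [X in (X * _)%N]big_mkcond [X in (_ * X)%N]big_mkcond /=.
rewrite -big_split /=; apply: leq_prod => p _; rewrite ffunE.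
case: (d p) (e p) => [i|] [j|] //=; rewrite ?muln1 ?mul1n //.
by rewrite leq_pmulr.
Qed.

Lemma le_young (t b : R) : 0 <= t -> 0 < b -> t <= b + t ^+ 2 / b.
Proof.
move=> t0 b0; have [tb|bt] := leP t b.
  by rewrite ler_wpDr // divr_ge0 ?sqr_ge0 // ltW.
rewrite ler_wpDl ?(ltW b0) // ler_pdivlMr // expr2 ler_wpM2l //; exact: ltW.
Qed.

Lemma inv_totient_prodpi (T : finType) (pi : T -> nat) (S : {set T}) :
  (forall p, prime (pi p)) -> injective pi ->
  (totient (\prod_(p in S) pi p))%:R^-1 <= 2 ^+ #|S| / (\prod_(p in S) pi p)%:R :> R.
Proof.
move=> prime_pi pi_inj; rewrite totient_prodpi // natr_prod -prodr_const -!prodfV -big_split /=.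
apply: ler_prod => p _; have p2 : 2 <= (pi p)%:R :> R by rewrite ler_nat prime_gt1.
have p1 : 0 < (pi p)%:R - 1 :> R by lra.
rewrite invr_ge0 (ltW p1) /= -[X in X <= _]mul1r ler_pdivrMr // mulrAC ler_pdivlMr; last by lra.
lra.
Qed.

(* A modulus arises from at most [c ^ omega] pairs [(d, e)]. By Young's inequality
   [c^omega <= l^b + c^(2 omega) / l^b] with [l = ln x]: BV bounds the sum weighted by [l^b] and
   the trivial bound for [Eq] the sum weighted by [c^(2 omega)]. *)
Lemma bv_error (theta eps : R) (k M : nat) : theta <= 1 -> BV theta -> 0 < eps ->
  exists C x0 : R, forall (x : R) (T K : finType) (pi : T -> nat) (Wm Z : nat), x0 <= x ->
  (forall p, prime (pi p)) -> injective pi -> (forall p, coprime (pi p) Wm) ->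
  #|K| = k -> (0 < Wm)%N -> (0 < Z)%N -> Z%:R <= x ->
  (Wm * Z ^ 2)%N%:R <= x `^ (theta - eps) ->
  \sum_(d : {ffun T -> option K} | (colour_norm pi d <= Z)%N)
    \sum_(e : {ffun T -> option K} | (colour_norm pi e <= Z)%N)
      Eq x (Wm * colour_norm pi (join_colour d e)) <= C * (x / ln x ^+ M).
Proof.
(* [J ^ omega = 2 ^ omega * c ^ (2 omega)]: the factor [2 ^ omega] is lost in
   [1 / phi(u) <= 2 ^ omega / u]. The trivial bound then yields [ln x ^+ J.+1], and [b] exceeds this
   exponent by the saving [M]. *)
move=> th1 HBV eps0; pose c := (k.+1 ^ 2)%N; pose J := (2 * c ^ 2)%N; pose b := (J + 1 + M)%N.
have bM0 : 0 < (b + M)%:R :> R by rewrite ltr0n /b addn1 !addSn.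
have [C1 [N1 HN1]] := HBV _ _ bM0 eps0.
exists (C1 + 7 * 3 ^+ J), (`|N1| + expR 1 + 2).
move=> x T K pi Wm Z xx prime_pi pi_inj pi_W Kk Wm0 Z0 Zx WZ.
have e1 : 0 < expR 1 :> R by exact: expR_gt0.
have N1x : N1 <= x by have := ler_norm N1; have := normr_ge0 N1; lra.
have n1 := normr_ge0 N1.
have x2 : 2 <= x by lra.
have x1 : 1 <= x by lra.
have x0 : 0 < x by lra.
have ex : expR 1 <= x by lra.
set l := ln x; have l1 : 1 <= l by rewrite /l -[1]expRK ler_ln ?posrE.
have l0 : 0 < l by lra.
have l2 : ln (2 * x) <= 2 * l.
  rewrite lnM ?posrE //; have : ln 2 <= l by rewrite ler_ln ?posrE.
  by rewrite -/l; lra.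
have px : x `^ (theta - eps) <= x.
  by rewrite -[leRHS]powRr1 ?(ltW x0) // ler_powR //; lra.
have Wx : (Wm * Z ^ 2)%N%:R <= x by apply: le_trans px.
pose u (S : {set T}) := (\prod_(p in S) pi p)%N.
have u0 S : (0 < u S)%N by exact: prodpi_gt0.
pose Q (S : {set T}) := (u S <= Z ^ 2)%N.
pose F S := if Q S then Eq x (Wm * u S) else 0.
have q0 S : (0 < Wm * u S)%N by rewrite muln_gt0 Wm0 u0.
have qZ S : Q S -> (Wm * u S <= Wm * Z ^ 2)%N by move=> QS; rewrite leq_mul2l; apply/orP; right.
have qx S : Q S -> (Wm * u S)%N%:R <= x by move/qZ; rewrite -(ler_nat R) => /le_trans; apply.
have F0 S : 0 <= F S by rewrite /F; case: ifP => // _; exact: Eq_ge0.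
have PQ (d e : {ffun T -> option K}) : (colour_norm pi d <= Z)%N -> (colour_norm pi e <= Z)%N ->
    Q (support (join_colour d e)).
  move=> dZ eZ; rewrite /Q /u -colour_norm_support.
  apply: leq_trans (colour_norm_join _ _ (fun p => prime_gt0 (prime_pi p))) _.
  by rewrite -mulnn leq_mul.
have s1 : \sum_(d : {ffun T -> option K} | (colour_norm pi d <= Z)%N)
    \sum_(e : {ffun T -> option K} | (colour_norm pi e <= Z)%N)
      Eq x (Wm * colour_norm pi (join_colour d e)) <= \sum_(S | Q S) c%:R ^+ #|S| * F S.
  have := @sum_pairs_support R T K (fun d => colour_norm pi d <= Z)%N Q F F0 PQ.
  rewrite Kk -/c; apply: le_trans; rewrite le_eqVlt; apply/orP; left; apply/eqP.
  apply: eq_bigr => d dZ; apply: eq_bigr => e eZ.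
  by rewrite /F (PQ d e dZ eZ) /u -colour_norm_support.
have lb : 0 < l ^+ b by rewrite exprn_gt0.
have s2 : \sum_(S | Q S) c%:R ^+ #|S| * F S <= l ^+ b * \sum_(S | Q S) F S
   + (\sum_(S | Q S) (c%:R ^+ #|S|) ^+ 2 * F S) / l ^+ b.
  rewrite mulr_sumr mulr_suml -big_split /=; apply: ler_sum => S _.
  have := ler_wpM2r (F0 S) (le_young (exprn_ge0 #|S| (ler0n R c)) lb).
  by rewrite mulrDl [_ / _ * F S]mulrAC.
have s3 : \sum_(S | Q S) F S <= C1 * (x / l ^+ (b + M)).
  have := HN1 x N1x; rewrite powR_mulrn ?(ltW l0) //; apply: le_trans.
  rewrite /sum_moduli; set N := Num.truncn _.
  pose h (S : {set T}) : 'I_N.+1 := inord (Wm * u S).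
  pose G (q : 'I_N.+1) : R := if (0 < q)%N && (q%:R <= x `^ (theta - eps)) then Estar x q else 0.
  have qN S : Q S -> (Wm * u S <= N)%N.
    move/qZ => h'; apply: (leq_trans h'); rewrite /N truncn_ge_nat //.
    exact: powR_ge0.
  rewrite [leRHS]big_mkcond; apply: (@le_trans _ _ (\sum_(S | Q S) G (h S))).
    apply: ler_sum => S QS; rewrite /G /h inordK ?ltnS ?qN // q0 /=.
    have -> : (Wm * u S)%N%:R <= x `^ (theta - eps).
      by apply: le_trans WZ; rewrite ler_nat qZ.
    by rewrite /F QS; apply: Eq_le_Estar => //; exact: qx.
  apply: sum_inj_le.
    move=> S S'; rewrite !unfold_in => QS QS' /(congr1 val); rewrite /= !inordK ?ltnS ?qN //.
    move/eqP; rewrite eqn_pmul2l // => /eqP E; apply/setP => p.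
    by have := prodpi_inj prime_pi pi_inj E p.
  move=> q; rewrite /G; case: ifP => // /andP[q1 q2]; apply: Estar_ge0 => //.
  exact: le_trans px.
have s4 : \sum_(S | Q S) (c%:R ^+ #|S|) ^+ 2 * F S <= 7 * 3 ^+ J * x * l ^+ J.+1.
  have Z2 : (0 < Z ^ 2)%N by rewrite expn_gt0 Z0.
  have := sum_support_weights R prime_pi pi_inj J Z2 => H.
  have lZ : 1 + ln (Z ^ 2)%N%:R <= 3 * l.
    rewrite natrX lnXn ?ltr0n // -[_ *+ 2]mulr_natl.
    have : ln Z%:R <= l by rewrite ler_ln ?posrE ?ltr0n.
    lra.
  have lZ0 : 0 <= 1 + ln (Z ^ 2)%N%:R :> R by rewrite addr_ge0 // ln_ge0 // ler1n.
  have H2 : \sum_(S | Q S) J%:R ^+ #|S| / (u S)%:R <= (3 * l) ^+ J.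
    by apply: le_trans H _; rewrite lerXn2r ?nnegrE //; lra.
  have c7 : 0 <= 7 * l * x by rewrite !mulr_ge0 // ltW.
  have := ler_wpM2l c7 H2; rewrite exprMn.
  have -> : 7 * l * x * (3 ^+ J * l ^+ J) = 7 * 3 ^+ J * x * l ^+ J.+1 by rewrite exprS; ring.
  apply: le_trans; rewrite mulr_sumr; apply: ler_sum => S QS.
  have JE : J%:R ^+ #|S| = 2 ^+ #|S| * (c%:R ^+ #|S|) ^+ 2 :> R.
    by rewrite /J natrM exprMn natrX -!exprM mulnC.
  rewrite /F QS JE.
  have FS : Eq x (Wm * u S) <= 7 * l * x * (2 ^+ #|S| / (u S)%:R).
    apply: le_trans (Eq_trivial x0 (lexx x) x1 (q0 S) (qx S QS)) _.
    have uR : 0 < (u S)%:R :> R by rewrite ltr0n.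
    have i1 : (Wm * u S)%N%:R^-1 <= 2 ^+ #|S| / (u S)%:R :> R.
      rewrite natrM invfM; apply: ler_pM; rewrite ?invr_ge0 ?ler0n //.
      apply: (@le_trans _ _ 1); first by rewrite invf_le1 ?ltr0n // ler1n.
      by rewrite exprn_ege1 // ler1n.
    have i2 : (totient (Wm * u S))%:R^-1 <= 2 ^+ #|S| / (u S)%:R :> R.
      apply: le_trans (inv_totient_prodpi S prime_pi pi_inj).
      rewrite totient_coprime; last by rewrite coprime_sym coprime_prodpi.
      have t0 : 0 < (totient (u S))%:R :> R by rewrite ltr0n totient_gt0.
      rewrite lef_pV2 ?posrE // ?ltr0n ?muln_gt0 ?totient_gt0 ?Wm0 ?u0 // ler_nat.
      by rewrite leq_pmull // totient_gt0.
    set y := 2 ^+ #|S| / _ in i1 i2 *.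
    have y0 : 0 <= y by rewrite divr_ge0 ?exprn_ge0 ?ler0n.
    have l20 : 0 <= ln (2 * x) by rewrite ln_ge0 //; lra.
    have j1 : 3 * x / (Wm * u S)%N%:R * ln (2 * x) <= 3 * x * y * (2 * l).
      apply: ler_pM => //; first by rewrite divr_ge0 ?ler0n ?mulr_ge0 // ltW.
      by rewrite ler_wpM2l // mulr_ge0 // ltW.
    have j2 : x / (totient (Wm * u S))%:R <= x * y by rewrite ler_wpM2l // ltW.
    have j3 : x * y <= l * (x * y) by rewrite ler_peMl // mulr_ge0 // ltW.
    have -> : 7 * l * x * y = 3 * x * y * (2 * l) + l * (x * y) by ring.
    by apply: lerD j1 (le_trans j2 j3).
  have cc : 0 <= (c%:R ^+ #|S|) ^+ 2 :> R by exact: sqr_ge0.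
  apply: le_trans (ler_wpM2l cc FS) _; rewrite le_eqVlt; apply/orP; left; apply/eqP.
  by ring.
apply: le_trans s1 _; apply: le_trans s2 _.
have t1 : l ^+ b * \sum_(S | Q S) F S <= C1 * (x / l ^+ M).
  apply: le_trans (ler_wpM2l (ltW lb) s3) _; rewrite exprD invfM.
  have lb0 : l ^+ b != 0 by rewrite gt_eqF.
  have -> : l ^+ b * (C1 * (x * ((l ^+ b)^-1 * (l ^+ M)^-1))) =
     (l ^+ b / l ^+ b) * (C1 * (x * (l ^+ M)^-1)) by ring.
  by rewrite divff // mul1r.
have t2 : (\sum_(S | Q S) (c%:R ^+ #|S|) ^+ 2 * F S) / l ^+ b <= 7 * 3 ^+ J * (x / l ^+ M).
  have ib : 0 <= (l ^+ b)^-1 by rewrite invr_ge0 ltW.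
  apply: le_trans (ler_wpM2r ib s4) _; rewrite /b addn1 exprD invfM.
  have lb0 : l ^+ J.+1 != 0 by rewrite gt_eqF // exprn_gt0.
  have -> : 7 * 3 ^+ J * x * l ^+ J.+1 * ((l ^+ J.+1)^-1 * (l ^+ M)^-1) =
    (l ^+ J.+1 / l ^+ J.+1) * (7 * 3 ^+ J * (x * (l ^+ M)^-1)) by ring.
  by rewrite divff // mul1r.
by rewrite mulrDl; apply: lerD.
Qed.

End BVError.

(** * The linear forms and the parameters *)

(* [multiplier i] divides [n + shift i] for all [n] in the residue class of [residue_class]. *)
Definition shift (i : 'I_6) : nat := nth 0%N [:: 0; 1; 2; 4; 5; 6]%N i.
Definition multiplier (i : 'I_6) : nat := nth 0%N [:: 3; 2; 5; 7; 2; 3]%N i.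

Lemma ord6P (P : 'I_6 -> Prop) :
  P (inord 0) -> P (inord 1) -> P (inord 2) -> P (inord 3) -> P (inord 4) -> P (inord 5) ->
  forall i, P i.
Proof.
move=> h0 h1 h2 h3 h4 h5 i; rewrite -(inord_val i).
by case: i => -[|[|[|[|[|[|//]]]]]].
Qed.

Lemma shift_inj : injective shift.
Proof.
move=> [i Hi] [j Hj] E; apply: val_inj => /=; move: E; rewrite /shift /=.
by move: i j Hi Hj => [|[|[|[|[|[|//]]]]]] [|[|[|[|[|[|//]]]]]].
Qed.

Lemma shift_lt i : (shift i < 7)%N.
Proof. by case: i => -[|[|[|[|[|[|//]]]]]]. Qed.

Lemma multiplier_bound i : prime (multiplier i) /\ (multiplier i <= 7)%N.
Proof. by case: i => -[|[|[|[|[|[|//]]]]]]. Qed.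

(** With [p] the multiplier and [n = W / p], this gives [X / p / phi(W / p) = X / phi(W)], a main
    term independent of the form. *)
Lemma totient_mul_dvd p n : prime p -> (0 < n)%N -> (p %| n)%N -> totient (p * n) = (p * totient n)%N.
Proof.
move=> pp n0 pn; have [m cm nE] := pfactor_coprime pp n0.
have l0 : (0 < logn p n)%N by rewrite logn_gt0 mem_primes pp n0 pn.
move: nE l0; case: (logn p n) => // k nE _; rewrite nE mulnCA -expnS.
have c1 e : coprime m (p ^ e) by rewrite coprime_sym coprimeXl.
rewrite !(totient_coprime (c1 _)) !totient_pfactor //= expnS; lia.
Qed.

Lemma coprime_no_prime b W : (0 < W)%N ->
  (forall r, prime r -> (r %| b)%N -> (r %| W)%N -> False) -> coprime b W.
Proof.
move=> W0 H; apply/negPn/negP => nc; have g1 : (1 < gcdn b W)%N.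
  by rewrite ltn_neqAle eq_sym nc gcdn_gt0 W0 orbT.
have := pdiv_dvd (gcdn b W); rewrite dvdn_gcd => /andP[rb rW].
exact: (H _ (pdiv_prime g1) rb rW).
Qed.

Lemma small_prime r : prime r -> (r < 11)%N -> [\/ r = 2, r = 3, r = 5 | r = 7]%N.
Proof. by case: r => [|[|[|[|[|[|[|[|[|[|[|//]]]]]]]]]]] // _ _; constructor. Qed.

Lemma residue_class (D : nat) : (10 < D)%N -> exists W v, [/\ (0 < W)%N,
  forall r, prime r -> (r %| W)%N = (r <= D)%N &
  forall i, exists Wm b, [/\ W = (multiplier i * Wm)%N, (multiplier i %| Wm)%N,
    (v + shift i = multiplier i * b)%N & coprime b W]].
Proof.
move=> D11; pose U := (\prod_(11 <= r < D.+1 | prime r) r)%N.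
have Upr r : prime r -> (r %| U)%N = (10 < r <= D)%N.
  move=> pr; rewrite /U Euclid_dvd_prod // big_has_cond; apply/hasP/andP => [[q]|[r1 r2]].
    rewrite mem_index_iota => /andP[q1 q2] /andP[pq]; rewrite dvdn_prime2 // => /eqP ->.
    by rewrite q1 -ltnS.
  by exists r; [rewrite mem_index_iota r1 ltnS | apply/andP; split].
have U0 : (0 < U)%N by rewrite /U prodn_cond_gt0 // => r; exact: prime_gt0.
have cU n : (0 < n)%N -> (forall r, prime r -> (r %| n)%N -> (r < 11)%N) -> coprime n U.
  move=> n0 Hn; rewrite coprime_sym; apply: coprime_no_prime => // r pr rU rn.
  by move: rU; rewrite Upr // => /andP[]; rewrite leqNgt Hn.
have smallP r a e : prime a -> (a < 11)%N -> prime r -> (r %| a ^ e)%N -> (r < 11)%N.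
  by move=> pa a11 pr; rewrite Euclid_dvdX // dvdn_prime2 // => /andP[/eqP ->].
(* [v] is 1 mod 4, 6 mod 9, 3 mod 25, 3 mod 49. Then 2 divides only [v + 1] and [v + 5], 3 only [v]
   and [v + 6], 5 only [v + 2], 7 only [v + 4], always to the first power. Modulo the larger primes
   [v] is 1, and [v + shift i] is one of 1, ..., 7. *)
have [v1 H1] := @crt_two 4 9 1 6 isT.
have [v2 H2] := @crt_two (4 * 9) 25 v1 3 isT.
have [v3 H3] := @crt_two (4 * 9 * 25) 49 v2 3 isT.
pose Q := (4 * 9 * 25 * 49)%N.
have QE : Q = (2 ^ 2 * 3 ^ 2 * 5 ^ 2 * 7 ^ 2)%N by [].
have Qpr r : prime r -> (r %| Q)%N = (r < 11)%N.
  move=> pr; rewrite QE; have dv n : (r %| n ^ 2)%N = (r %| n)%N by rewrite Euclid_dvdX ?andbT.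
  rewrite (Euclid_dvdM _ _ pr) (Euclid_dvdM (2 ^ 2 * 3 ^ 2) _ pr).
  rewrite (Euclid_dvdM (2 ^ 2) _ pr) !dv.
  apply/idP/idP => [|/(small_prime pr)[] ->]; rewrite ?orbT //.
  by case/orP=> [/orP[/orP[]|]|]; rewrite dvdn_prime2 // => /eqP ->.
have Q0 : (0 < Q)%N by rewrite QE !muln_gt0.
have cQU : coprime Q U by apply: cU => // r pr; rewrite Qpr.
have [v H] := crt_two v3 1 cQU.
have : (v == v %[mod Q * U])%N by [].
rewrite H -/Q H3 H2 H1 => /andP[/andP[/andP[/andP[/eqP e4 /eqP e9] /eqP e25] /eqP e49] /eqP eU].
have Wpr r : prime r -> (r %| Q * U)%N = (r <= D)%N.
  move=> pr; rewrite Euclid_dvdM // Qpr // Upr //; case: ltnP => //= r11.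
  by apply/esym; rewrite (leq_trans (ltnW r11)).
exists (Q * U)%N, v; split=> //; first by rewrite muln_gt0 Q0 U0.
have E4 : v = (v %/ 4 * 4 + 1)%N by rewrite {1}(divn_eq v 4) e4.
have E9 : v = (v %/ 9 * 9 + 6)%N by rewrite {1}(divn_eq v 9) e9.
have E25 : v = (v %/ 25 * 25 + 3)%N by rewrite {1}(divn_eq v 25) e25.
have E49 : v = (v %/ 49 * 49 + 3)%N by rewrite {1}(divn_eq v 49) e49.
move=> i; have big r b : prime r -> (10 < r)%N -> (r <= D)%N -> (v + shift i = multiplier i * b)%N ->
    (r %| b)%N -> False.
  move=> pr r11 rD vb rb; have rU : (r %| U)%N by rewrite Upr // r11.
  have : (v == 1 %[mod r])%N.
    by have := congr1 (modn^~ r) eU; rewrite /= !modn_dvdm // => ->.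
  have rv : (r %| v + shift i)%N by rewrite vb dvdn_mull.
  rewrite -(eqn_modDr (shift i)) (eqP rv) => /eqP /esym h1.
  have : (r %| 1 + shift i)%N by apply/eqP.
  move/dvdn_leq => /(_ isT); have := shift_lt i; lia.
suff : exists Wm' b, [/\ Q = (multiplier i * Wm')%N, (multiplier i %| Wm')%N,
    (v + shift i = multiplier i * b)%N &
    forall r, (r == 2) || (r == 3) || (r == 5) || (r == 7) -> (r %| b)%N -> False]%N.
  move=> [Wm' [b [b1 b2 b3 b4]]]; exists (Wm' * U)%N, b; split=> //.
  - by rewrite b1 mulnA.
  - by rewrite dvdn_mulr.
  apply: coprime_no_prime; first by rewrite muln_gt0 Q0 U0.
  move=> r pr rb; rewrite Wpr // => rD; have [r11|r11] := ltnP r 11; last exact: (big r b).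
  by apply: (b4 r _ rb); have [] := small_prime pr r11 => ->.
clear -E4 E9 E25 E49; rewrite {}/Q.
move: (v %/ 4)%N (v %/ 9)%N (v %/ 25)%N (v %/ 49)%N E4 E9 E25 E49 => k4 k9 k25 k49 E4 E9 E25 E49.
move: i; apply: ord6P; rewrite /shift /multiplier ?inordK //=.
- exists (4 * 3 * 25 * 49)%N, (k9 * 3 + 2)%N; split=> //; first by lia.
  by move=> r /orP[/orP[/orP[]|]|] /eqP -> /dvdnP[s rs]; lia.
- exists (2 * 9 * 25 * 49)%N, (k4 * 2 + 1)%N; split=> //; first by lia.
  by move=> r /orP[/orP[/orP[]|]|] /eqP -> /dvdnP[s rs]; lia.
- exists (4 * 9 * 5 * 49)%N, (k25 * 5 + 1)%N; split=> //; first by lia.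
  by move=> r /orP[/orP[/orP[]|]|] /eqP -> /dvdnP[s rs]; lia.
- exists (4 * 9 * 25 * 7)%N, (k49 * 7 + 1)%N; split=> //; first by lia.
  by move=> r /orP[/orP[/orP[]|]|] /eqP -> /dvdnP[s rs]; lia.
- exists (2 * 9 * 25 * 49)%N, (k4 * 2 + 3)%N; split=> //; first by lia.
  by move=> r /orP[/orP[/orP[]|]|] /eqP -> /dvdnP[s rs]; lia.
- exists (4 * 3 * 25 * 49)%N, (k9 * 3 + 4)%N; split=> //; first by lia.
  by move=> r /orP[/orP[/orP[]|]|] /eqP -> /dvdnP[s rs]; lia.
Qed.

(** * Smallness of the local errors at primes beyond [D] *)

Section LargePrimes.
Variable (R : realType).

Lemma telescope_inv (D n : nat) : (0 < D)%N ->
  \sum_(i < n | (D < i)%N) ((i%:R - 1)^-1 - i%:R^-1) <= (D%:R)^-1 :> R.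
Proof.
move=> D0; suff : \sum_(i < n | (D < i)%N) ((i%:R - 1)^-1 - i%:R^-1) =
    (D%:R)^-1 - (maxn D n.-1)%:R^-1 :> R.
  by move=> ->; rewrite gerBl invr_ge0 ler0n.
elim: n => [|n IH]; first by rewrite big_ord0 maxn0 subrr.
rewrite big_mkcond big_ord_recr -big_mkcond IH /=.
case: ltnP => Dn; last by rewrite addr0 !(maxn_idPl _) //; lia.
have -> : maxn D n.-1 = n.-1 by lia.
by have -> : n.-1%:R = n%:R - 1 :> R; [rewrite -subn1 natrB //; lia | ring].
Qed.

Variables (Z D : nat) (T K : finType) (pi : T -> nat).
Hypotheses (D_gt0 : (0 < D)%N) (pi_inj : injective pi) (pi_gt : forall p, (D < pi p)%N).
Hypothesis pi_le : forall p, (pi p <= Z)%N.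

Lemma sum_inv_diff : \sum_p (((pi p)%:R - 1)^-1 - (pi p)%:R^-1) <= (D%:R)^-1 :> R.
Proof.
apply: le_trans (telescope_inv Z.+1 D_gt0); rewrite [leRHS]big_mkcond /=.
pose G (j : 'I_Z.+1) : R := if (D < j)%N then (j%:R - 1)^-1 - j%:R^-1 else 0.
have -> : \sum_p (((pi p)%:R - 1)^-1 - (pi p)%:R^-1) = \sum_p G (inord (pi p)).
  by apply: eq_bigr => p _; rewrite /G inordK ?ltnS // pi_gt.
apply: (@sum_inj_le R T 'I_Z.+1 xpredT (fun p => inord (pi p)) G) => [p q _ _ /(congr1 val)|j].
  by rewrite /= !inordK ?ltnS // => /pi_inj.
rewrite /G; case: ifP => // Dj; rewrite subr_ge0 lef_pV2 ?posrE ?gerBl ?subr_gt0 ?ltr1n ?ltr0n //; lia.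
Qed.

Lemma inv_sq_sum_le : inv_sq_sum R pi <= (D%:R)^-1.
Proof.
apply: le_trans sum_inv_diff; apply: ler_sum => p _.
have p1 : (1 : R) < (pi p)%:R by rewrite ltr1n; have := pi_gt p; lia.
move: (_%:R) p1 => x x1; have -> : (x - 1)^-1 - x^-1 = x^-1 * (x - 1)^-1.
  by field; rewrite !gt_eqF ?subr_gt0 ?(lt_trans ltr01).
have x0 : 0 < x by exact: lt_trans ltr01 x1.
rewrite expr2 ler_wpM2l ?invr_ge0 ?(ltW x0) // lef_pV2 ?posrE ?subr_gt0 //; lra.
Qed.

(** From [(1 + t) * (1 - t) <= 1] at each prime, the product is at most [1 / (1 - s)] with
    [s = (k - 1) / D <= 1 / 2], hence at most [1 + 2 * s]. *)
Lemma extra_le : (0 < #|K|)%N -> (2 * #|K| <= D)%N -> extra R K pi <= 2 * #|K|%:R / D%:R.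
Proof.
move=> K0 KD; pose k : R := #|K|%:R - 1; pose x p : R := ((pi p)%:R - 1)^-1 - (pi p)%:R^-1.
have k0 : 0 <= k by rewrite subr_ge0 ler1n.
have xp p : 0 <= x p.
  have p1 := pi_gt p; rewrite subr_ge0 lef_pV2 ?posrE ?gerBl ?subr_gt0 ?ltr1n ?ltr0n //; lia.
have D0 : (0 : R) < D%:R by rewrite ltr0n.
have s2 : k * (D%:R)^-1 <= 1 / 2 :> R.
  rewrite ler_pdivrMr // /k; have : ((2 * #|K|)%N%:R : R) <= D%:R by rewrite ler_nat.
  rewrite natrM; lra.
have sx : \sum_p k * x p <= k * (D%:R)^-1 by rewrite -mulr_sumr ler_wpM2l // sum_inv_diff.
have x1 p : 0 <= k * x p <= 1.
  rewrite mulr_ge0 //=; apply: le_trans (_ : \sum_p k * x p <= _); last lra.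
  by rewrite (bigD1 p) //= lerDl sumr_ge0 // => q _; rewrite mulr_ge0.
rewrite /extra; set P := \prod_p _.
have P1 : P * \prod_p (1 - k * x p) <= 1.
  rewrite -big_split /= -[leRHS](prodr_const_nat 0 0 1) big_nil.
  apply: prodr_ile1 => p _; have /andP[a b] := x1 p; rewrite -/k -/(x p).
  have -> : (1 + k * x p) * (1 - k * x p) = 1 - (k * x p) ^+ 2 by ring.
  by rewrite subr_ge0 gerBl sqr_ge0 andbT expr_le1.
have Pge : 0 <= P by apply: prodr_ge0 => p _; have /andP[a _] := x1 p; rewrite addr_ge0.
have := @prodr_ge_1Bsum R T xpredT (fun p => k * x p) (fun p _ => x1 p).
move=> P2; have P3 : P * (1 - k * (D%:R)^-1) <= 1.
  by apply: le_trans P1; rewrite ler_wpM2l //; lra.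
have -> : 2 * #|K|%:R / D%:R = 2 * (k * (D%:R)^-1) + 2 * (D%:R)^-1 :> R by rewrite /k; field; rewrite gt_eqF.
have Di : (0 : R) <= (D%:R)^-1 by rewrite invr_ge0 ler0n.
have s0 : 0 <= k * (D%:R)^-1 by rewrite mulr_ge0.
move: (k * _) s2 s0 P3 => s s2 s0 P3; clear -P3 s2 s0 Pge Di; nra.
Qed.

End LargePrimes.

(** A pair [(m, q)] determines [n = a m * q - h m], and by the last hypothesis an [n] arises from at
    most one form; each prime carries weight at most [M]. *)
Lemma sum_primes_le (R : realType) (K : finType) (a h b Wm : K -> nat) (x : K -> R)
    (N l v W : nat) (f : nat -> R) (M : R) :
  (forall n, 0 <= f n) -> 0 <= M ->
  (forall m, [/\ (0 < a m)%N, W = (a m * Wm m)%N & (v + h m = a m * b m)%N]) ->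
  (forall m q, x m < q%:R -> q%:R <= 2 * x m -> (N + h m <= a m * q < N + l + h m)%N) ->
  (forall m q, prime q -> q%:R <= 2 * x m -> ln (q%:R : R) <= M) ->
  (forall n m m' q q', (N <= n)%N -> prime q -> prime q' ->
     (n + h m = a m * q)%N -> (n + h m' = a m' * q')%N -> m = m') ->
  \sum_m \sum_(q < (Num.truncn (2 * x m)).+1 |
      (x m < q%:R) && (q%:R <= 2 * x m) && (q == b m %[mod Wm m])%N)
    varpi R q * f (a m * q - h m)%N <=
  M * \sum_(n < l) (N + n == v %[mod W])%:R * f (N + n)%N.
Proof.
move=> f0 M0 arith range logM uniq.
pose good m n := (a m %| n + h m)%N && prime ((n + h m) %/ a m).
(* The index [l] is added so that [inord] applies; the factor [(n < l)] gives it weight 0. *)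
pose g m (n : 'I_l.+1) : R := (good m (N + n)%N)%:R *
  ((n < l)%N%:R * ((N + n == v %[mod W])%:R * f (N + n)%N)).
have g0 m n : 0 <= g m n by rewrite !mulr_ge0.
apply: (@le_trans _ _ (\sum_m M * \sum_n g m n)).
  apply: ler_sum => m _; have [a0 WE vE] := arith m.
  rewrite big_mkcond (eq_bigr (fun q : 'I__ => if [&& prime q, x m < q%:R, q%:R <= 2 * x m &
      (q == b m %[mod Wm m])%N] then varpi R q * f (a m * q - h m)%N else 0)); last first.
    move=> q _; case: (boolP (prime q)) => pq /=; first by rewrite andbA.
    by rewrite /varpi (negPf pq) mul0r if_same.
  rewrite -big_mkcond mulr_sumr /=.
  apply: (@le_trans _ _ (\sum_(q < (Num.truncn (2 * x m)).+1 | [&& prime q, x m < q%:R,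
     q%:R <= 2 * x m & (q == b m %[mod Wm m])%N]) M * g m (inord (a m * q - h m - N)))).
    apply: ler_sum => q /and4P[pq q1 q2 q3]; have /andP[r1 r2] := range m q q1 q2.
    rewrite /g inordK; last by lia.
    have -> : (N + (a m * q - h m - N) = a m * q - h m)%N by lia.
    have -> : (a m * q - h m - N < l)%N by lia.
    have e : (a m * q - h m + h m = a m * q)%N by lia.
    rewrite /good e dvdn_mulr // mulKn // pq !mul1r.
    have -> : (a m * q - h m == v %[mod W])%N.
      by rewrite -(eqn_modDr (h m)) e vE WE -!muln_modr (eqP q3).
    by rewrite mul1r /varpi pq ler_wpM2r // (logM m).
  apply: (@sum_inj_le R _ _ _ (fun q : 'I_(Num.truncn (2 * x m)).+1 => inord (a m * q - h m - N))
    (fun n => M * g m n)) => [q q'|n]; last exact: mulr_ge0.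
  move=> /and4P[_ q1 q2 _] /and4P[_ q1' q2' _] /(congr1 val).
  have /andP[r1 r2] := range m q q1 q2; have /andP[r1' r2'] := range m q' q1' q2'.
  rewrite /= !inordK; [|lia..] => e; apply/val_inj/eqP => /=.
  by rewrite -(eqn_pmul2l a0); apply/eqP; lia.
rewrite -mulr_sumr ler_wpM2l // exchange_big big_ord_recr /= [X in _ + X]big1 ?addr0; last first.
  by move=> m _; rewrite /g /= ltnn mul0r mulr0.
apply: ler_sum => n _; rewrite -mulr_suml /= ltn_ord mul1r.
rewrite -[leRHS]mul1r ler_wpM2r ?mulr_ge0 // -natr_sum lern1.
have [m gm|ng] := pickP (fun m => good m (N + n)%N); last by rewrite big1 // => m _; rewrite ng.
rewrite (bigD1 m) //= gm big1 // => m' mm'; apply/eqP; rewrite eqb0; apply/negP => gm'.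
move: gm gm' mm' => /andP[d p] /andP[d' p'] /eqP; apply.
by apply: (uniq (N + n)%N _ _ _ _ _ p' p); rewrite ?leq_addr // mulnC divnK.
Qed.

(** * The sieve inequality when no two forms are prime together *)

Section SieveInequality.
Variables (R : realType) (D W v Z X : nat) (Wm b : 'I_6 -> nat).
Hypotheses (D_gt : (11 < D)%N) (W_gt0 : (0 < W)%N).
Hypothesis W_primes : forall r, prime r -> (r %| W)%N = (r <= D)%N.
Hypothesis arith : forall i, [/\ W = (multiplier i * Wm i)%N, (multiplier i %| Wm i)%N,
  (v + shift i = multiplier i * b i)%N & coprime (b i) W].
Hypotheses (L_ge1 : 1 <= ln (Z%:R : R)) (Z_le : (7 * Z <= X)%N) (X_ge : (49 <= X)%N).

Definition sieve_prime := {p : 'I_Z.+1 | prime p && (D < p)%N}.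
Definition sieve_val (p : sieve_prime) : nat := val (val p).

Lemma sieve_val_prime p : prime (sieve_val p).
Proof. by case/andP: (valP p). Qed.

Lemma sieve_val_gt p : (D < sieve_val p)%N.
Proof. by case/andP: (valP p). Qed.

Lemma sieve_val_inj : injective sieve_val.
Proof. by move=> p q /val_inj/val_inj. Qed.

Lemma sieve_val_le p : (sieve_val p <= Z)%N.
Proof. by rewrite -ltnS ltn_ord. Qed.

Lemma sieve_val_coprime p : coprime (sieve_val p) W.
Proof.
by rewrite prime_coprime ?sieve_val_prime // W_primes ?sieve_val_prime // -ltnNge sieve_val_gt.
Qed.

Lemma sieve_val_surj q : prime q -> (q <= Z)%N -> coprime q W -> exists p, sieve_val p = q.
Proof.
move=> pq qZ; rewrite prime_coprime // W_primes // -ltnNge => Dq.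
have H : prime (Ordinal (qZ : (q < Z.+1)%N)) && (D < Ordinal (qZ : (q < Z.+1)%N))%N by rewrite /= pq.
by exists (exist (fun p : 'I_Z.+1 => prime p && (D < p)%N) _ H).
Qed.

Let Y : {ffun 'I_6 -> 'I_Z.+1} -> R := @test_fun R Z.
Let m6 : R := mass R Z W ^+ 6.

Lemma sieve_inequality :
  (forall n m m' q q', (X - 5 <= n)%N -> prime q -> prime q' ->
     (n + shift m = multiplier m * q)%N -> (n + shift m' = multiplier m' * q')%N -> m = m') ->
  \sum_m (X%:R / (totient W)%:R *
      (\sum_u twt R W (~: [set m]%SET) u * fibre_sum W Y m u ^+ 2
        - 6 ^+ 2 * mass R Z W ^+ 7 * (116 / D%:R))
    - (6 * m6) ^+ 2 * \sum_(d | (colour_norm sieve_val d <= Z)%N)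
        \sum_(e | (colour_norm sieve_val e <= Z)%N)
        Eq (X%:R / (multiplier m)%:R) (Wm m * colour_norm sieve_val (@join_colour _ 'I_6 d e)))
  <= ln X%:R * ((X + 6)%:R / W%:R * \sum_u twt R W [set: 'I_6]%SET u * Y u ^+ 2
      + (6 * m6) ^+ 2 * (Z%:R * m6) ^+ 2).
Proof.
move=> uniq; have Z_gt0 : (0 < Z)%N.
  by rewrite lt0n; apply/eqP => z0; move: L_ge1; rewrite z0 ln0 // ler10.
have X1 : (1 : R) <= X%:R by rewrite ler1n; lia.
have lnX : 0 <= ln (X%:R : R) by exact: ln_ge0.
have piK p : (#|'I_6| < sieve_val p)%N by rewrite card_ord; have := sieve_val_gt p; lia.
have pi7 p : (7 <= sieve_val p)%N by have := sieve_val_gt p; lia.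
have Yb u : 0 <= Y u <= 6 by exact: test_fun_bound.
have Ys (u : {ffun 'I_6 -> 'I_Z.+1}) : (Z < \prod_i u i)%N -> Y u = 0 by exact: test_fun_supp.
have mult0 m : (0 < multiplier m)%N by have [/prime_gt0] := multiplier_bound m.
set w := fun n => sieve_weight sieve_val (signed_value sieve_val Y)
  (shift_colouring sieve_val shift n) ^+ 2.
have upper := @sieved_count R Z _ _ sieve_val sieve_val_prime sieve_val_inj shift 7 shift_inj
  shift_lt pi7 piK W W_gt0 sieve_val_coprime Z_gt0 Y 6 Yb (X - 5) (X + 6) v.
have lower m : X%:R / (totient W)%:R *
      (\sum_u twt R W (~: [set m]%SET) u * fibre_sum W Y m u ^+ 2
        - 6 ^+ 2 * mass R Z W ^+ 7 * (116 / D%:R))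
    - (6 * m6) ^+ 2 * \sum_(d | (colour_norm sieve_val d <= Z)%N)
        \sum_(e | (colour_norm sieve_val e <= Z)%N)
        Eq (X%:R / (multiplier m)%:R) (Wm m * colour_norm sieve_val (@join_colour _ 'I_6 d e))
    <= \sum_(q < (Num.truncn (2 * (X%:R / (multiplier m)%:R : R))).+1 |
      (X%:R / (multiplier m)%:R < q%:R :> R) && (q%:R <= 2 * (X%:R / (multiplier m)%:R : R)) &&
      (q == b m %[mod Wm m])%N)
    varpi R q * w (multiplier m * q - shift m)%N.
  have [WE aWm _ cb] := arith m; have [pa a7] := multiplier_bound m.
  have Wm0 : (0 < Wm m)%N by move: W_gt0; rewrite WE muln_gt0 => /andP[].
  have WmW : (Wm m %| W)%N by rewrite WE dvdn_mull.
  have a0 : (0 : R) < (multiplier m)%:R by rewrite ltr0n mult0.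
  have x7 : 7%:R <= X%:R / (multiplier m)%:R :> R.
    rewrite ler_pdivlMr // -natrM ler_nat; lia.
  have xZ : Z%:R <= X%:R / (multiplier m)%:R :> R.
    rewrite ler_pdivlMr // -natrM ler_nat; apply: leq_trans Z_le; by rewrite mulnC leq_mul2r a7 orbT.
  have pia p : ~~ (sieve_val p %| multiplier m)%N.
    apply/negP => /(dvdn_leq (mult0 m)); apply/negP; rewrite -ltnNge.
    exact: leq_ltn_trans (leq_trans a7 (leq_trans (isT : (7 <= 12)%N) D_gt)) (sieve_val_gt p).
  have := @sieved_primes R Z _ _ sieve_val sieve_val_prime sieve_val_inj shift 7 shift_inj
    shift_lt pi7 W sieve_val_coprime Z_gt0 sieve_val_le Y 6 Yb m (multiplier m) (Wm m) (b m)
    (mult0 m) pia Wm0 (fun p => coprime_dvdr WmW (sieve_val_coprime p)) (coprime_dvdr WmW cb)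
    _ x7 xZ.
  rewrite card_ord -/m6; apply: le_trans; rewrite lerB //.
  have -> : X%:R / (multiplier m)%:R / (totient (Wm m))%:R = X%:R / (totient W)%:R :> R.
    by rewrite WE totient_mul_dvd // natrM invfM mulrA.
  rewrite ler_wpM2l //.
  have := quadratic_form_lower sieve_val_prime sieve_val_inj sieve_val_coprime sieve_val_surj
    Z_gt0 _ piK Yb Ys m.
  rewrite card_ord => /(_ isT); apply: le_trans; rewrite lerB //.
  rewrite cardsC1 card_ord /=.
  have -> : (6 * mass R Z W) ^+ 2 * mass R Z W ^+ 5 = 6 ^+ 2 * mass R Z W ^+ 7 by ring.
  have D0 : (0 < D)%N by exact: leq_trans D_gt.
  (* With [inv_sq_sum <= 1 / D] and [extra <= 12 / D] the error factor is at most [(2 * (1 + 12) + 8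
     * 6 + (6 + 36)) / D = 116 / D]. *)
  have s1 := @inv_sq_sum_le R Z D _ sieve_val D0 sieve_val_inj sieve_val_gt sieve_val_le.
  have := @extra_le R Z D _ 'I_6 sieve_val D0 sieve_val_inj sieve_val_gt sieve_val_le.
  rewrite card_ord => /(_ isT) s2; have {}s2 := s2 D_gt.
  rewrite ler_wpM2l ?mulr_ge0 ?exprn_ge0 ?mass_ge0 //.
  have D1 : (0 : R) < (D%:R)^-1 by rewrite invr_gt0 ltr0n.
  move: s1 s2 D1; move: (inv_sq_sum _ _) (extra _ _ _) (_^-1) => s e i; lra.
apply: le_trans (ler_sum _ (fun m _ => lower m)) _.
rewrite card_ord -/m6 in upper; apply: le_trans (ler_wpM2l lnX upper).
(* [X < a * q <= 2 * X] and shifts of at most 6 put [n] in [[X - 5, 2 * X]], a window of [X + 6]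
   integers. Every multiplier is at least 2, so [q <= X] and its logarithm is at most [ln X]. *)
apply: (@sum_primes_le R _ multiplier shift b Wm _ (X - 5) (X + 6) v W w) => //.
- by move=> n; exact: sqr_ge0.
- by move=> m; have [WE _ vb _] := arith m; split.
- move=> m q; have a0 : (0 : R) < (multiplier m)%:R by rewrite ltr0n mult0.
  rewrite ltr_pdivrMr // mulrA ler_pdivlMr // -!natrM ltr_nat ler_nat mulnC => q1 q2.
  have := shift_lt m; lia.
move=> m q pq; have [pa _] := multiplier_bound m.
have a0 : (0 : R) < (multiplier m)%:R by rewrite ltr0n mult0.
rewrite mulrA ler_pdivlMr // -!natrM ler_nat => q2.
have X0 : (0 < X)%N by exact: leq_trans X_ge.
rewrite ler_ln ?posrE ?ltr0n ?(prime_gt0 pq) ?X0 // ler_nat.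
by rewrite -(leq_pmul2l (isT : (0 < 2)%N)) (leq_trans _ q2) // mulnC leq_mul2l prime_gt1 ?orbT.
Qed.
End SieveInequality.

(** * Choice of parameters and the contradiction *)

Lemma pow_le_exp (R : realType) (n : nat) (K k : R) : 0 < k ->
  exists Y0, forall y, Y0 <= y -> K * y ^+ n <= expR (k * y).
Proof.
move=> k0; pose c := (k / n.+1%:R) ^+ n.+1.
have c0 : 0 < c by rewrite exprn_gt0 // divr_gt0 // ltr0n.
exists (`|K| / c) => y yY; have y0 : 0 <= y by apply: le_trans yY; rewrite divr_ge0 // ltW.
apply: (@le_trans _ _ (c * y ^+ n.+1)).
  rewrite exprS mulrA ler_wpM2r ?exprn_ge0 //.
  by apply: le_trans (ler_norm K) _; move: yY; rewrite ler_pdivrMr // mulrC.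
have -> : k * y = n.+1%:R * (k / n.+1%:R * y).
  by rewrite [RHS]mulrA [_ * (k / _)]mulrCA mulfV ?mulr1 // pnatr_eq0.
(* The exponential is the [n.+1]-st power of the exponential of [k * y / n.+1], which exceeds its
   argument. *)
rewrite expRM_natl /c -exprMn lerXn2r ?nnegrE ?expR_ge0 //.
  by rewrite mulr_ge0 // divr_ge0 // ltW.
by apply: le_trans (expR_ge1Dx _); rewrite lerDr.
Qed.

(** Everything is divided by [U = X / W * tau ^+ 6]. As [phi = rho * W] and [tau = rho * L], the
    prime side [X / phi * tau ^+ 7] equals [U * L], and the density [rho] cancels. The powers of 2
    come from [mass <= 2 * tau]. *)
Lemma normalised_inequality (R : realFieldType) (I J d A E e X W phi rho y L tau mass Z : R) :
  0 < X -> 0 < W -> 0 < rho -> phi = rho * W -> tau = rho * L -> 0 < tau -> 0 <= y ->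
  0 <= mass <= 2 * tau -> 0 <= A ->
  6 ^+ 2 * 2 ^+ 7 * A <= d -> 6 * (I + d) <= X * d ->
  6 ^+ 2 * 2 ^+ 12 * tau ^+ 6 * E * W <= X * e -> 0 <= E ->
  6 ^+ 2 * 2 ^+ 24 * tau ^+ 18 * Z ^+ 2 * W <= X * d ->
  6 * (X / phi * (tau ^+ 7 * (J - d) - 6 ^+ 2 * mass ^+ 7 * A) - (6 * mass ^+ 6) ^+ 2 * E) <=
    y * ((X + 6) / W * (tau ^+ 6 * (I + d)) + (6 * mass ^+ 6) ^+ 2 * (Z * mass ^+ 6) ^+ 2) ->
  6 * (L * (J - 2 * d) - e) <= y * (I + 3 * d).
Proof.
move=> X0 W0 rho0 phiE tauE tau0 y0 /andP[m0 m2] A0 HA HX HE E0 HZ H.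
have powm n : mass ^+ n <= 2 ^+ n * tau ^+ n.
  by rewrite -exprMn lerXn2r ?nnegrE // mulr_ge0 // ltW.
pose U := X / W * tau ^+ 6; have U0 : 0 < U by rewrite mulr_gt0 ?exprn_gt0 ?divr_gt0.
have main : U * (L * (J - 2 * d)) <=
    X / phi * (tau ^+ 7 * (J - d) - 6 ^+ 2 * mass ^+ 7 * A).
  have -> : U * (L * (J - 2 * d)) = X / phi * (tau ^+ 7 * (J - 2 * d)).
    by rewrite /U phiE tauE; field; rewrite !gt_eqF.
  rewrite ler_wpM2l //; first by rewrite phiE divr_ge0 ?mulr_ge0 // ltW.
  have t7 : 0 < tau ^+ 7 by rewrite exprn_gt0.
  have m7 : 6 ^+ 2 * mass ^+ 7 * A <= tau ^+ 7 * d.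
    apply: le_trans (_ : tau ^+ 7 * (6 ^+ 2 * 2 ^+ 7 * A) <= _); last by rewrite ler_wpM2l // ltW.
    have -> : tau ^+ 7 * (6 ^+ 2 * 2 ^+ 7 * A) = 6 ^+ 2 * (2 ^+ 7 * tau ^+ 7) * A by ring.
    by rewrite ler_wpM2r // ler_wpM2l // sqr_ge0.
  move: (6 ^+ 2 * _ * A) m7 => c m7; clear -m7; lra.
have m12 : (6 * mass ^+ 6) ^+ 2 <= 6 ^+ 2 * 2 ^+ 12 * tau ^+ 12.
  by rewrite exprMn -exprM -mulrA; apply: ler_wpM2l (powm 12); exact: sqr_ge0.
have err1 : (6 * mass ^+ 6) ^+ 2 * E <= U * e.
  apply: le_trans (ler_wpM2r E0 m12) _.
  have -> : 6 ^+ 2 * 2 ^+ 12 * tau ^+ 12 * E = tau ^+ 6 / W * (6 ^+ 2 * 2 ^+ 12 * tau ^+ 6 * E * W).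
    by field; rewrite gt_eqF.
  have -> : U * e = tau ^+ 6 / W * (X * e) by rewrite /U; field; rewrite gt_eqF.
  by rewrite ler_wpM2l // divr_ge0 ?exprn_ge0 ?ltW.
have err2 : (6 * mass ^+ 6) ^+ 2 * (Z * mass ^+ 6) ^+ 2 <= U * d.
  apply: (@le_trans _ _ (6 ^+ 2 * 2 ^+ 12 * tau ^+ 12 * (2 ^+ 12 * tau ^+ 12 * Z ^+ 2))).
    apply: ler_pM => //; rewrite ?sqr_ge0 //.
    rewrite exprMn mulrC -exprM; apply: ler_wpM2r; first exact: sqr_ge0.
    exact: (powm 12).
  have -> : 6 ^+ 2 * 2 ^+ 12 * tau ^+ 12 * (2 ^+ 12 * tau ^+ 12 * Z ^+ 2) =
      tau ^+ 6 / W * (6 ^+ 2 * 2 ^+ 24 * tau ^+ 18 * Z ^+ 2 * W) by field; rewrite gt_eqF.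
  have -> : U * d = tau ^+ 6 / W * (X * d) by rewrite /U; field; rewrite gt_eqF.
  by rewrite ler_wpM2l // divr_ge0 ?exprn_ge0 ?ltW.
have err3 : (X + 6) / W * (tau ^+ 6 * (I + d)) <= U * (I + 2 * d).
  have -> : (X + 6) / W * (tau ^+ 6 * (I + d)) = tau ^+ 6 / W * (X * (I + d) + 6 * (I + d)).
    by field; rewrite gt_eqF.
  have -> : U * (I + 2 * d) = tau ^+ 6 / W * (X * (I + d) + X * d).
    by rewrite /U; field; rewrite gt_eqF.
  by rewrite ler_wpM2l ?lerD2l // divr_ge0 ?exprn_ge0 // ltW.
rewrite -(ler_pM2l U0).
have -> : U * (y * (I + 3 * d)) = y * (U * (I + 2 * d) + U * d) by ring.
apply: le_trans (ler_wpM2l y0 (lerD err3 err2)); apply: le_trans H.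
by rewrite mulrCA; apply: ler_wpM2l; [exact: ltW | clear -main err1; lra].
Qed.

Lemma ln_truncn_bound (R : realType) (x : R) : 2 <= x ->
  ln x - 1 <= ln (Num.truncn x)%:R <= ln x.
Proof.
move=> x2; have x0 : 0 < x by apply: lt_le_trans x2.
have := truncn_itv (ltW x0); rewrite -natr1 => /andP[t1 t2].
have t0 : (0 : R) < (Num.truncn x)%:R by lra.
apply/andP; split; last by rewrite ler_ln.
have ln2 : ln (2 : R) <= 1 by apply: le_trans (ln_leB1 _) _; [rewrite ltr0n | lra].
have : ln (x / 2) <= ln (Num.truncn x)%:R by rewrite ler_ln ?posrE ?divr_gt0 //; lra.
by rewrite ln_div ?posrE //; lra.
Qed.

Lemma critical_level (R : rcfType) (theta : R) :
  (75 - Num.sqrt 473) / 56 < theta -> 319 / 336 < theta.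
Proof.
(* [(75 - 131 / 6) / 56 = 319 / 336], so it suffices that the square root stays below [131 / 6]. *)
apply: lt_trans; have : Num.sqrt (473 : R) < 131 / 6.
  have s0 : 0 <= (473 : R) by lra.
  have q0 : 0 <= (131 / 6 : R) by lra.
  have := @ltr_sqr R (Num.sqrt 473) (131 / 6).
  rewrite !nnegrE sqrtr_ge0 q0 (sqr_sqrtr s0) => /(_ isT isT) <-.
  have -> : (131 / 6 : R) ^+ 2 = 17161 / 36 by field.
  lra.
lra.
Qed.

Lemma sieve_parameters (R : realFieldType) (theta J I : R) :
  J = 1 / (60 * 99) -> I = 29 / (240 * 252) -> 319 / 336 < theta -> theta <= 1 ->
  exists eps d, [/\ 0 < eps, 0 < d, 2 * d < J, 1 / 5 <= theta / 2 - eps &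
    I + 15 * d <= 6 * (theta / 2 - eps) * (J - 2 * d)].
Proof.
move=> JE IE tc t1; pose g := theta - 319 / 336; have g0 : 0 < g by rewrite subr_gt0.
have g1 : g <= 1 by rewrite /g; lra.
(* At the critical theta the two sides agree for [eps = d = 0]. The surplus left after [eps] is
   [3 / 2 * J * g = 21 * d]: 15 for the left side and 6 for the loss through [2 * d] on the
   right. *)
exists (g / 4), (J * g / 14); split; try by rewrite ?JE /g; lra.
have -> : 6 * (theta / 2 - g / 4) * (J - 2 * (J * g / 14)) =
  6 * (theta / 2 - g / 4) * J - 12 * (theta / 2 - g / 4) * (J * g / 14) by ring.
have : 12 * (theta / 2 - g / 4) * (J * g / 14) <= 6 * (J * g / 14).
  by rewrite ler_pM2r ?JE ?/g; lra.
by rewrite IE JE /g; lra.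
Qed.

Lemma sieve_level (R : realType) (vt y : R) : 14 <= y -> 1 / 5 <= vt -> vt <= 1 / 2 ->
  exists Z : nat, [/\ (0 < Z)%N, 7 * Z%:R <= expR y, Z%:R ^+ 2 <= expR (2 * (vt * y)) &
    vt * y - 1 <= ln Z%:R <= vt * y].
Proof.
move=> y14 v1 v2; have y0 : 0 < y by lra.
have l1 := ler_wpM2r (ltW y0) v1; have l2 := ler_wpM2r (ltW y0) v2.
pose s := expR (vt * y); have s0 : 0 <= s by exact: expR_ge0.
have s2 : 2 <= s by apply: le_trans (expR_ge1Dx _); lra.
have Zs : (Num.truncn s)%:R <= s by rewrite truncn_le.
have sE : ln s = vt * y by exact: expRK.
exists (Num.truncn s); split.
- by rewrite truncn_gt0 (le_trans _ s2) // ler1n.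
- have -> : expR y = expR (y / 2) * expR (y / 2) by rewrite -expRD; congr expR; field.
  apply: ler_pM => //; first by apply: le_trans (expR_ge1Dx _); lra.
  by apply: le_trans Zs _; rewrite ler_expR; lra.
- by rewrite expRM_natl lerXn2r ?nnegrE.
by have := ln_truncn_bound s2; rewrite sE.
Qed.

(** Transfers [bv_error] from [X] to the six points [X / a]. One [eps] is the margin of the
    hypothesis, the other makes room for the constant modulus [W]. *)
Lemma bv_error_scaled (R : realType) (theta eps : R) : theta <= 1 -> BV theta -> 0 < eps ->
  exists C x0, 0 <= C /\ forall X D W Wm a Z : nat, x0 <= ln (X%:R : R) -> 14 <= ln (X%:R : R) ->
    prime a -> (a <= 7)%N -> W = (a * Wm)%N -> (0 < W)%N ->
    (forall r, prime r -> (r %| W)%N = (r <= D)%N) ->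
    (0 < Z)%N -> 7 * Z%:R <= (X%:R : R) -> 7 * W%:R <= expR (eps * ln (X%:R : R)) ->
    Z%:R ^+ 2 <= expR ((theta - 2 * eps) * ln (X%:R : R)) ->
    \sum_(d | (colour_norm (@sieve_val D Z) d <= Z)%N)
       \sum_(e | (colour_norm (@sieve_val D Z) e <= Z)%N)
       Eq (X%:R / a%:R : R) (Wm * colour_norm (@sieve_val D Z) (@join_colour _ 'I_6 d e))
    <= C * (X%:R / ln X%:R ^+ 13).
Proof.
move=> t1 bv e0; have [C [x0 err]] := bv_error 6 13 t1 bv e0.
exists (`|C| * 2 ^+ 13), (7 * `|x0|); split; first by rewrite mulr_ge0.
move=> X D W Wm a Z x0X y14 pa a7 WE W0 Wpr Z0 Z7 W7 Zsq.
have [y yE] : exists y : R, y = ln X%:R by eexists.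
rewrite -yE in x0X y14 W7 Zsq *; have y0 : 0 < y by lra.
have X0 : (0 : R) < X%:R by apply: lt_le_trans Z7; rewrite mulr_gt0 // ltr0n.
have Xexp : expR y = X%:R by rewrite yE lnK.
have yX : y <= X%:R by rewrite -Xexp; apply: le_trans (expR_ge1Dx _); rewrite lerDr.
have aR : (0 : R) < a%:R by rewrite ltr0n prime_gt0.
have a1R : (1 : R) <= a%:R by rewrite ler1n prime_gt0.
have a7R : a%:R <= 7 :> R by rewrite ler_nat.
have Wm0 : (0 < Wm)%N by move: W0; rewrite WE muln_gt0 => /andP[].
have lna : ln a%:R <= 6 :> R by apply: le_trans (ln_leB1 aR) _; clear -a7R; lra.
have la0 : 0 <= ln a%:R :> R by exact: ln_ge0.
have lnx : ln (X%:R / a%:R) = y - ln a%:R by rewrite ln_div // yE.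
apply: le_trans (err _ _ 'I_6 (@sieve_val D Z) Wm Z _ _ _ _ _ Wm0 Z0 _ _) _; rewrite ?card_ord //.
- rewrite ler_pdivlMr // (le_trans (ler_wpM2r (ltW aR) (ler_norm x0))) //.
  by apply: le_trans yX; apply: le_trans x0X; rewrite mulrC ler_wpM2r.
- exact: sieve_val_prime.
- exact: sieve_val_inj.
- move=> p; apply: coprime_dvdr (sieve_val_coprime Wpr p).
  by rewrite WE dvdn_mull.
- by rewrite ler_pdivlMr // mulrC (le_trans _ Z7) // ler_wpM2r.
- have xa : 0 < X%:R / a%:R :> R by rewrite divr_gt0.
  rewrite /powR gt_eqF // lnx natrM natrX.
  apply: (@le_trans _ _ (W%:R * expR ((theta - 2 * eps) * y))).
    apply: ler_pM => //; rewrite ?ler0n ?exprn_ge0 // ler_nat WE.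
    by rewrite leq_pmull // prime_gt0.
  (* Passing from [X] to [X / a] costs at most a factor 7 in the level, which the 7 in the bound for
     [W] pays. *)
  apply: (@le_trans _ _ (expR ((theta - eps) * y) / 7)); last first.
    have -> : (7 : R)^-1 = expR (- ln 7) by rewrite expRN lnK ?posrE.
    rewrite -expRD ler_expR mulrBr lerD2l lerN2.
    have la7 : ln a%:R <= ln 7 :> R by rewrite ler_ln ?posrE.
    apply: le_trans la7; rewrite -[leRHS]mul1r ler_wpM2r //; clear -t1 e0; lra.
  rewrite ler_pdivlMr //.
  have -> : (theta - eps) * y = eps * y + (theta - 2 * eps) * y by ring.
  by rewrite expRD mulrAC ler_wpM2r ?expR_ge0 // mulrC.
rewrite lnx -[leRHS]mulrA.
(* Hence [ln (X / a)] is at least half of [ln X], whence the factor [2 ^+ 13] in the constant. *)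
have yl : y / 2 <= y - ln a%:R by clear -lna y14; lra.
have y2 : 0 < y / 2 by rewrite divr_gt0.
have yl0 := lt_le_trans y2 yl.
apply: le_trans (ler_wpM2r _ (ler_norm C)) _.
  by rewrite !divr_ge0 ?exprn_ge0 ?(ltW yl0) ?(ltW aR).
apply: ler_wpM2l => //.
have -> : 2 ^+ 13 * (X%:R / y ^+ 13) = X%:R * (y / 2) ^- 13 :> R.
  by field; rewrite gt_eqF.
apply: ler_pM; rewrite ?invr_ge0 ?exprn_ge0 ?divr_ge0 ?(ltW yl0) ?(ltW aR) //.
  by rewrite ler_pdivrMr // ler_peMr.
rewrite lef_pV2 ?posrE ?exprn_gt0 //.
by rewrite lerXn2r ?nnegrE ?(ltW y2) ?(ltW yl0).
Qed.

Lemma exists_scale (R : realType) (N : nat) (Q : R) : exists2 X : nat, (N <= X)%N & Q <= ln X%:R.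
Proof.
exists ((Num.truncn (expR Q)).+1 + N)%N; first exact: leq_addl.
rewrite -[leLHS]expRK ler_ln ?posrE ?expR_gt0 ?ltr0n //.
by apply: le_trans (ltW (truncnS_gt _)) _; rewrite ler_nat leq_addr.
Qed.

Lemma two_primes (R : realType) (theta : R) : (75 - Num.sqrt 473) / 56 < theta -> theta <= 1 ->
  BV theta -> forall N0, exists n m m' q q', [/\ (N0 <= n)%N, m <> m', prime q, prime q' &
    (n + shift m = multiplier m * q)%N /\ (n + shift m' = multiplier m' * q')%N].
Proof.
move=> /critical_level tc t1 bv N0; apply: contrapT => none.
have uniq n m m' q q' : (N0 <= n)%N -> prime q -> prime q' ->
    (n + shift m = multiplier m * q)%N -> (n + shift m' = multiplier m' * q')%N -> m = m'.
  move=> n1 p p' e e'; apply: contrapT => mm; apply: none.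
  by exists n, m, m', q, q'.
have [J JE] : exists J : R, J = 1 / (60 * 99) by eexists.
have [I IE] : exists I : R, I = 29 / (240 * 252) by eexists.
have I0 : 0 < I by rewrite IE; lra.
have J1 : J <= 1 by rewrite JE; lra.
have [eps [d [e0 d0 Jd vt0 gap]]] := sieve_parameters JE IE tc t1.
(* The order of choices matters: [D] depends only on [d], then [W] on [D], and only afterwards is
   [X] taken large in terms of [W]. *)
have [D D11 Dd] : exists2 D : nat, (11 < D)%N & 6 ^+ 2 * 2 ^+ 7 * (116 / D%:R) <= d.
  pose t := 6 ^+ 2 * 2 ^+ 7 * 116 / d; exists (Num.truncn t + 12)%N; first by rewrite addnS ltnS leq_addl.
  have := truncnS_gt t; rewrite /t ltr_pdivrMr // => tt.
  have D0 : (0 : R) < (Num.truncn t + 12)%N%:R by rewrite ltr0n addnS.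
  rewrite mulrA ler_pdivrMr // [leRHS]mulrC; apply: (le_trans (ltW tt)).
  by rewrite ler_wpM2r ?(ltW d0) // ler_nat -addn1 leq_add2l.
have [W [v [W0 Wpr ar]]] := @residue_class D (ltnW D11).
have [Wm /choice[b arith]] := choice ar.
have [L1 L1_1 sqr] := square_sum_limit W0 d0; rewrite -IE in sqr.
have [L2 L2_1 fib] := fibre_square_sum_limit W0 d0; rewrite -JE in fib.
have [C [x0 [C0 err]]] := bv_error_scaled t1 bv e0.
have e2 : 0 < 2 * eps by rewrite mulr_gt0.
have [Y1 H1] := @pow_le_exp R 0 (7 * W%:R) eps e0.
have [Y2 H2] := @pow_le_exp R 18 (6 ^+ 2 * 2 ^+ 24 * W%:R / d) (2 * eps) e2.
have [Y3 H3] := @pow_le_exp R 0 (6 * (I + d) / d) 1 ltr01.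
have [B BE] : exists B, B = 6 ^+ 2 * 2 ^+ 12 * C * W%:R by eexists.
have B0 : 0 <= B by rewrite BE; do 3?[apply: mulr_ge0]; rewrite ?exprn_ge0.
have dV : 0 < 2 / d by rewrite divr_gt0.
have [X XN Xy] := exists_scale (N0 + 50)
  (`|Y1| + `|Y2| + `|Y3| + `|x0| + 5 * (L1 + L2 + 2) + B + 2 / d + 14).
have [y yE] : exists y : R, y = ln X%:R by eexists.
have [[y1 y2 y3 yx] [y14 yL yB yd]] : [/\ Y1 <= y, Y2 <= y, Y3 <= y & x0 <= y] /\
    [/\ 14 <= y, 5 * (L1 + L2 + 2) <= y, B <= y & 2 <= y * d].
  rewrite -ler_pdivrMr //; rewrite -yE in Xy; move: (2 / d) dV Xy => dV dV0 Xy.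
  have := (normr_ge0 Y1, normr_ge0 Y2, normr_ge0 Y3, normr_ge0 x0) => -[[[]]].
  have := (ler_norm Y1, ler_norm Y2, ler_norm Y3, ler_norm x0) => -[[[]]].
  clear -Xy B0 dV0 L1_1 L2_1; move: `|Y1| `|Y2| `|Y3| `|x0| Xy => n1 n2 n3 n4 Xy *.
  by split; split; lra.
have y0 : 0 < y by clear -y14; lra.
have X50 : (49 <= X)%N by clear -XN; lia.
have X0 : (0 : R) < X%:R by rewrite ltr0n (leq_trans _ X50).
have Xexp : expR y = X%:R by rewrite yE lnK.
have {}H1 : 7 * W%:R <= expR (eps * y) by have := H1 y y1; rewrite expr0 mulr1.
have {}H3 : 6 * (I + d) <= X%:R * d.
  by have := H3 y y3; rewrite expr0 mulr1 mul1r Xexp ler_pdivrMr.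
have {}H2 := H2 y y2.
have vtE : 2 * ((theta / 2 - eps) * y) = (theta - 2 * eps) * y by field.
have vt1 : theta / 2 - eps <= 1 / 2 by clear -t1 e0; lra.
move: (theta / 2 - eps) vtE vt1 vt0 gap => vt vtE vt1 vt0 gap.
have [Z [Z0 Z7 Zsq /andP[Ll Lu]]] := sieve_level y14 vt0 vt1.
rewrite vtE in Zsq; rewrite Xexp in Z7.
have [L LE] : exists L : R, L = ln Z%:R by eexists.
rewrite -LE in Ll Lu.
have vy : y / 5 <= vt * y <= y / 2.
  by have := ler_wpM2r (ltW y0) vt0; have := ler_wpM2r (ltW y0) vt1; clear; lra.
have [L1L L2L L0 Ly] : [/\ L1 <= L, L2 <= L, 0 < L & L <= y].
  by clear -vy Ll Lu yL y0 L1_1 L2_1; case/andP: vy => *; split; lra.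
have LZ1 : 1 <= ln (Z%:R : R) by rewrite -LE (le_trans L1_1).
have {}sqr := sqr Z; rewrite -LE in sqr; have {}sqr := sqr L1L.
have {}fib := fib Z; rewrite -LE in fib; have {fib} [massle fib] := fib L2L.
have rho0 : 0 < cop_density R W by exact: cop_density_gt0.
have [tau tauE] : exists tau, tau = cop_density R W * L by eexists.
rewrite -tauE in sqr massle fib.
have tau0 : 0 < tau by rewrite tauE mulr_gt0.
have tauy : tau <= y.
  apply: le_trans Ly; rewrite tauE -[leRHS]mul1r ler_wpM2r ?(ltW L0) //.
  by have /andP[] := cop_density_bound R W0.
have phiE : (totient W)%:R = cop_density R W * W%:R by rewrite /cop_density mulfVK // pnatr_eq0 -lt0n.
pose E := C * (X%:R / y ^+ 13).
have E0 : 0 <= E by rewrite mulr_ge0 // divr_ge0 ?exprn_ge0 ?(ltW y0).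
have Z7n : (7 * Z <= X)%N by rewrite -(ler_nat R) natrM.
have uniqX n m m' q q' : (X - 5 <= n)%N -> prime q -> prime q' ->
    (n + shift m = multiplier m * q)%N -> (n + shift m' = multiplier m' * q')%N -> m = m'.
  by move=> nX; apply: uniq; clear -nX XN; lia.
have := sieve_inequality D11 W0 Wpr arith LZ1 Z7n X50 uniqX.
rewrite -yE natrD => ineq.
have := @normalised_inequality R I J d (116 / D%:R) E 1 X%:R W%:R (totient W)%:R
  (cop_density R W) y L tau (mass R Z W) Z%:R X0 _ rho0 phiE tauE tau0 (ltW y0) _ _ Dd H3 _ E0 _ _.
have W0R : (0 : R) < W%:R by rewrite ltr0n.
have tau_pow n : tau ^+ n <= y ^+ n by rewrite lerXn2r ?nnegrE ?(ltW tau0) ?(ltW y0).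
move=> /(_ W0R) final; have {final} : 6 * (L * (J - 2 * d) - 1) <= y * (I + 3 * d).
  apply: final.
  - by rewrite mass_ge0.
  - by rewrite divr_ge0.
  - apply: (@le_trans _ _ (6 ^+ 2 * 2 ^+ 12 * y ^+ 6 * E * W%:R)).
      apply: ler_wpM2r => //; apply: ler_wpM2r => //; apply: ler_wpM2l (tau_pow 6).
      by apply: mulr_ge0; exact: exprn_ge0.
    have -> : 6 ^+ 2 * 2 ^+ 12 * y ^+ 6 * E * W%:R = X%:R * (B / y ^+ 7).
      by rewrite BE /E; field; rewrite gt_eqF.
    rewrite ler_wpM2l // ler_pdivrMr ?exprn_gt0 // mul1r.
    by apply: le_trans yB _; rewrite -[leLHS]expr1 ler_eXn2l //; clear -y14; lra.
  - apply: (@le_trans _ _ (6 ^+ 2 * 2 ^+ 24 * y ^+ 18 * expR ((theta - 2 * eps) * y) * W%:R)).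
      apply: ler_wpM2r => //; apply: ler_pM Zsq; rewrite ?sqr_ge0 //.
        by apply: mulr_ge0; [apply: mulr_ge0|]; rewrite exprn_ge0 // ltW.
      by apply: ler_wpM2l (tau_pow 18); apply: mulr_ge0; exact: exprn_ge0.
    have -> : 6 ^+ 2 * 2 ^+ 24 * y ^+ 18 * expR ((theta - 2 * eps) * y) * W%:R =
        d * expR ((theta - 2 * eps) * y) * (6 ^+ 2 * 2 ^+ 24 * W%:R / d * y ^+ 18).
      by field; rewrite gt_eqF.
    apply: le_trans (ler_wpM2l _ H2) _; first by rewrite mulr_ge0 ?expR_ge0 // ltW.
    rewrite -mulrA -expRD mulrC ler_wpM2r ?(ltW d0) // -Xexp ler_expR.
    have -> : (theta - 2 * eps) * y + 2 * eps * y = theta * y by ring.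
    by rewrite -[leRHS]mul1r ler_wpM2r // ltW.
  apply: (le_trans (le_trans _ ineq)); last first.
    apply: ler_wpM2l; first exact: ltW.
    by rewrite lerD2r ler_wpM2l // divr_ge0 // addr_ge0.
  have sum6 (c : R) : 6 * c = \sum_(m < 6) c by rewrite sumr_const card_ord mulr_natl.
  rewrite [leLHS]sum6; apply: ler_sum => m _; apply: lerB.
    apply: ler_wpM2l; first by rewrite divr_ge0.
    by apply: lerB.
  apply: ler_wpM2l; first exact: sqr_ge0.
  have [WE _ _ _] := arith m; have [pa a7] := multiplier_bound m.
  by rewrite /E yE; apply: (err X D W) => //; rewrite -?yE.
apply/negP; rewrite -ltNge.
(* From [L >= vt * y - 1] and [gap] the left side is at least [y * (I + 15 * d) - 12], which exceeds
   [y * (I + 3 * d)] because [y * d >= 2]. *)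
have s0 : 0 <= J - 2 * d by rewrite subr_ge0 ltW.
have := ler_wpM2r s0 Ll; have := ler_wpM2l (ltW y0) gap.
by clear -yd J1 d0; lra.
Qed.

(** * Gaps between products of two primes *)

Lemma isE2_mul p q : prime p -> prime q -> (p < q)%N -> isE2 (p * q).
Proof.
move=> pp pq lt; have p0 := prime_gt0 pp; have q0 := prime_gt0 pq.
have Hp : (p < (p * q).+1)%N by rewrite ltnS leq_pmulr.
have Hq : (q < (p * q).+1)%N by rewrite ltnS leq_pmull.
by apply/existsP; exists (Ordinal Hp); apply/existsP; exists (Ordinal Hq); rewrite /= pp pq lt eqxx.
Qed.

Definition countE2 m := count isE2 (iota 0 m).

Lemma countE2S m : countE2 m.+1 = (countE2 m + isE2 m)%N.
Proof. by rewrite /countE2 -addn1 iotaD count_cat /= addn0. Qed.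

Lemma countE2_mono : {homo countE2 : m n / (m <= n)%N}.
Proof. by apply: homo_leq => // [m n p|m]; [exact: leq_trans | rewrite countE2S leq_addr]. Qed.

Lemma qE2_countE2 m : isE2 m -> qE2 (countE2 m) = m.
Proof.
have lt n n' : isE2 n -> (n < n')%N -> (countE2 n < countE2 n')%N.
  by move=> En /countE2_mono; rewrite countE2S En addn1.
move=> Em; apply: xget_unique => [|n /andP[En /eqP e]]; first by rewrite /= Em eqxx.
have {}e : countE2 n = countE2 m := e.
by case: (ltngtP n m) => // [/(lt _ _ En)|/(lt _ _ Em)]; rewrite e ltnn.
Qed.

Lemma qE2_gap_le m n : isE2 m -> isE2 n -> (m < n)%N ->
  (qE2 (countE2 m).+1 - qE2 (countE2 m) <= n - m)%N /\
  (qE2 (countE2 m) < qE2 (countE2 m).+1)%N.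
Proof.
(* The next term is the least such integer [k] above [m]; the count is constant between [m] and [k],
   so [k] has index [(countE2 m).+1]. *)
move=> Em En mn; have ex : exists k, (m < k)%N && isE2 k by exists n; rewrite mn En.
case: (ex_minnP ex) => k /andP[mk Ek] kmin.
have -> : (countE2 m).+1 = countE2 k.
  have : forall j, (m < j)%N -> (j <= k)%N -> countE2 j = (countE2 m).+1.
    elim=> // j IH; rewrite ltnS leq_eqVlt => /orP[/eqP <- _|mj jk].
      by rewrite countE2S Em addn1.
    rewrite countE2S IH ?(ltnW jk) //; case: (boolP (isE2 j)) => // Ej; last by rewrite addn0.
    by have := kmin j; rewrite mj Ej => /(_ isT); rewrite leqNgt jk.
  by move=> H; rewrite (H k).
rewrite !qE2_countE2 // mk; split=> //; apply: leq_sub2r.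
by apply: kmin; rewrite mn En.
Qed.

(** The lower limit is the supremum of the infima of the tails, and every tail contains a term at
    most [l]. *)
Lemma limn_einf_le (R : realType) (u : nat -> \bar R) (l : \bar R) :
  (forall N, exists2 n, (N <= n)%N & (u n <= l)%E) -> (limn_einf u <= l)%E.
Proof.
move=> H; rewrite limn_einf_lim (cvg_lim _ (@cvg_einfs_sup R u)) //.
apply: ge_ereal_sup => _ [N _ <-]; have [n Nn un] := H N.
by apply: le_trans un; apply: ereal_inf_lbound; exists n.
Qed.

Lemma qE2_gaps (M : nat) :
  (forall N, exists m n, [/\ (N <= m)%N, isE2 m, isE2 n & (m < n <= m + M)%N]) ->
  forall N, exists n, [/\ (N <= n)%N, (qE2 n <= qE2 n.+1)%N & (qE2 n.+1 - qE2 n <= M)%N].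
Proof.
move=> H N; have [m0 Nm0] : exists m0, (N <= countE2 m0)%N.
  elim: N => [|N [m0 IH]]; first by exists 0%N.
  have [m [_ [mm Em _ _]]] := H m0; exists m.+1.
  by rewrite countE2S Em addn1 ltnS (leq_trans IH) // countE2_mono.
have [m [n [mm Em En /andP[mn nm]]]] := H m0; exists (countE2 m).
have [gap lt] := qE2_gap_le Em En mn; split; last first.
- by apply: leq_trans gap _; rewrite leq_subLR.
- exact: ltnW.
- by apply: leq_trans Nm0 _; exact: countE2_mono.
Qed.

Lemma consecutive_E2 (R : realType) (theta : R) :
  (75 - Num.sqrt 473) / 56 < theta -> theta <= 1 -> BV theta ->
  forall N, exists m n, [/\ (N <= m)%N, isE2 m, isE2 n & (m < n <= m + 6)%N].
Proof.
(* From [n >= 56] and multipliers at most 7 the prime cofactor is at least 8, hence larger than the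
   multiplier, and the two primes are distinct. *)
move=> ht t1 bv N; have [n [i [j [q [q' [nN ij pq pq' [eq eq']]]]]]] := two_primes ht t1 bv (N + 56).
have large k p : prime p -> (n + shift k = multiplier k * p)%N -> isE2 (n + shift k).
  move=> pp e; have [pa a7] := multiplier_bound k; rewrite e; apply: isE2_mul => //.
  apply: (leq_ltn_trans a7); move: e a7; clear -nN; nia.
have Ei := large i q pq eq; have Ej := large j q' pq' eq'.
have si := shift_lt i; have sj := shift_lt j.
have [lt|lt|/shift_inj //] := ltngtP (shift i) (shift j).
  exists (n + shift i)%N, (n + shift j)%N; split=> //; clear -nN si sj lt; lia.
exists (n + shift j)%N, (n + shift i)%N; split=> //; clear -nN si sj lt; lia.
Qed.

Theorem theorem4 (R : realType) (theta : R) :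
  (75 - Num.sqrt 473) / 56 < theta -> theta <= 1 ->
  BV theta -> BV2 theta ->
  (limn_einf (fun n : nat => (((qE2 n.+1)%:R - (qE2 n)%:R : R))%:E)
     <= (6 : R)%:E)%E.
Proof.
move=> ht t1 bv _; apply: limn_einf_le => N.
have [n [Nn le gap]] := qE2_gaps (consecutive_E2 ht t1 bv) N.
by exists n; rewrite // lee_fin -natrB // ler_nat.
Qed.
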